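(* Fix $T>0$, $0\leq t<T$, $\tau=T-t$, $r\geq 0$, $\sigma>0$, and $M_t\geq S_t>0$. For $n\in\mathbb{N}$ let $P^{fl}_n(t)$ be the $n$-period binomial price of the European lookback put with floating strike at time $t$ (defined in the context). Then, as $n\to\infty$: (i) if $r>0$, \[ \begin{split} P_{n}^{fl}(t)&=P^{fl}_{BS}(t)-S_t\frac{\sigma\sqrt{\tau}}{2}\big(\theta_1 B_1+\theta_2 B_3\big)\frac{1}{\sqrt{n}}\\ &\quad+\Big[S_t\frac{\sigma^2 \tau}{12}\Big((\theta_1+2)B_1+(\theta_2+2-T_1)B_3\Big)+M_t T_2 B_4\Big]\frac{1}{n}+O\Bigl(\frac{1}{n^{3/2}}\Bigr), \end{split} \] where $P^{fl}_{BS}(t)=-S_t+S_t \theta_1 B_1+M_t B_2-S_t(1-\theta_2)B_3$, $\theta_1=1+\frac{\sigma^2}{2r}$, $\theta_2=1-\frac{\sigma^2}{2r}$, $B_1=\Phi(d_1)$, $B_2=e^{-r\tau}\Phi(-d_2)$, $B_3=e^{-r\tau}\big(\frac{S_t}{M_t}\big)^{-2r/\sigma^2}\Phi(-d_3)$, $B_4=\sigma\sqrt{\tau}\big(\frac{S_t}{M_t}\big)^{(1-2r/\sigma^2)/2}\frac{e^{-\frac{1}{4}(d_1^2+d_4^2)}}{\sqrt{2\pi}}$, $T_1=\frac{12r}{\sigma^2}\theta_2\kappa_n-(1+\frac{4r^2}{\sigma^4})\log\frac{S_t}{M_t}$ and $T_2=\frac{1}{2}+\kappa_n+\frac{d_4}{6\sigma\sqrt{\tau}}\log\frac{S_t}{M_t}$;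 (ii) if $r=0$, \[ \begin{split} P_{n}^{fl}(t)&=P^{fl}_{BS}(t)-S_t\frac{\sigma\sqrt{\tau}}{2}\big(2B_1+B_3^*+B_4^*\big)\frac{1}{\sqrt{n}}\\ &\quad+\Big[S_t\frac{\sigma^2 \tau}{6}\Big(\big( 3+3\kappa_n-\frac{\sigma^2 \tau}{4}\big)B_1+B_3^*\Big)+S_t T_2^* B_4^*\Big]\frac{1}{n}+O\Bigl(\frac{1}{n^{3/2}}\Bigr), \end{split} \] where $P^{fl}_{BS}(t)=-S_t+S_t B_1+M_t B_2+S_t(B_3^*+B_4^* )$, $B_1=\Phi(d_1)$, $B_2=e^{-r\tau}\Phi(-d_2)$ (so $B_2=\Phi(-d_2)$), $B_3^*=\big(\log\frac{S_t}{M_t}+\frac{\sigma^2\tau}{2}\big)\Phi(d_1)$, $B_4^*=\sigma\sqrt{\tau}\frac{e^{-d_1^2/2}}{\sqrt{2\pi}}$ and $T_2^*=\frac{1}{2}+\kappa_n+\frac{\sigma^2 \tau}{12}-\frac{d_2}{6\sigma\sqrt{\tau}}\log\frac{S_t}{M_t}$.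
   Context: $S_t$ is the price of the underlying at time $t$ and $M_t=\max_{t^*\leq t}S_{t^*}$ its running maximum. Binomial model: $u=e^{\sigma\sqrt{\tau/n}}$, $d=u^{-1}$, $p=\frac{e^{r\tau/n}-d}{u-d}$ (with $n$ large enough that $0<p<1$), $q=\frac{u-e^{-r\tau/n}}{u-d}$, and $j_0=\frac{\log(M_t/S_t)}{\sigma\sqrt{\tau/n}}$. Consider the directed graph with initial node $(0,j_0)$ in which, from each node $(m,j_m)$ with $0\leq m<n$, there is an ''up'' edge to $(m+1,j_m+1)$ and a ''down'' edge to $(m+1,\max(j_m-1,0))$; let $\Lambda^{j_0}_{j,k,n}$ be the number of paths from $(0,j_0)$ to $(n,j)$ with exactly $k$ up jumps, and $J$ the set of reachable terminal levels $j$. The discrete price is $P^{fl}_n(t) = S_t \sum_{j\in J} (u^{j}-1)\sum_{k=0}^n \Lambda^{j_0}_{j,k,n} (1-q)^{k}q^{n-k}$. Further, $\kappa_n=\{j_0\}(1-\{j_0\})$ where $\{x\}=x-\lfloor x\rfloor$ is the fractional part, $\Phi$ is the standard normal distribution function, and $d_1=\frac{1}{\sigma\sqrt{\tau}}\big(\log\frac{S_t}{M_t}+(r+\frac{\sigma^2}{2})\tau\big)$, $d_2=d_1-\sigma\sqrt{\tau}$, $d_3=-d_1+\frac{2r}{\sigma}\sqrt{\tau}$, $d_4=d_3+\sigma\sqrt{\tau}$. *)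

(* Defs.v *)
From Stdlib Require Import Reals Lra List.
From Coquelicot Require Import Coquelicot.
Open Scope R_scope.

Definition fracR (x : R) : R := x - IZR (Int_part x).

Definition Phi (x : R) : R :=
  / sqrt (2 * PI) *
  RInt_gen (fun y => exp (- y ^ 2 / 2)) (Rbar_locally m_infty) (at_point x).

Definition dt (tau : R) (n : nat) : R := tau / INR n.
Definition u_n (sigma tau : R) (n : nat) : R := exp (sigma * sqrt (dt tau n)).
Definition d_n (sigma tau : R) (n : nat) : R := / u_n sigma tau n.
Definition p_n (r sigma tau : R) (n : nat) : R :=
  (exp (r * dt tau n) - d_n sigma tau n) / (u_n sigma tau n - d_n sigma tau n).
Definition q_n (r sigma tau : R) (n : nat) : R :=
  (u_n sigma tau n - exp (- r * dt tau n)) / (u_n sigma tau n - d_n sigma tau n).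
Definition j0_n (S M sigma tau : R) (n : nat) : R :=
  ln (M / S) / (sigma * sqrt (dt tau n)).

(** A path of length n is a list of n moves (true = up, false = down), first move first. *)
Fixpoint all_paths (n : nat) : list (list bool) :=
  match n with
  | O => nil :: nil
  | S m => map (cons true) (all_paths m) ++ map (cons false) (all_paths m)
  end.

Definition step (j : R) (b : bool) : R := if b then j + 1 else Rmax (j - 1) 0.
Definition endpoint (j0 : R) (p : list bool) : R := fold_left step p j0.
Definition nups (p : list bool) : nat := count_occ Bool.bool_dec p true.

Definition Lambda (j0 j : R) (k n : nat) : nat :=
  length (filter (fun p => andb (if Req_EM_T (endpoint j0 p) j then true else false)
                                (Nat.eqb (nups p) k))
                 (all_paths n)).

Definition reach_levels (j0 : R) (n : nat) : list R :=
  nodup Req_EM_T (map (endpoint j0) (all_paths n)).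

Definition sumR (l : list R) : R := fold_right Rplus 0 l.

Definition P_fl (S M r sigma tau : R) (n : nat) : R :=
  let u := u_n sigma tau n in
  let q := q_n r sigma tau n in
  let j0 := j0_n S M sigma tau n in
  S * sumR (map (fun j =>
          (Rpower u j - 1) *
          sum_f_R0 (fun k => INR (Lambda j0 j k n) * (1 - q) ^ k * q ^ (n - k)) n)
        (reach_levels j0 n)).

Definition kappa_n (S M sigma tau : R) (n : nat) : R :=
  fracR (j0_n S M sigma tau n) * (1 - fracR (j0_n S M sigma tau n)).

Definition d1 (S M r sigma tau : R) : R :=
  / (sigma * sqrt tau) * (ln (S / M) + (r + sigma ^ 2 / 2) * tau).
Definition d2 (S M r sigma tau : R) : R := d1 S M r sigma tau - sigma * sqrt tau.
Definition d3 (S M r sigma tau : R) : R := - d1 S M r sigma tau + 2 * r / sigma * sqrt tau.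
Definition d4 (S M r sigma tau : R) : R := d3 S M r sigma tau + sigma * sqrt tau.

Definition theta1 (r sigma : R) : R := 1 + sigma ^ 2 / (2 * r).
Definition theta2 (r sigma : R) : R := 1 - sigma ^ 2 / (2 * r).
Definition B1 (S M r sigma tau : R) : R := Phi (d1 S M r sigma tau).
Definition B2 (S M r sigma tau : R) : R := exp (- r * tau) * Phi (- d2 S M r sigma tau).
Definition B3 (S M r sigma tau : R) : R :=
  exp (- r * tau) * Rpower (S / M) (- (2 * r / sigma ^ 2)) * Phi (- d3 S M r sigma tau).
Definition B4 (S M r sigma tau : R) : R :=
  sigma * sqrt tau * Rpower (S / M) ((1 - 2 * r / sigma ^ 2) / 2) *
  (exp (- / 4 * (d1 S M r sigma tau ^ 2 + d4 S M r sigma tau ^ 2)) / sqrt (2 * PI)).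
Definition T1 (S M r sigma tau : R) (n : nat) : R :=
  12 * r / sigma ^ 2 * theta2 r sigma * kappa_n S M sigma tau n
  - (1 + 4 * r ^ 2 / sigma ^ 4) * ln (S / M).
Definition T2 (S M r sigma tau : R) (n : nat) : R :=
  / 2 + kappa_n S M sigma tau n + d4 S M r sigma tau / (6 * sigma * sqrt tau) * ln (S / M).

Definition PBS_pos (S M r sigma tau : R) : R :=
  - S + S * theta1 r sigma * B1 S M r sigma tau + M * B2 S M r sigma tau
  - S * (1 - theta2 r sigma) * B3 S M r sigma tau.

Definition expansion_pos (S M r sigma tau : R) (n : nat) : R :=
  PBS_pos S M r sigma tau
  - S * (sigma * sqrt tau / 2)
      * (theta1 r sigma * B1 S M r sigma tau + theta2 r sigma * B3 S M r sigma tau)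
      * (1 / sqrt (INR n))
  + (S * (sigma ^ 2 * tau / 12)
       * ((theta1 r sigma + 2) * B1 S M r sigma tau
          + (theta2 r sigma + 2 - T1 S M r sigma tau n) * B3 S M r sigma tau)
     + M * T2 S M r sigma tau n * B4 S M r sigma tau) * (1 / INR n).

Definition B3s (S M r sigma tau : R) : R :=
  (ln (S / M) + sigma ^ 2 * tau / 2) * Phi (d1 S M r sigma tau).
Definition B4s (S M r sigma tau : R) : R :=
  sigma * sqrt tau * (exp (- d1 S M r sigma tau ^ 2 / 2) / sqrt (2 * PI)).
Definition T2s (S M r sigma tau : R) (n : nat) : R :=
  / 2 + kappa_n S M sigma tau n + sigma ^ 2 * tau / 12
  - d2 S M r sigma tau / (6 * sigma * sqrt tau) * ln (S / M).

Definition PBS_zero (S M r sigma tau : R) : R :=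
  - S + S * B1 S M r sigma tau + M * B2 S M r sigma tau
  + S * (B3s S M r sigma tau + B4s S M r sigma tau).

Definition expansion_zero (S M r sigma tau : R) (n : nat) : R :=
  PBS_zero S M r sigma tau
  - S * (sigma * sqrt tau / 2)
      * (2 * B1 S M r sigma tau + B3s S M r sigma tau + B4s S M r sigma tau)
      * (1 / sqrt (INR n))
  + (S * (sigma ^ 2 * tau / 6)
       * ((3 + 3 * kappa_n S M sigma tau n - sigma ^ 2 * tau / 4) * B1 S M r sigma tau
          + B3s S M r sigma tau)
     + S * T2s S M r sigma tau n * B4s S M r sigma tau) * (1 / INR n).

Definition bigO_n32 (f g : nat -> R) : Prop :=
  exists C : R, exists N : nat, forall n : nat, (N <= n)%nat ->
    Rabs (f n - g n) <= C / (INR n * sqrt (INR n)).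

(* Main.v *)
Require Import Defs.
From Stdlib Require Import Reals Lra Lia ZArith List.
From Coquelicot Require Import Coquelicot.
Open Scope R_scope.

(** After the change of numeraire the price is [S (E u^(j_n) - 1)] for a random walk reflected at
    [0]. By the reflection principle and exponential tilting, [E u^(j_n)] is a combination of four
    binomial tails at the level [K = floor j0 + 1]; this closed form is verified through the
    first-step recursion, where the reflection at [0] becomes the equality of the formulas for
    [K = 0] and for [K = 1, j = 0]. When [r = 0] the geometric weights degenerate and one tail is
    replaced by a mean excess.

    The tails are expanded without estimating the law of the walk far from its centre. At parameter
    [1/2] the local probabilities follow from Wallis' product and the exact ratio of consecutive
    binomial weights, and the tail from the symmetry [P (Y >= k) + P (Y >= 2 - k) = 1], for [k] of the parity of [n], by
    telescoping over [O(sqrt n)] steps; the drift is then switched on by integrating the explicit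
    derivative of the tail in the step probability. With [s = 1 / sqrt n], [y] the rescaled midpoint
    between the two lattice points at the threshold and [eta] the rescaled drift, the tail is
    [1 - Phi (y - eta) + s^2 phi (y - eta) R (y, eta) + O(s^3)] for a cubic polynomial [R].

    The parity of [n + K] enters these expansions through a bounded coefficient with values [0] and
    [1], and drops out of the combination that gives the price. *)

(** * Uniform asymptotic expansions *)

(** The rounding [w = 1 - frac j0] and the parity of [n + K] oscillate with [n] and have no limit,
    so the coefficients of the expansions are bounded functions of the index and not constants. In
    the coefficient of the Gaussian density at order [1 / n] they survive only as a multiple of
    [w (1 - w) + pi (1 - pi)], where [pi] in {0, 1} marks the parity: the first summand is
    [kappa_n], the second is zero. The orders are budgeted backwards from the error [s^3] of the
    price. Telescoping a tail over [O(1 / s)] lattice points loses one power of [s], so local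
    probabilities, themselves of size [s], must be known up to [O(s^4)]. For the central weight the
    limit in Wallis' product is then not enough: the next term, the [1/4] in [PI (m + 1/4)], is
    needed as well, and two monotone sequences with a common limit supply it. *)

Section Asymptotics.

Context {I : Type} (s : I -> R) (D : I -> Prop).

Definition bigO (m : nat) (F : I -> R) : Prop :=
  exists C d, 0 < d /\ 0 <= C /\
    forall i, D i -> 0 < s i <= d -> Rabs (F i) <= C * s i ^ m.

Lemma bigO_ext m F G :
  (exists d, 0 < d /\ forall i, D i -> 0 < s i <= d -> F i = G i) ->
  bigO m F -> bigO m G.
Proof.
  intros [d0 [Hd0 E]] [C [d [Hd [HC H]]]].
  exists C, (Rmin d0 d). split; [apply Rmin_pos; auto|split; auto].
  intros i Di [Hs Hsd].
  pose proof (Rmin_l d0 d). pose proof (Rmin_r d0 d).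
  rewrite <- E by (auto; lra). apply H; auto; lra.
Qed.

Lemma bigO_eq m F G : (forall i, F i = G i) -> bigO m F -> bigO m G.
Proof.
  intros E. apply bigO_ext. exists 1. split; [lra|auto].
Qed.

Lemma bigO_le m F G :
  (exists d, 0 < d /\ forall i, D i -> 0 < s i <= d -> Rabs (F i) <= Rabs (G i)) ->
  bigO m G -> bigO m F.
Proof.
  intros [d0 [Hd0 E]] [C [d [Hd [HC H]]]].
  exists C, (Rmin d0 d). split; [apply Rmin_pos; auto|split; auto].
  intros i Di [Hs Hsd].
  pose proof (Rmin_l d0 d). pose proof (Rmin_r d0 d).
  eapply Rle_trans; [apply E; auto; lra|]. apply H; auto; lra.
Qed.

Lemma bigO_plus m F G : bigO m F -> bigO m G -> bigO m (fun i => F i + G i).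
Proof.
  intros [C [d [Hd [HC H]]]] [C' [d' [Hd' [HC' H']]]].
  exists (C + C'), (Rmin d d'). split; [apply Rmin_pos; auto|split; [lra|]].
  intros i Di [Hs Hsd].
  pose proof (Rmin_l d d'). pose proof (Rmin_r d d').
  eapply Rle_trans; [apply Rabs_triang|].
  rewrite Rmult_plus_distr_r. apply Rplus_le_compat; [apply H|apply H']; auto; lra.
Qed.

Lemma bigO_mult m1 m2 F G :
  bigO m1 F -> bigO m2 G -> bigO (m1 + m2) (fun i => F i * G i).
Proof.
  intros [C [d [Hd [HC H]]]] [C' [d' [Hd' [HC' H']]]].
  exists (C * C'), (Rmin d d'). split; [apply Rmin_pos; auto|split; [nra|]].
  intros i Di [Hs Hsd].
  pose proof (Rmin_l d d'). pose proof (Rmin_r d d').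
  rewrite Rabs_mult, pow_add.
  replace (C * C' * (s i ^ m1 * s i ^ m2)) with ((C * s i ^ m1) * (C' * s i ^ m2)) by ring.
  apply Rmult_le_compat; try apply Rabs_pos; [apply H|apply H']; auto; lra.
Qed.

Lemma bigO_weaken m1 m2 F : (m2 <= m1)%nat -> bigO m1 F -> bigO m2 F.
Proof.
  intros L [C [d [Hd [HC H]]]].
  exists C, (Rmin d 1). split; [apply Rmin_pos; lra|split; auto].
  intros i Di [Hs Hsd].
  pose proof (Rmin_l d 1). pose proof (Rmin_r d 1).
  eapply Rle_trans; [apply H; auto; lra|]. apply Rmult_le_compat_l; auto.
  replace m1 with (m2 + (m1 - m2))%nat by lia. rewrite pow_add.
  rewrite <- (Rmult_1_r (s i ^ m2)) at 2.
  apply Rmult_le_compat_l; [apply pow_le; lra|].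
  rewrite <- (pow1 (m1 - m2)). apply pow_incr; lra.
Qed.

Lemma bigO_const c : bigO 0 (fun _ => c).
Proof.
  exists (Rabs c), 1. split; [lra|split; [apply Rabs_pos|]]. intros; simpl; lra.
Qed.

Lemma bigO_bounded F C : (forall i, D i -> Rabs (F i) <= C) -> bigO 0 F.
Proof.
  intros H. exists (Rmax C 0), 1. split; [lra|split; [apply Rmax_r|]].
  intros i Di _. simpl. pose proof (Rmax_l C 0). specialize (H i Di). lra.
Qed.

Lemma bigO_small m : bigO m (fun i => s i ^ m).
Proof.
  exists 1, 1. split; [lra|split; [lra|]].
  intros i _ [Hs _]. rewrite Rabs_pos_eq; [lra|apply pow_le; lra].
Qed.

Lemma bigO_scal m c F : bigO m F -> bigO m (fun i => c * F i).
Proof. intros H. apply (bigO_mult 0 m); [apply bigO_const|auto]. Qed.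

Lemma bigO_opp m F : bigO m F -> bigO m (fun i => - F i).
Proof. intros H. apply bigO_eq with (fun i => -1 * F i); [intros; ring|apply bigO_scal; auto]. Qed.

Lemma bigO_minus m F G : bigO m F -> bigO m G -> bigO m (fun i => F i - G i).
Proof. intros H H'. apply (bigO_plus m F (fun i => - G i)); auto. apply bigO_opp; auto. Qed.

Lemma bigO_pow F k : bigO 0 F -> bigO 0 (fun i => F i ^ k).
Proof.
  intros H. induction k; simpl; [apply bigO_const|]. apply (bigO_mult 0 0); auto.
Qed.

(** Boundedness of the coefficients is part of the definition, so that products and compositions
    stay in the class. As the coefficients may vary with the index, [F] does not determine them. *)
Definition ex3 (F a b c : I -> R) : Prop :=
  bigO 0 a /\ bigO 0 b /\ bigO 0 c /\
  bigO 3 (fun i => F i - (a i + b i * s i + c i * s i ^ 2)).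

Lemma ex3_eq F G a b c a' b' c' :
  (exists d, 0 < d /\ forall i, D i -> 0 < s i <= d ->
     F i = G i /\ a i = a' i /\ b i = b' i /\ c i = c' i) ->
  ex3 F a b c -> ex3 G a' b' c'.
Proof.
  intros [d [Hd E]] [Ha [Hb [Hc HF]]].
  split; [|split; [|split]].
  - apply bigO_ext with a; auto. exists d; split; auto; intros; apply E; auto.
  - apply bigO_ext with b; auto. exists d; split; auto; intros; apply E; auto.
  - apply bigO_ext with c; auto. exists d; split; auto; intros; apply E; auto.
  - eapply bigO_ext; [|apply HF]. exists d; split; auto. intros i Di Hi.
    destruct (E i Di Hi) as [-> [-> [-> ->]]]. reflexivity.
Qed.

Lemma ex3_coef F a b c a' b' c' :
  ex3 F a b c ->
  (forall i, D i -> a i = a' i) -> (forall i, D i -> b i = b' i) ->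
  (forall i, D i -> c i = c' i) -> ex3 F a' b' c'.
Proof.
  intros H E1 E2 E3. eapply ex3_eq; [|exact H]. exists 1. split; [lra|].
  intros; auto.
Qed.

Lemma ex3_fun F G a b c :
  (exists d, 0 < d /\ forall i, D i -> 0 < s i <= d -> F i = G i) ->
  ex3 F a b c -> ex3 G a b c.
Proof.
  intros [d [Hd E]]. apply ex3_eq. exists d. split; auto.
Qed.

Lemma ex3_base (a b c : I -> R) :
  bigO 0 a -> bigO 0 b -> bigO 0 c ->
  ex3 (fun i => a i + b i * s i + c i * s i ^ 2) a b c.
Proof.
  intros. split; [|split; [|split]]; auto.
  apply bigO_eq with (fun i => 0 * s i ^ 3); [intros; ring|]. apply bigO_scal, bigO_small.
Qed.

Lemma ex3_const c : ex3 (fun _ => c) (fun _ => c) (fun _ => 0) (fun _ => 0).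
Proof.
  eapply ex3_fun; [|apply ex3_base; apply bigO_const].
  exists 1; split; [lra|]; intros; simpl; ring.
Qed.

Lemma ex3_small : ex3 s (fun _ => 0) (fun _ => 1) (fun _ => 0).
Proof.
  eapply ex3_fun; [|apply ex3_base; apply bigO_const].
  exists 1; split; [lra|]; intros; simpl; ring.
Qed.

Lemma ex3_plus F G a b c a' b' c' :
  ex3 F a b c -> ex3 G a' b' c' ->
  ex3 (fun i => F i + G i) (fun i => a i + a' i) (fun i => b i + b' i) (fun i => c i + c' i).
Proof.
  intros [A1 [A2 [A3 A4]]] [B1 [B2 [B3 B4]]].
  split; [|split; [|split]]; [apply bigO_plus; auto|apply bigO_plus; auto|apply bigO_plus; auto|].
  eapply bigO_eq; [|apply (bigO_plus _ _ _ A4 B4)]. intros; simpl; ring.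
Qed.

Lemma ex3_opp F a b c :
  ex3 F a b c ->
  ex3 (fun i => - F i) (fun i => - a i) (fun i => - b i) (fun i => - c i).
Proof.
  intros [A1 [A2 [A3 A4]]].
  split; [|split; [|split]]; [apply bigO_opp; auto|apply bigO_opp; auto|apply bigO_opp; auto|].
  eapply bigO_eq; [|apply (bigO_opp _ _ A4)]. intros; simpl; ring.
Qed.

Lemma ex3_minus F G a b c a' b' c' :
  ex3 F a b c -> ex3 G a' b' c' ->
  ex3 (fun i => F i - G i) (fun i => a i - a' i) (fun i => b i - b' i) (fun i => c i - c' i).
Proof. intros H H'. apply (ex3_plus F (fun i => - G i)); auto. apply ex3_opp; auto. Qed.

Lemma ex3_bounded F a b c : ex3 F a b c -> bigO 0 F.
Proof.
  intros [A1 [A2 [A3 A4]]].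
  apply bigO_eq with (fun i => (F i - (a i + b i * s i + c i * s i ^ 2))
     + (a i + b i * s i ^ 1 + c i * s i ^ 2)); [intros; simpl; ring|].
  apply bigO_plus; [apply (bigO_weaken 3); auto; lia|].
  apply bigO_plus; [apply bigO_plus; auto|].
  - apply (bigO_weaken 1); [lia|]. apply (bigO_mult 0 1); auto. apply bigO_small.
  - apply (bigO_weaken 2); [lia|]. apply (bigO_mult 0 2); auto. apply bigO_small.
Qed.

Lemma ex3_mult F G a b c a' b' c' :
  ex3 F a b c -> ex3 G a' b' c' ->
  ex3 (fun i => F i * G i) (fun i => a i * a' i) (fun i => a i * b' i + b i * a' i)
      (fun i => a i * c' i + b i * b' i + c i * a' i).
Proof.
  intros HF HG. pose proof (ex3_bounded _ _ _ _ HG) as BG.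
  destruct HF as [A1 [A2 [A3 A4]]]. destruct HG as [B1 [B2 [B3 B4]]].
  split; [|split; [|split]].
  - apply (bigO_mult 0 0); auto.
  - apply bigO_plus; apply (bigO_mult 0 0); auto.
  - repeat apply bigO_plus; apply (bigO_mult 0 0); auto.
  (* With [P] and [Q] the two truncations, [F G - P Q = (F - P) G + P (G - Q)]; the last summand is
     the part of [P Q] of degree at least 3. *)
  - apply bigO_eq with (fun i =>
      (F i - (a i + b i * s i + c i * s i ^ 2)) * G i
      + (a i + b i * s i ^ 1 + c i * s i ^ 2) * (G i - (a' i + b' i * s i + c' i * s i ^ 2))
      + (b i * c' i + c i * b' i + c i * c' i * s i ^ 1) * s i ^ 3).
    { intros; simpl; ring. }
    assert (P : forall k f, bigO 0 f -> bigO 0 (fun i => f i * s i ^ k)).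
    { intros k f Hf. apply (bigO_weaken k); [lia|]. apply (bigO_mult 0 k); auto.
      apply bigO_small. }
    apply bigO_plus; [apply bigO_plus|].
    + apply (bigO_mult 3 0); auto.
    + apply (bigO_mult 0 3); auto. apply bigO_plus; auto. apply bigO_plus; auto.
    + apply (bigO_mult 0 3); [|apply bigO_small].
      apply bigO_plus; [apply bigO_plus; apply (bigO_mult 0 0); auto|].
      apply P. apply (bigO_mult 0 0); auto.
Qed.

Lemma ex3_bigO F a b c :
  bigO 0 a -> bigO 0 b -> bigO 0 c ->
  bigO 3 (fun i => F i - (a i + b i * s i + c i * s i ^ 2)) -> ex3 F a b c.
Proof. intros. repeat split; auto. Qed.

Lemma ex3_perturb F G a b c :
  bigO 3 (fun i => G i - F i) -> ex3 F a b c -> ex3 G a b c.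
Proof.
  intros HG [A1 [A2 [A3 A4]]]. repeat split; auto.
  eapply bigO_eq; [|apply (bigO_plus _ _ _ HG A4)]. intros; simpl; ring.
Qed.

End Asymptotics.

Arguments ex3_plus {I s D F G a b c a' b' c'}.
Arguments ex3_minus {I s D F G a b c a' b' c'}.
Arguments ex3_mult {I s D F G a b c a' b' c'}.
Arguments ex3_opp {I s D F a b c}.
Arguments ex3_bounded {I s D F a b c}.

(** Specializes a bound that is uniform over a large index set to a family inside it, as when [n] is
    sent to [(n, k n, eta n)]. *)
Lemma bigO_comap {I J : Type} (g : J -> I) (s : I -> R) (s' : J -> R)
  (D : I -> Prop) (D' : J -> Prop) m F :
  (exists d, 0 < d /\ forall j, D' j -> 0 < s' j <= d -> D (g j) /\ s (g j) = s' j) ->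
  bigO s D m F -> bigO s' D' m (fun j => F (g j)).
Proof.
  intros [d0 [Hd0 E]] [C [d [Hd [HC H]]]].
  exists C, (Rmin d0 d). split; [apply Rmin_pos; auto|split; auto].
  intros i Di [Hs Hsd].
  pose proof (Rmin_l d0 d). pose proof (Rmin_r d0 d).
  destruct (E i Di) as [E1 E2]; [lra|]. rewrite <- E2. apply H; auto. lra.
Qed.

(** * Taylor's formula and composition of expansions *)

Lemma derivative_bound (f f' : R -> R) a b M :
  (forall x, Rmin a b <= x <= Rmax a b -> is_derive f x (f' x)) ->
  (forall x, Rmin a b <= x <= Rmax a b -> Rabs (f' x) <= M) ->
  Rabs (f b - f a) <= M * Rabs (b - a).
Proof.
  intros Hd HM.
  destruct (MVT_gen f a b f') as [c [Hc E]].
  - intros x Hx. apply Hd; lra.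
  - intros x Hx. apply continuity_pt_filterlim.
    apply (ex_derive_continuous f). exists (f' x). apply Hd; auto.
  - rewrite E, Rabs_mult. apply Rmult_le_compat_r; [apply Rabs_pos|]. auto.
Qed.

Section Taylor.

Variables (g g1 g2 g3 : R -> R) (lo hi M : R).
Hypothesis Dg : forall x, lo <= x <= hi -> is_derive g x (g1 x).
Hypothesis Dg1 : forall x, lo <= x <= hi -> is_derive g1 x (g2 x).
Hypothesis Dg2 : forall x, lo <= x <= hi -> is_derive g2 x (g3 x).
Hypothesis B3 : forall x, lo <= x <= hi -> Rabs (g3 x) <= M.

(** Each remainder estimate follows from the previous one by the mean value inequality, so the
    constant stays [M], without factorials; only the order matters later. *)
Lemma taylor1 a x : lo <= a <= hi -> lo <= x <= hi ->
  Rabs (g2 x - g2 a) <= M * Rabs (x - a).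
Proof.
  intros Ha Hx. apply derivative_bound with g3; intros y Hy; [apply Dg2|apply B3];
  unfold Rmin, Rmax in Hy; destruct (Rle_dec a x); lra.
Qed.

Lemma taylor2 a x : lo <= a <= hi -> lo <= x <= hi ->
  Rabs (g1 x - g1 a - g2 a * (x - a)) <= M * Rabs (x - a) ^ 2.
Proof.
  intros Ha Hx.
  replace (g1 x - g1 a - g2 a * (x - a)) with
    ((g1 x - g2 a * (x - a)) - (g1 a - g2 a * (a - a))) by ring.
  replace (M * Rabs (x - a) ^ 2) with ((M * Rabs (x - a)) * Rabs (x - a)) by ring.
  apply derivative_bound with (f := fun y => g1 y - g2 a * (y - a)) (f' := fun y => g2 y - g2 a).
  - intros y Hy. assert (lo <= y <= hi) by
      (unfold Rmin, Rmax in Hy; destruct (Rle_dec a x); lra).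
    auto_derive; [exists (g2 y); auto|].
    assert (E : Derive (fun x : R => g1 x) y = g2 y) by (apply is_derive_unique; auto). rewrite E. ring.
  - intros y Hy. assert (lo <= y <= hi) by
      (unfold Rmin, Rmax in Hy; destruct (Rle_dec a x); lra).
    eapply Rle_trans; [apply taylor1; auto|].
    apply Rmult_le_compat_l.
    { eapply Rle_trans; [apply Rabs_pos|apply (B3 a); auto]. }
    unfold Rmin, Rmax in Hy; destruct (Rle_dec a x);
    unfold Rabs; destruct (Rcase_abs (y - a)); destruct (Rcase_abs (x - a)); lra.
Qed.

Lemma taylor3 a x : lo <= a <= hi -> lo <= x <= hi ->
  Rabs (g x - g a - g1 a * (x - a) - g2 a * (x - a) ^ 2 / 2) <= M * Rabs (x - a) ^ 3.
Proof.
  intros Ha Hx.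
  replace (g x - g a - g1 a * (x - a) - g2 a * (x - a) ^ 2 / 2) with
    ((g x - g1 a * (x - a) - g2 a * (x - a) ^ 2 / 2)
     - (g a - g1 a * (a - a) - g2 a * (a - a) ^ 2 / 2)) by field.
  replace (M * Rabs (x - a) ^ 3) with ((M * Rabs (x - a) ^ 2) * Rabs (x - a)) by ring.
  apply derivative_bound with (f := fun y => g y - g1 a * (y - a) - g2 a * (y - a) ^ 2 / 2)
    (f' := fun y => g1 y - g1 a - g2 a * (y - a)).
  - intros y Hy. assert (lo <= y <= hi) by
      (unfold Rmin, Rmax in Hy; destruct (Rle_dec a x); lra).
    auto_derive; [exists (g1 y); auto|].
    assert (E : Derive (fun x : R => g x) y = g1 y) by (apply is_derive_unique; auto). rewrite E. field.
  - intros y Hy. assert (lo <= y <= hi) by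
      (unfold Rmin, Rmax in Hy; destruct (Rle_dec a x); lra).
    eapply Rle_trans; [apply taylor2; auto|].
    apply Rmult_le_compat_l.
    { eapply Rle_trans; [apply Rabs_pos|apply (B3 a); auto]. }
    apply pow_incr. split; [apply Rabs_pos|].
    unfold Rmin, Rmax in Hy; destruct (Rle_dec a x);
    unfold Rabs; destruct (Rcase_abs (y - a)); destruct (Rcase_abs (x - a)); lra.
Qed.

End Taylor.

(** The margin [r] keeps the leading term away from the ends of [[lo, hi]], so that [F i] also lies
    in the interval once [s i] is small, and Taylor's formula applies between the two. *)
Lemma ex3_comp {I} (s : I -> R) (D : I -> Prop) (g g1 g2 g3 : R -> R) lo hi r M F a b c :
  (forall x, lo <= x <= hi -> is_derive g x (g1 x)) ->
  (forall x, lo <= x <= hi -> is_derive g1 x (g2 x)) ->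
  (forall x, lo <= x <= hi -> is_derive g2 x (g3 x)) ->
  (forall x, lo <= x <= hi -> Rabs (g x) <= M /\ Rabs (g1 x) <= M /\
     Rabs (g2 x) <= M /\ Rabs (g3 x) <= M) ->
  0 < r -> (forall i, D i -> lo + r <= a i <= hi - r) ->
  ex3 s D F a b c ->
  ex3 s D (fun i => g (F i)) (fun i => g (a i)) (fun i => g1 (a i) * b i)
    (fun i => g1 (a i) * c i + g2 (a i) * b i ^ 2 / 2).
Proof.
  intros D0 D1 D2 HB Hr Ha HF.
  destruct HF as [A1 [A2 [A3 A4]]].
  assert (Bg : bigO s D 0 (fun i => g (a i))).
  { apply bigO_bounded with M. intros i Di. apply HB. specialize (Ha i Di). lra. }
  assert (Bg1 : bigO s D 0 (fun i => g1 (a i))).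
  { apply bigO_bounded with M. intros i Di. apply HB. specialize (Ha i Di). lra. }
  assert (Bg2 : bigO s D 0 (fun i => g2 (a i))).
  { apply bigO_bounded with M. intros i Di. apply HB. specialize (Ha i Di). lra. }
  assert (P : forall k f, bigO s D 0 f -> bigO s D k (fun i => f i * s i ^ k)).
  { intros k f Hf. apply (bigO_mult s D 0 k); auto. apply bigO_small. }
  assert (Bd : bigO s D 1 (fun i => F i - a i)).
  { apply bigO_eq with (fun i => (F i - (a i + b i * s i + c i * s i ^ 2))
      + (b i * s i ^ 1 + c i * s i ^ 2)); [intros; simpl; ring|].
    apply bigO_plus; [apply (bigO_weaken s D 3); auto; lia|].
    apply bigO_plus; [apply P; auto|apply (bigO_weaken s D 2); auto; lia]. }
  (* Difference of squares: [F - a - b s] is [O(s^2)] and [F - a + b s] is [O(s)]. *)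
  assert (Bd2 : bigO s D 3 (fun i => (F i - a i) ^ 2 - b i ^ 2 * s i ^ 2)).
  { apply bigO_eq with (fun i => (F i - a i - b i * s i) * ((F i - a i) + b i * s i ^ 1));
      [intros; simpl; ring|].
    apply (bigO_mult s D 2 1).
    - apply bigO_eq with (fun i => (F i - (a i + b i * s i + c i * s i ^ 2)) + c i * s i ^ 2);
        [intros; simpl; ring|].
      apply bigO_plus; [apply (bigO_weaken s D 3); auto; lia|auto].
    - apply bigO_plus; auto. }
  apply ex3_bigO; auto.
  - apply (bigO_mult s D 0 0); auto.
  - apply bigO_plus; [apply (bigO_mult s D 0 0); auto|].
    apply (bigO_mult s D 0 0); [|apply bigO_const].
    apply (bigO_mult s D 0 0); auto. apply bigO_pow; auto.
  - apply bigO_eq with (fun i =>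
      (g (F i) - g (a i) - g1 (a i) * (F i - a i) - g2 (a i) * (F i - a i) ^ 2 / 2)
      + g1 (a i) * (F i - (a i + b i * s i + c i * s i ^ 2))
      + / 2 * (g2 (a i) * ((F i - a i) ^ 2 - b i ^ 2 * s i ^ 2))).
    { intros; simpl; field. }
    apply bigO_plus; [apply bigO_plus|].
    + apply bigO_le with (fun i => M * ((F i - a i) * ((F i - a i) * (F i - a i)))).
      * destruct Bd as [C [d [Hd [HC H]]]].
        (* This radius makes [C s <= r]; the [+ 1] covers [C = 0]. *)
        exists (Rmin d (r / (C + 1))). split.
        { apply Rmin_pos; auto. apply Rdiv_lt_0_compat; lra. }
        intros i Di [Hs Hsd].
        pose proof (Rmin_l d (r / (C + 1))). pose proof (Rmin_r d (r / (C + 1))).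
        assert (Hi : Rabs (F i - a i) <= C * s i ^ 1) by (apply H; auto; lra).
        assert (s i * (C + 1) <= r).
        { apply Rmult_le_reg_r with (/ (C + 1)); [apply Rinv_0_lt_compat; lra|].
          rewrite Rmult_assoc, Rinv_r by lra. unfold Rdiv in *. lra. }
        assert (Hr1 : Rabs (F i - a i) <= r) by nra.
        specialize (Ha i Di).
        assert (lo <= a i <= hi) by lra.
        assert (lo <= F i <= hi).
        { revert Hr1. unfold Rabs. destruct (Rcase_abs (F i - a i)); intros; lra. }
        eapply Rle_trans; [apply (taylor3 g g1 g2 g3 lo hi M); auto; intros; apply HB; auto|].
        assert (0 <= M) by (eapply Rle_trans; [apply Rabs_pos|apply (HB (a i)); auto]).
        rewrite !Rabs_mult, (Rabs_pos_eq M) by auto. right; ring.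
      * apply bigO_scal. apply (bigO_mult s D 1 2); auto. apply (bigO_mult s D 1 1); auto.
    + apply (bigO_mult s D 0 3); auto.
    + apply bigO_scal. apply (bigO_mult s D 0 3); auto.
Qed.

Lemma exp_bound x B : x <= B -> Rabs (exp x) <= exp B.
Proof.
  intros H. rewrite Rabs_pos_eq by (left; apply exp_pos).
  destruct H as [H| ->]; [left; apply exp_increasing; auto|right; auto].
Qed.

Lemma is_derive_exp x : is_derive exp x (exp x).
Proof. auto_derive; auto. ring. Qed.

Lemma ex3_exp {I} (s : I -> R) (D : I -> Prop) B F a b c :
  (forall i, D i -> Rabs (a i) <= B) ->
  ex3 s D F a b c ->
  ex3 s D (fun i => exp (F i)) (fun i => exp (a i)) (fun i => exp (a i) * b i)
    (fun i => exp (a i) * c i + exp (a i) * b i ^ 2 / 2).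
Proof.
  intros Ha. apply ex3_comp with (g := exp) (g1 := exp) (g2 := exp) (g3 := exp)
    (lo := - B - 1) (hi := B + 1) (r := 1) (M := exp (B + 1)).
  1-3: intros; apply is_derive_exp.
  - intros x Hx. assert (Rabs (exp x) <= exp (B + 1)) by (apply exp_bound; lra). tauto.
  - lra.
  - intros i Di. specialize (Ha i Di). revert Ha. unfold Rabs.
    destruct (Rcase_abs (a i)); lra.
Qed.

Lemma ex3_inv {I} (s : I -> R) (D : I -> Prop) lo hi F a b c :
  0 < lo -> (forall i, D i -> lo <= a i <= hi) ->
  ex3 s D F a b c ->
  ex3 s D (fun i => / F i) (fun i => / a i) (fun i => - / a i ^ 2 * b i)
    (fun i => - / a i ^ 2 * c i + 2 / a i ^ 3 * b i ^ 2 / 2).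
Proof.
  intros Hlo Ha.
  apply ex3_comp with (g := Rinv) (g1 := fun x => - / x ^ 2) (g2 := fun x => 2 / x ^ 3)
    (g3 := fun x => - 6 / x ^ 4) (lo := lo / 2) (hi := hi + lo / 2) (r := lo / 2)
    (M := / (lo / 2) + / (lo / 2) ^ 2 + 2 * / (lo / 2) ^ 3 + 6 * / (lo / 2) ^ 4).
  - intros x Hx. auto_derive; [lra|]. field; lra.
  - intros x Hx. auto_derive; [|field; lra]. nra.
  - intros x Hx. auto_derive; [|field; lra]. apply Rgt_not_eq. apply (pow_lt x 3). lra.
  - intros x Hx.
    assert (P : forall k, 0 < / x ^ k <= / (lo / 2) ^ k).
    { intros k. split; [apply Rinv_0_lt_compat, pow_lt; lra|].
      apply Rinv_le_contravar; [apply pow_lt; lra|]. apply pow_incr; lra. }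
    pose proof (P 1%nat) as P1. rewrite !pow_1 in P1.
    pose proof (P 2%nat). pose proof (P 3%nat). pose proof (P 4%nat).
    unfold Rdiv. rewrite Rabs_Ropp.
    rewrite (Rabs_pos_eq (/ x)), (Rabs_pos_eq (/ x ^ 2)), (Rabs_pos_eq (2 * / x ^ 3)) by lra.
    rewrite (Rabs_left (-6 * / x ^ 4)) by lra.
    unfold Rdiv in *. lra.
  - lra.
  - intros i Di. specialize (Ha i Di). lra.
Qed.

(** * The Gaussian integral *)

Definition gauss (x : R) : R := exp (- x ^ 2 / 2).
Definition phi (x : R) : R := / sqrt (2 * PI) * gauss x.

Lemma continuous_gauss x : continuous gauss x.
Proof. apply (ex_derive_continuous gauss). unfold gauss. auto_derive; auto. Qed.

Lemma ex_RInt_gauss a b : ex_RInt gauss a b.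
Proof. apply (ex_RInt_continuous (V := R_CompleteNormedModule)). intros. apply continuous_gauss. Qed.

Lemma is_derive_RInt_gauss x : is_derive (fun y => RInt gauss 0 y) x (gauss x).
Proof.
  apply (is_derive_RInt gauss (fun y => RInt gauss 0 y) 0 x).
  - exists (mkposreal 1 Rlt_0_1). intros y _. apply (RInt_correct gauss), ex_RInt_gauss.
  - apply continuous_gauss.
Qed.

(** The integrand of the classical evaluation of the Gaussian integral by differentiation under the
    integral sign. *)
Definition gauss_aux (x t : R) : R := exp (- x ^ 2 * (1 + t ^ 2) / 2) / (1 + t ^ 2).

Lemma is_derive_gauss_aux x t :
  is_derive (fun y => gauss_aux y t) x (- x * exp (- x ^ 2 * (1 + t ^ 2) / 2)).
Proof.
  unfold gauss_aux. assert (0 <= t ^ 2) by apply pow2_ge_0.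
  auto_derive.  lra. unfold Rdiv. simpl. field. simpl in H. lra.
Qed.

Lemma ex_RInt_gauss_aux x a b : ex_RInt (gauss_aux x) a b.
Proof.
  apply (ex_RInt_continuous (V := R_CompleteNormedModule)). intros t _.
  apply (ex_derive_continuous (gauss_aux x)). unfold gauss_aux.
  assert (0 <= t ^ 2) by apply pow2_ge_0. simpl in H.
  auto_derive. lra.
Qed.

Lemma is_derive_RInt_gauss_aux x :
  is_derive (fun y => RInt (gauss_aux y) 0 1) x (- gauss x * RInt gauss 0 x).
Proof.
  replace (- gauss x * RInt gauss 0 x)
    with (RInt (fun t => Derive (fun u => gauss_aux u t) x) 0 1).
  - apply (is_derive_RInt_param gauss_aux).
    + exists (mkposreal 1 Rlt_0_1). intros y _ t _. eexists; apply is_derive_gauss_aux.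
    + intros t _.
      apply continuity_2d_pt_ext with
        (fun u v => - u * exp (- (u * u) * (1 + v * v) / 2)).
      { intros u v. symmetry. apply is_derive_unique.
        replace (- (u * u)) with (- u ^ 2) by ring. replace (v * v) with (v ^ 2) by ring.
        apply is_derive_gauss_aux. }
      apply continuity_2d_pt_mult.
      { apply continuity_2d_pt_opp, continuity_2d_pt_id1. }
      apply (continuity_1d_2d_pt_comp exp (fun u v => - (u * u) * (1 + v * v) / 2)).
      { apply derivable_continuous_pt, derivable_pt_exp. }
      unfold Rdiv. apply continuity_2d_pt_mult; [|apply continuity_2d_pt_const].
      apply continuity_2d_pt_mult.
      { apply continuity_2d_pt_opp, continuity_2d_pt_mult; apply continuity_2d_pt_id1. }
      apply continuity_2d_pt_plus; [apply continuity_2d_pt_const|].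
      apply continuity_2d_pt_mult; apply continuity_2d_pt_id2.
    + exists (mkposreal 1 Rlt_0_1). intros y _. apply ex_RInt_gauss_aux.
  (* The substitution [y = x t] carries the integral over [0, 1] to the one from 0 to [x]. *)
  - rewrite RInt_ext with (g := fun t => scal (- gauss x) (scal x (gauss (x * t + 0)))).
    + assert (E : ex_RInt (fun t => scal x (gauss (x * t + 0))) 0 1).
      { apply (ex_RInt_comp_lin gauss x 0 0 1). apply ex_RInt_gauss. }
      etransitivity; [apply (RInt_scal (V := R_CompleteNormedModule)); exact E|].
      unfold scal at 1; simpl; unfold mult; simpl. f_equal.
      etransitivity; [apply (RInt_comp_lin gauss x 0 0 1); apply ex_RInt_gauss|].
      f_equal; ring.
    + intros t _. etransitivity; [apply is_derive_unique, is_derive_gauss_aux|].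
      transitivity (- gauss x * (x * gauss (x * t + 0))); [unfold gauss|reflexivity].
      replace (- x ^ 2 * (1 + t ^ 2) / 2) with (- x ^ 2 / 2 + - (x * t + 0) ^ 2 / 2) by field.
      rewrite exp_plus. match goal with |- @eq _ ?a ?b => change (@eq R a b) end. ring.
Qed.

(** With [I] the integral of [gauss] from 0 to [x], the left side has derivative
    [2 I gauss x - 2 I gauss x = 0]. At [x = 0] only twice the integral of [1 / (1 + t^2)] remains,
    which is [2 atan 1]. *)
Lemma gauss_square x : RInt gauss 0 x ^ 2 + 2 * RInt (gauss_aux x) 0 1 = PI / 2.
Proof.
  set (F := fun y => RInt gauss 0 y ^ 2 + 2 * RInt (gauss_aux y) 0 1).
  assert (HD : forall y, is_derive F y 0).
  { intros y. unfold F.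
    pose proof (is_derive_RInt_gauss y) as D1. pose proof (is_derive_RInt_gauss_aux y) as D2.
    evar_last.
    { apply (is_derive_plus (fun y => RInt gauss 0 y ^ 2) (fun y => 2 * RInt (gauss_aux y) 0 1)).
      - apply (is_derive_pow (fun y => RInt gauss 0 y) 2 y _ D1).
      - apply (is_derive_scal (fun y => RInt (gauss_aux y) 0 1) y 2 _ D2). }
    unfold plus; simpl. ring. }
  assert (E : F x = F 0).
  { assert (Rabs (F x - F 0) <= 0 * Rabs (x - 0)).
    { apply derivative_bound with (fun _ => 0); auto. intros. rewrite Rabs_R0; lra. }
    rewrite Rmult_0_l in H. pose proof (Rabs_pos (F x - F 0)).
    destruct (Req_dec (F x - F 0) 0); [lra|]. pose proof (Rabs_pos_lt _ H1). lra. }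
  unfold F in E. rewrite E. rewrite RInt_point.
  assert (E1 : PI / 4 = RInt (gauss_aux 0) 0 1); [|rewrite <- E1; change (0 ^ 2 + 2 * (PI / 4) = PI / 2); field].
  symmetry. rewrite <- atan_1. apply is_RInt_unique.
  assert (E2 : atan 1 = minus (atan 1) (atan 0)) by
    (rewrite atan_0; unfold minus, plus, opp; simpl; ring).
  rewrite E2.
  apply (is_RInt_ext (fun t => / (1 + t ^ 2))).
  { intros t _. unfold gauss_aux.
    replace (- 0 ^ 2 * (1 + t ^ 2) / 2) with 0 by field. rewrite exp_0.
    symmetry. apply Rmult_1_l. }
  apply (is_RInt_derive atan).
  - intros t _. apply is_derive_Reals.
    apply derivable_pt_lim_atan.
  - intros t _. apply (ex_derive_continuous (fun t => / (1 + t ^ 2))).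
    auto_derive. pose proof (pow2_ge_0 t). simpl in H. lra.
Qed.

(** [exp y >= 1 + y] at [y = x^2 (1 + t^2) / 2] gives this crude decay, enough for the limit at
    infinity. *)
Lemma gauss_aux_bound x : 0 <= RInt (gauss_aux x) 0 1 <= 2 / (2 + x ^ 2).
Proof.
  assert (P : forall t, 0 < 1 + t ^ 2) by (intros t; pose proof (pow2_ge_0 t); lra).
  pose proof (pow2_ge_0 x) as Hx.
  split.
  - apply RInt_ge_0; [lra|apply ex_RInt_gauss_aux|].
    intros t _. unfold gauss_aux. apply Rlt_le, Rdiv_lt_0_compat; [apply exp_pos|apply P].
  - replace (2 / (2 + x ^ 2)) with (RInt (fun _ => 2 / (2 + x ^ 2)) 0 1).
    2:{ rewrite RInt_const. unfold scal; simpl; unfold mult; simpl. ring. }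
    apply RInt_le; [lra|apply ex_RInt_gauss_aux|apply ex_RInt_const|].
    intros t Ht. unfold gauss_aux.
    pose proof (pow2_ge_0 t) as Ht2.
    replace (- x ^ 2 * (1 + t ^ 2) / 2) with (- (x ^ 2 * (1 + t ^ 2) / 2)) by field.
    rewrite exp_Ropp.
    assert (1 + x ^ 2 / 2 <= exp (x ^ 2 * (1 + t ^ 2) / 2)).
    { eapply Rle_trans; [|apply exp_ineq1_le]. nra. }
    replace (2 / (2 + x ^ 2)) with (/ (1 + x ^ 2 / 2) * / 1) by (field; lra).
    apply Rmult_le_compat.
    + left; apply Rinv_0_lt_compat, exp_pos.
    + left; apply Rinv_0_lt_compat, P.
    + apply Rinv_le_contravar; lra.
    + apply Rinv_le_contravar; lra.
Qed.

Lemma RInt_gauss_odd x : RInt gauss 0 (- x) = - RInt gauss 0 x.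
Proof.
  replace (- x) with (-1 * x + 0) by ring. replace 0 with (-1 * 0 + 0) at 1 by ring.
  rewrite <- (RInt_comp_lin gauss (-1) 0 0 x) by apply ex_RInt_gauss.
  transitivity (RInt (fun y => opp (gauss y)) 0 x).
  - apply RInt_ext. intros y _. unfold gauss. replace (- (-1 * y + 0) ^ 2 / 2) with (- y ^ 2 / 2) by field.
    transitivity (-1 * exp (- y ^ 2 / 2)); [reflexivity|].
    transitivity (- exp (- y ^ 2 / 2)); [|reflexivity].
    match goal with |- @eq _ ?a ?b => change (@eq R a b) end. ring.
  - apply (RInt_opp (V := R_CompleteNormedModule)). apply ex_RInt_gauss.
Qed.

Lemma RInt_gauss_lim : is_lim (fun x => RInt gauss 0 x) p_infty (sqrt (PI / 2)).
Proof.
  assert (H2 : is_lim (fun x => RInt gauss 0 x ^ 2) p_infty (PI / 2)).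
  { apply is_lim_ext with (fun x => PI / 2 - 2 * RInt (gauss_aux x) 0 1).
    { intros x. pose proof (gauss_square x). lra. }
    replace (Finite (PI / 2)) with (Rbar_minus (PI / 2) (Rbar_mult 2 0)).
    2:{ simpl. f_equal. ring. }
    apply is_lim_minus'; [apply is_lim_const|]. apply (is_lim_scal_l (fun x => RInt (gauss_aux x) 0 1) 2 p_infty 0).
    apply (is_lim_le_le_loc (fun _ => 0) (fun x => 2 / (2 + x ^ 2))).
    - exists 0. intros x _. apply gauss_aux_bound.
    - apply is_lim_const.
    - apply is_lim_spec. intros [e He]. exists (2 / e + 1). intros x Hx. simpl.
      assert (0 < 2 / e) by (apply Rdiv_lt_0_compat; lra).
      pose proof (pow2_ge_0 x).
      rewrite Rminus_0_r, Rabs_pos_eq.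
      2:{ left. apply Rdiv_lt_0_compat; simpl in *; lra. }
      apply Rmult_lt_reg_r with (2 + x * (x * 1)); [simpl in *; lra|].
      unfold Rdiv. rewrite Rmult_assoc, Rinv_l by (simpl in *; lra).
      assert (e * (2 / e) = 2) by (field; lra).
      nra. }
  assert (H3 : is_lim (fun x => sqrt (RInt gauss 0 x ^ 2)) p_infty (sqrt (PI / 2))).
  { apply (is_lim_comp_continuous (fun x => RInt gauss 0 x ^ 2) sqrt p_infty (PI / 2)); auto.
    apply continuous_sqrt. }
  apply is_lim_ext_loc with (2 := H3).
  exists 0. intros x Hx. rewrite sqrt_pow2; auto.
  apply RInt_ge_0; [lra|apply ex_RInt_gauss|]. intros. left; apply exp_pos.
Qed.

Lemma sqrt_2PI_pos : 0 < sqrt (2 * PI).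
Proof. apply sqrt_lt_R0. pose proof PI_RGT_0. lra. Qed.

(** Trades the improper integral for a proper one from 0, which can be differentiated and reflected.
    The [1 / 2] is the Gaussian limit, carried to minus infinity by oddness. *)
Lemma Phi_RInt x : Phi x = 1 / 2 + / sqrt (2 * PI) * RInt gauss 0 x.
Proof.
  pose proof PI_RGT_0 as HPI. pose proof sqrt_2PI_pos as Hs.
  unfold Phi. replace (1 / 2) with (/ sqrt (2 * PI) * sqrt (PI / 2)).
  2:{ rewrite <- sqrt_inv, <- sqrt_mult_alt.
      - replace (/ (2 * PI) * (PI / 2)) with ((1 / 2) ^ 2) by (field; lra).
        apply sqrt_pow2; lra.
      - left; apply Rinv_0_lt_compat; lra. }
  rewrite <- Rmult_plus_distr_l. f_equal.
  apply is_RInt_gen_unique.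
  assert (L : is_lim (fun a => sqrt (PI / 2) + RInt gauss 0 x
              - (sqrt (PI / 2) + RInt gauss 0 a)) m_infty (sqrt (PI / 2) + RInt gauss 0 x)).
  { replace (Finite (sqrt (PI / 2) + RInt gauss 0 x))
      with (Rbar_minus (sqrt (PI / 2) + RInt gauss 0 x) 0) at 1.
    2:{ simpl. f_equal. ring. }
    apply is_lim_minus'; [apply is_lim_const|].
    apply is_lim_ext with (fun a => sqrt (PI / 2) - RInt gauss 0 (- a)).
    { intros a. rewrite RInt_gauss_odd. ring. }
    replace (Finite 0) with (Rbar_minus (sqrt (PI / 2)) (sqrt (PI / 2))).
    2:{ simpl. f_equal. ring. }
    apply is_lim_minus'; [apply is_lim_const|].
    apply (is_lim_comp (fun a => RInt gauss 0 a) Ropp m_infty (sqrt (PI / 2)) p_infty).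
    - apply RInt_gauss_lim.
    - apply (is_lim_opp (fun y => y) m_infty m_infty). apply is_lim_id.
    - exists 0. intros; discriminate. }
  intros P HP. specialize (L P HP).
  apply (Filter_prod _ _ _ (fun a => P (sqrt (PI / 2) + RInt gauss 0 x
    - (sqrt (PI / 2) + RInt gauss 0 a))) (fun y => y = x) L).
  { reflexivity. }
  intros a b Ha Hb. simpl. subst b.
  exists (RInt gauss a x). split; [apply (RInt_correct gauss), ex_RInt_gauss|].
  replace (RInt gauss a x) with
    (sqrt (PI / 2) + RInt gauss 0 x - (sqrt (PI / 2) + RInt gauss 0 a)); auto.
  pose proof (RInt_Chasles gauss 0 a x (ex_RInt_gauss _ _) (ex_RInt_gauss _ _)) as E.
  unfold plus in E; simpl in E. lra.
Qed.

Lemma is_derive_Phi x : is_derive Phi x (phi x).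
Proof.
  apply is_derive_ext with (fun x => 1 / 2 + / sqrt (2 * PI) * RInt gauss 0 x).
  { intros; symmetry; apply Phi_RInt. }
  evar_last.
  { apply (is_derive_plus (fun _ => 1 / 2) (fun x => / sqrt (2 * PI) * RInt gauss 0 x)).
    - apply is_derive_const.
    - apply (is_derive_scal (fun x => RInt gauss 0 x)). apply is_derive_RInt_gauss. }
  unfold plus, zero; simpl. unfold phi. ring.
Qed.

Lemma Phi_opp x : Phi (- x) = 1 - Phi x.
Proof. rewrite !Phi_RInt, RInt_gauss_odd. field. apply Rgt_not_eq, sqrt_2PI_pos. Qed.

Lemma is_derive_phi x : is_derive phi x (- x * phi x).
Proof.
  replace (- x * phi x) with (/ sqrt (2 * PI) * (- x * gauss x)) by (unfold phi; ring).
  apply (is_derive_scal gauss). unfold gauss. auto_derive; auto. unfold Rdiv. simpl. field.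
Qed.

(** * The simple random walk and the closed form of the price *)

(** The law of a sum of [n] independent steps, [+1] with probability [a] and [-1] otherwise. The
    first-step recursion replaces binomial coefficients: identities become inductions on [n], and
    levels out of range or of the wrong parity need no convention. *)
Fixpoint walk_prob (n : nat) (a : R) (k : Z) : R :=
  match n with
  | O => if (k =? 0)%Z then 1 else 0
  | S m => a * walk_prob m a (k - 1) + (1 - a) * walk_prob m a (k + 1)
  end.

Fixpoint walk_tail (n : nat) (a : R) (k : Z) : R :=
  match n with
  | O => if (k <=? 0)%Z then 1 else 0
  | S m => a * walk_tail m a (k - 1) + (1 - a) * walk_tail m a (k + 1)
  end.

Lemma walk_tail_diff n a k : walk_tail n a k - walk_tail n a (k + 1) = walk_prob n a k.
Proof.
  revert k; induction n as [|n IH]; intros k; cbn [walk_tail walk_prob].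
  - destruct (Z.leb_spec k 0), (Z.leb_spec (k + 1) 0), (Z.eqb_spec k 0); try lia; lra.
  - rewrite <- !IH.
    replace (k + 1 - 1)%Z with (k - 1 + 1)%Z by lia. ring.
Qed.

(** [- Y] is the walk with parameter [1 - a], and for integers [Y < k] means [- Y >= 1 - k]. *)
Lemma walk_tail_compl n a k : walk_tail n a k + walk_tail n (1 - a) (1 - k) = 1.
Proof.
  revert k; induction n as [|n IH]; intros k; cbn [walk_tail walk_prob].
  - destruct (Z.leb_spec k 0), (Z.leb_spec (1 - k) 0); try lia; lra.
  - pose proof (IH (k - 1)%Z) as H1. pose proof (IH (k + 1)%Z) as H2.
    replace (1 - (k - 1))%Z with (1 - k + 1)%Z in H1 by lia.
    replace (1 - (k + 1))%Z with (1 - k - 1)%Z in H2 by lia.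
    replace (walk_tail n (1 - a) (1 - k + 1)) with (1 - walk_tail n a (k - 1)) by lra.
    replace (walk_tail n (1 - a) (1 - k - 1)) with (1 - walk_tail n a (k + 1)) by lra.
    ring.
Qed.

Lemma walk_prob_opp n a k : walk_prob n (1 - a) (- k) = walk_prob n a k.
Proof.
  revert k; induction n as [|n IH]; intros k; cbn [walk_tail walk_prob].
  - destruct (Z.eqb_spec (- k) 0), (Z.eqb_spec k 0); try lia; lra.
  - rewrite <- !(IH (_ + _)%Z), <- !(IH (_ - _)%Z).
    replace (- (k - 1))%Z with (- k + 1)%Z by lia.
    replace (- (k + 1))%Z with (- k - 1)%Z by lia. ring.
Qed.

Lemma walk_prob_odd n a k : Z.odd (Z.of_nat n + k) = true -> walk_prob n a k = 0.
Proof.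
  revert k; induction n as [|n IH]; intros k.
  - simpl. destruct (Z.eqb_spec k 0); [subst; discriminate|auto].
  - intros H. cbn [walk_prob]. rewrite !IH; [ring| |].
    + replace (Z.of_nat n + (k + 1))%Z with (Z.of_nat (S n) + k)%Z by lia. auto.
    + replace (Z.of_nat n + (k - 1))%Z with (Z.of_nat (S n) + k - 2)%Z by lia.
      rewrite Z.odd_sub, H. reflexivity.
Qed.

(** With [m = (n + k) / 2] up steps this is the ratio [(n - m) / (m + 1)] of consecutive binomial
    coefficients. Cleared of denominators it holds for every integer [k], of either parity. *)
Lemma walk_prob_ratio n a k :
  (INR n + IZR k + 2) * (1 - a) * walk_prob n a (k + 2) = (INR n - IZR k) * a * walk_prob n a k.
Proof.
  revert k; induction n as [|n IH]; intros k.
  - simpl. destruct (Z.eqb_spec (k + 2) 0), (Z.eqb_spec k 0); try lia.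
    + replace k with (-2)%Z by lia. simpl. ring.
    + subst. simpl. ring.
    + ring.
  - rewrite S_INR. cbn [walk_prob].
    pose proof (IH (k - 1)%Z) as H1. pose proof (IH (k + 1)%Z) as H2.
    rewrite minus_IZR in H1. rewrite plus_IZR in H2.
    replace (k - 1 + 2)%Z with (k + 1)%Z in H1 by lia.
    replace (k + 2 - 1)%Z with (k + 1)%Z by lia.
    replace (k + 1 + 2)%Z with (k + 2 + 1)%Z in H2 by lia.
    set (x := walk_prob n a (k + 1)) in *. set (y := walk_prob n a (k + 2 + 1)) in *.
    set (z := walk_prob n a (k - 1)) in *.
    replace ((INR n + 1 + IZR k + 2) * (1 - a) * (a * x + (1 - a) * y)) with
      ((INR n + IZR k + 3) * (1 - a) * a * x
       + (1 - a) * ((INR n + (IZR k + 1) + 2) * (1 - a) * y)) by ring.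
    replace ((INR n + 1 - IZR k) * a * (a * z + (1 - a) * x)) with
      (a * ((INR n - (IZR k - 1)) * a * z) + (INR n + 1 - IZR k) * a * (1 - a) * x) by ring.
    rewrite H2, <- H1. ring.
Qed.

(** The absorption identity [m C(N, m) = N C(N - 1, m - 1)] for [N = S n] and [m = (N + k) / 2] up
    steps. *)
Lemma walk_prob_succ n a k :
  (INR (S n) + IZR k) * walk_prob (S n) a k = 2 * INR (S n) * a * walk_prob n a (k - 1).
Proof.
  cbn [walk_prob].
  pose proof (walk_prob_ratio n a (k - 1)) as H.
  replace (k - 1 + 2)%Z with (k + 1)%Z in H by lia.
  rewrite minus_IZR in H. rewrite S_INR.
  set (x := walk_prob n a (k + 1)) in *. set (z := walk_prob n a (k - 1)) in *.
  replace ((INR n + 1 + IZR k) * (a * z + (1 - a) * x)) with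
    ((INR n + 1 + IZR k) * a * z + (INR n + (IZR k - 1) + 2) * (1 - a) * x) by ring.
  rewrite H. ring.
Qed.

Lemma walk_tail_step2 n a k :
  walk_tail n a (k - 1) - walk_tail n a (k + 1) = walk_prob n a (k - 1) + walk_prob n a k.
Proof.
  rewrite <- !walk_tail_diff. replace (k - 1 + 1)%Z with k by lia. ring.
Qed.

(** Differentiating a binomial tail telescopes to [n] times probabilities of the walk with one step
    less; absorption expresses them through the [n]-step law itself. By parity at most one of the
    two terms is nonzero. *)
Lemma is_derive_walk_tail n a k :
  (1 <= n)%nat -> a <> 0 ->
  is_derive (fun a => walk_tail n a k) a
    (((INR n + IZR k) * walk_prob n a k + (INR n + IZR k + 1) * walk_prob n a (k + 1)) / (2 * a)).
Proof.
  intros Hn Ha. destruct n as [|n]; [lia|].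
  replace (INR (S n) + IZR k + 1) with (INR (S n) + IZR (k + 1)) by (rewrite plus_IZR; ring).
  rewrite !walk_prob_succ.
  replace (k + 1 - 1)%Z with k by lia.
  (* The form with one step less is the one that reproduces itself under the first-step recursion,
     hence the one fit for induction. *)
  replace ((2 * INR (S n) * a * walk_prob n a (k - 1) + 2 * INR (S n) * a * walk_prob n a k)
    / (2 * a)) with (INR (S n) * (walk_prob n a (k - 1) + walk_prob n a k)) by (field; auto).
  clear Hn Ha. revert k; induction n as [|n IH]; intros k.
  - simpl. auto_derive; auto.
    destruct (Z.leb_spec (k - 1) 0), (Z.leb_spec (k + 1) 0), (Z.eqb_spec k 0),
      (Z.eqb_spec (k - 1) 0); try lia; lra.
  - pose proof (IH (k - 1)%Z) as H1. pose proof (IH (k + 1)%Z) as H2.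
    assert (P : forall k, walk_prob (S n) a k
      = a * walk_prob n a (k - 1) + (1 - a) * walk_prob n a (k + 1)) by reflexivity.
    pose proof (P (k - 1)%Z) as P1. pose proof (P k) as P2. clear P.
    set (m := S n) in *. clearbody m.
    change (walk_tail (S m)) with
      (fun a k => a * walk_tail m a (k - 1) + (1 - a) * walk_tail m a (k + 1)).
    cbv beta. evar_last.
    { apply (is_derive_plus (fun a => a * walk_tail m a (k - 1))
        (fun a => (1 - a) * walk_tail m a (k + 1))).
      - apply (is_derive_mult (fun a => a) (fun a => walk_tail m a (k - 1))).
        + apply is_derive_id.
        + apply H1.
        + intros; apply Rmult_comm.
      - apply (is_derive_mult (fun a => 1 - a) (fun a => walk_tail m a (k + 1))).
        + apply (is_derive_minus (fun _ => 1) (fun a => a)); [apply is_derive_const|apply is_derive_id].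
        + apply H2.
        + intros; apply Rmult_comm. }
    unfold plus, mult, minus, zero, one, opp; cbn -[INR]. unfold plus, mult, zero, one, opp; cbn -[INR].
    pose proof (walk_tail_step2 m a k) as E.
    rewrite S_INR.
    replace (k + 1 - 1)%Z with k by lia. replace (k - 1 + 1)%Z with k by lia.
    replace (k - 1 - 1)%Z with (k - 2)%Z by lia. replace (k + 1 + 1)%Z with (k + 2)%Z by lia.
    replace (k - 1 - 1)%Z with (k - 2)%Z in P1 by lia.
    replace (k - 1 + 1)%Z with k in P1 by lia.
    apply Rminus_diag_uniq.
    match goal with |- ?X = 0 => replace X with
      ((walk_tail m a (k - 1) - walk_tail m a (k + 1))
      - (walk_prob m a (k - 1) + walk_prob m a k)
      + INR m * ((a * walk_prob n a (k - 2) + (1 - a) * walk_prob n a k - walk_prob m a (k - 1))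
          + (a * walk_prob n a (k - 1) + (1 - a) * walk_prob n a (k + 1) - walk_prob m a k)))
      by ring end.
    rewrite E, P1, P2. ring.
Qed.

Lemma Rpower_succ x y : 0 < x -> Rpower x (y + 1) = Rpower x y * x.
Proof. intros. rewrite Rpower_plus, Rpower_1; auto. Qed.

Lemma Rpower_pred x y : 0 < x -> Rpower x (y - 1) = Rpower x y / x.
Proof.
  intros. unfold Rminus. rewrite Rpower_plus, Rpower_Ropp, Rpower_1; auto.
Qed.

(** Change of measure by the exponential martingale [E^n u^Y], [Y] the walk with parameter [p]. *)
Lemma walk_prob_tilt n p q u E k :
  0 < u -> q = p * u * E -> 1 - q = (1 - p) / u * E ->
  walk_prob n q k = E ^ n * Rpower u (IZR k) * walk_prob n p k.
Proof.
  intros Hu H1 H2. revert k; induction n as [|n IH]; intros k; cbn [walk_tail walk_prob].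
  - destruct (Z.eqb_spec k 0); [subst; rewrite Rpower_O by auto; ring|simpl; ring].
  - simpl (E ^ S n). rewrite !IH, H2, H1, plus_IZR, minus_IZR, Rpower_succ, Rpower_pred by auto.
    field. lra.
Qed.

(** The mean excess [E (Y - k)^+] of the walk [Y] with parameter [a], in the closed form given by
    Abel summation. *)
Definition walk_excess (n : nat) (a : R) (k : Z) : R :=
  (INR n * (2 * a - 1) - IZR k) * walk_tail n a k
  + (1 - a) * ((INR n + IZR k) * walk_prob n a k + (INR n + IZR k + 1) * walk_prob n a (k + 1)).

Lemma walk_excess_succ n a k :
  walk_excess (S n) a k = a * walk_excess n a (k - 1) + (1 - a) * walk_excess n a (k + 1).
Proof.
  (* Absorption turns the local terms into a difference of tails, so that an identity between tails
     alone remains. Absorption starts at one step, so [n = 0] is checked by cases. *)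
  assert (L : forall n k, (INR (S n) + IZR k) * walk_prob (S n) a k
     + (INR (S n) + IZR k + 1) * walk_prob (S n) a (k + 1)
     = 2 * INR (S n) * a * (walk_tail n a (k - 1) - walk_tail n a (k + 1))).
  { intros m z. replace (INR (S m) + IZR z + 1) with (INR (S m) + IZR (z + 1))
      by (rewrite plus_IZR; ring).
    rewrite !walk_prob_succ, walk_tail_step2.
    replace (z + 1 - 1)%Z with z by lia. ring. }
  unfold walk_excess. rewrite L. rewrite S_INR.
  change (walk_tail (S n) a k) with
      (a * walk_tail n a (k - 1) + (1 - a) * walk_tail n a (k + 1)).
  rewrite plus_IZR, minus_IZR.
  destruct n as [|n].
  - simpl. replace (k - 1 + 1)%Z with k by lia. replace (k + 1 + 1)%Z with (k + 2)%Z by lia.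
    destruct (Z.leb_spec (k - 1) 0), (Z.leb_spec (k + 1) 0), (Z.eqb_spec k 0),
      (Z.eqb_spec (k - 1) 0), (Z.eqb_spec (k + 1) 0), (Z.eqb_spec (k + 2) 0); try lia;
      try (replace k with 0%Z by lia); try (replace k with 1%Z by lia);
      try (replace k with (-1)%Z by lia); try (replace k with (-2)%Z by lia); simpl; try ring.
  - pose proof (L n (k - 1)%Z) as L1. pose proof (L n (k + 1)%Z) as L2.
    rewrite minus_IZR in L1. rewrite plus_IZR in L2. rewrite L1, L2.
    change (walk_tail (S n) a) with
      (fun k => a * walk_tail n a (k - 1) + (1 - a) * walk_tail n a (k + 1)).
    cbv beta.
    replace (k - 1 + 1)%Z with k by lia. replace (k + 1 - 1)%Z with k by lia. ring.
Qed.

(** For integers, [(Y - k)^+ - (Y - k - 1)^+] is the indicator of [Y >= k + 1]. *)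
Lemma walk_excess_diff n a k :
  walk_excess n a k - walk_excess n a (k + 1) = walk_tail n a (k + 1).
Proof.
  revert k; induction n as [|n IH]; intros k.
  - unfold walk_excess. simpl.
    replace (k + 1 + 1)%Z with (k + 2)%Z by lia.
    rewrite plus_IZR.
    destruct (Z.leb_spec k 0), (Z.leb_spec (k + 1) 0), (Z.eqb_spec k 0),
      (Z.eqb_spec (k + 1) 0), (Z.eqb_spec (k + 2) 0); try lia;
      try (replace k with 0%Z by lia); try (replace k with 1%Z by lia);
      try (replace k with (-1)%Z by lia); try (replace k with (-2)%Z by lia); simpl; try ring.
  - rewrite !walk_excess_succ. cbn [walk_tail].
    pose proof (IH (k - 1)%Z) as H1. pose proof (IH (k + 1)%Z) as H2.
    replace (k - 1 + 1)%Z with k in H1 by lia.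
    replace (k + 1 - 1)%Z with k by lia. rewrite <- H1, <- H2. ring.
Qed.

Lemma walk_excess_0 a k : (0 <= k)%Z -> walk_excess 0 a k = 0.
Proof.
  intros. unfold walk_excess. simpl.
  destruct (Z.leb_spec k 0), (Z.eqb_spec k 0), (Z.eqb_spec (k + 1) 0); try lia.
  - subst. simpl; ring.
  - ring.
Qed.

Fixpoint reflected_mean (g : R -> R) (q : R) (n : nat) (j : R) : R :=
  match n with
  | O => g j
  | S m => (1 - q) * reflected_mean g q m (j + 1) + q * reflected_mean g q m (Rmax (j - 1) 0)
  end.

(** A level is written [K - 1 + f] with fractional part [f]. A down move from [K = 1] is cut at 0
    and forgets [f]; if [K = 0] stands for the cut position, the reflected recursion becomes the
    free one with boundary condition [F n 0 f = F n 1 0]. *)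
Lemma reflected_mean_unique g q (F : nat -> Z -> R -> R) :
  (forall K f, (1 <= K)%Z -> 0 <= f < 1 -> F 0%nat K f = g (IZR K - 1 + f)) ->
  (forall n K f, F (S n) K f = (1 - q) * F n (K + 1)%Z f + q * F n (K - 1)%Z f) ->
  (forall n f, 0 <= f < 1 -> F n 0%Z f = F n 1%Z 0) ->
  forall n K f, (1 <= K)%Z -> 0 <= f < 1 -> reflected_mean g q n (IZR K - 1 + f) = F n K f.
Proof.
  intros H0 HS HB n. induction n as [|n IH]; intros K f HK Hf.
  - simpl. symmetry. auto.
  - cbn [reflected_mean]. rewrite HS. f_equal; f_equal.
    + rewrite <- IH by (auto; lia). f_equal. rewrite plus_IZR. ring.
    + destruct (Z.eq_dec K 1) as [->|HK1].
      * simpl. rewrite HB, <- IH by (auto; lra || lia).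
        f_equal. rewrite Rmax_right; simpl; lra.
      * rewrite <- IH by (auto; lia). f_equal.
        assert (2 <= IZR K) by (apply (IZR_le 2); lia).
        rewrite Rmax_left by lra. rewrite minus_IZR. ring.
Qed.

(** [E] is the one-step mean of [u] to the increment, and tilting by it changes the down probability
    from [q] to [p]. The three summands solve the free recursion separately: [q]-tails, [u^j]
    against [p]-tails and their reflection with odds [th], and [rho^K] against the reflected tail.
    The boundary condition then fixes [c], which is singular at [rho = 1]. *)
Lemma reflected_mean_closed u p q E n K f :
  let th := p / (1 - p) in let rho := u * th in let c := (1 - / u) / (rho - 1) in
  0 < u -> 0 < p < 1 -> q = p * u * E -> 1 - q = (1 - p) / u * E -> rho <> 1 ->
  (1 <= K)%Z -> 0 <= f < 1 ->
  reflected_mean (Rpower u) q n (IZR K - 1 + f) =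
    E ^ n * Rpower u (IZR K - 1 + f)
      * (1 - walk_tail n p K - Rpower th (IZR K) * walk_tail n (1 - p) (K + 1))
    + (walk_tail n q K + c * walk_tail n q (K + 1))
    + (1 - c * rho) * (E ^ n * Rpower rho (IZR K) * walk_tail n (1 - p) (K + 1)).
Proof.
  intros th rho c Hu Hp Hq Hq1 Hrho HK Hf.
  assert (Hth : 0 < th) by (apply Rdiv_lt_0_compat; lra).
  assert (Hr : 0 < rho) by (apply Rmult_lt_0_compat; lra).
  apply (reflected_mean_unique (Rpower u) q (fun n K f =>
    E ^ n * Rpower u (IZR K - 1 + f)
      * (1 - walk_tail n p K - Rpower th (IZR K) * walk_tail n (1 - p) (K + 1))
    + (walk_tail n q K + c * walk_tail n q (K + 1))
    + (1 - c * rho) * (E ^ n * Rpower rho (IZR K) * walk_tail n (1 - p) (K + 1)))); auto; clear n K f HK Hf.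
  - intros K f HK Hf. simpl.
    destruct (Z.leb_spec K 0), (Z.leb_spec (K + 1) 0); try lia. ring.
  - intros n K f.
    cbn [walk_tail]. rewrite plus_IZR, minus_IZR.
    replace (IZR K + 1 - 1 + f) with (IZR K - 1 + f + 1) by ring.
    replace (IZR K - 1 - 1 + f) with (IZR K - 1 + f - 1) by ring.
    rewrite !Rpower_succ, !Rpower_pred by auto.
    replace (K - 1 + 1)%Z with K by lia. replace (K + 1 - 1)%Z with K by lia.
    set (A := Rpower u (IZR K - 1 + f)). set (B := Rpower th (IZR K)).
    set (C := Rpower rho (IZR K)). simpl (E ^ S n).
    set (t1 := walk_tail n p (K - 1)). set (t2 := walk_tail n p (K + 1)).
    set (t3 := walk_tail n (1 - p) K). set (t4 := walk_tail n (1 - p) (K + 1 + 1)).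
    set (e := E ^ n).
    set (X := walk_tail n q (K - 1)). set (Y := walk_tail n q (K + 1)).
    set (Z := walk_tail n q (K + 1 + 1)). set (W := walk_tail n q K).
    (* The tilt turns the weights [(1 - q) u] and [q / u] into [E (1 - p)] and [E p]; the odds [th]
       exchange [p] and [1 - p] in the reflected term. *)
    assert (E1 : (1 - q) * (e * (A * u) * (1 - t2 - B * th * t4))
       + q * (e * (A / u) * (1 - t1 - B / th * t3))
       = E * e * A * (1 - (p * t1 + (1 - p) * t2)
                      - B * ((1 - p) * t3 + (1 - (1 - p)) * t4))).
    { rewrite Hq1, Hq. unfold th. field. repeat split; lra. }
    assert (E2 : (1 - q) * (e * (C * rho) * t4) + q * (e * (C / rho) * t3)
       = E * e * C * ((1 - p) * t3 + (1 - (1 - p)) * t4)).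
    { rewrite Hq1, Hq. unfold rho, th. field. repeat split; lra. }
    rewrite <- E1, <- E2. ring.
  - intros n f Hf. cbn [Z.add].
    replace (IZR 1 - 1 + 0) with 0 by ring.
    rewrite !Rpower_O, !Rpower_1 by auto.
    change (0 + 1)%Z with 1%Z. change (Z.pos (1 + 1)) with 2%Z.
    pose proof (walk_tail_compl n p 0) as C0. change (1 - 0)%Z with 1%Z in C0.
    pose proof (walk_tail_diff n p 0) as P0. change (0 + 1)%Z with 1%Z in P0.
    pose proof (walk_tail_diff n q 0) as Q0. change (0 + 1)%Z with 1%Z in Q0.
    pose proof (walk_tail_diff n q 1) as Q1. change (1 + 1)%Z with 2%Z in Q1.
    pose proof (walk_tail_diff n (1 - p) 1) as R1. change (1 + 1)%Z with 2%Z in R1.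
    rewrite (walk_prob_tilt n p q u E) in Q0, Q1 by auto.
    rewrite Rpower_O in Q0 by auto. rewrite Rpower_1 in Q1 by auto.
    assert (R2 : walk_prob n p 1 = th * walk_prob n (1 - p) 1).
    { rewrite <- (Rpower_1 th Hth).
      rewrite (walk_prob_tilt n (1 - p) p th 1 1); auto.
      - rewrite pow1. ring.
      - unfold th. field; lra.
      - unfold th. field; lra. }
    rewrite R2 in Q1.
    set (e := E ^ n) in *. set (A := Rpower u (0 - 1 + f)).
    set (b0 := walk_prob n p 0) in *. set (b1 := walk_prob n (1 - p) 1) in *.
    set (T1 := walk_tail n (1 - p) 1) in *. set (T2 := walk_tail n (1 - p) 2) in *.
    (* By complementation the coefficient of the power that contains [f] vanishes at [K = 0]. The
       rest is reduced to [T1], [T2], [b0] and a single [q]-tail, and the value of [c] closes the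
       identity. *)
    replace (1 - walk_tail n p 0 - 1 * T1) with 0 by lra.
    replace (walk_tail n p 1) with (1 - T1 - b0) by lra.
    replace (walk_tail n q 0) with (walk_tail n q 1 + e * 1 * b0) by lra.
    replace (walk_tail n q 1) with (walk_tail n q 2 + e * u * (th * b1)) by lra.
    replace b1 with (T1 - T2) by lra.
    change (u * th) with rho. replace th with (rho / u) by (unfold rho; field; lra).
    unfold c. field. split; lra.
Qed.

(** Here [u th = 1] forces [q = 1 - p]: the walk and its tilt are mirror images, so only the
    parameters [p] and [q] occur. At the boundary the excess contributes through its drop by one
    tail from level 1 to level 2. *)
Lemma reflected_mean_closed_zero u p q n K f :
  let th := p / (1 - p) in
  0 < u -> 0 < p < 1 -> q = p * u -> 1 - q = (1 - p) / u -> u * th = 1 ->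
  (1 <= K)%Z -> 0 <= f < 1 ->
  reflected_mean (Rpower u) q n (IZR K - 1 + f) =
    Rpower u (IZR K - 1 + f)
      * (1 - walk_tail n p K - Rpower th (IZR K) * walk_tail n q (K + 1))
    + (walk_tail n q K + walk_tail n q (K + 1)) + (1 - / u) * walk_excess n q (K + 1).
Proof.
  intros th Hu Hp Hq Hq1 Hrho HK Hf.
  assert (Hth : 0 < th) by (apply Rdiv_lt_0_compat; lra).
  assert (Hqp : q = 1 - p).
  { unfold th in Hrho. rewrite Hq. apply (f_equal (fun x => x * (1 - p))) in Hrho.
    replace (u * (p / (1 - p)) * (1 - p)) with (u * p) in Hrho by (field; lra). lra. }
  apply (reflected_mean_unique (Rpower u) q (fun n K f =>
    Rpower u (IZR K - 1 + f)
      * (1 - walk_tail n p K - Rpower th (IZR K) * walk_tail n q (K + 1))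
    + (walk_tail n q K + walk_tail n q (K + 1)) + (1 - / u) * walk_excess n q (K + 1)));
    auto; clear n K f HK Hf.
  - intros K f HK Hf. simpl. rewrite walk_excess_0 by lia.
    destruct (Z.leb_spec K 0), (Z.leb_spec (K + 1) 0); try lia. ring.
  - intros n K f. rewrite walk_excess_succ.
    cbn [walk_tail]. rewrite plus_IZR, minus_IZR.
    replace (IZR K + 1 - 1 + f) with (IZR K - 1 + f + 1) by ring.
    replace (IZR K - 1 - 1 + f) with (IZR K - 1 + f - 1) by ring.
    rewrite !Rpower_succ, !Rpower_pred by auto.
    replace (K - 1 + 1)%Z with K by lia. replace (K + 1 - 1)%Z with K by lia.
    set (A := Rpower u (IZR K - 1 + f)). set (B := Rpower th (IZR K)).
    set (t1 := walk_tail n p (K - 1)). set (t2 := walk_tail n p (K + 1)).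
    set (t3 := walk_tail n q K). set (t4 := walk_tail n q (K + 1 + 1)).
    assert (E1 : (1 - q) * ((A * u) * (1 - t2 - B * th * t4))
       + q * ((A / u) * (1 - t1 - B / th * t3))
       = A * (1 - (p * t1 + (1 - p) * t2) - B * (q * t3 + (1 - q) * t4))).
    { rewrite Hq1. replace th with (/ u) by (apply Rmult_eq_reg_l with u; [rewrite Rinv_r; lra|lra]).
      assert (Ep : p = q / u) by (rewrite Hq; field; lra).
      replace ((1 - p) / u * (A * u * (1 - t2 - B * / u * t4))) with
        ((1 - p) * A * (1 - t2) - A * B * t4 * ((1 - p) / u)) by (field; lra).
      rewrite <- Hq1, Ep. field. lra. }
    rewrite <- E1. ring.
  - intros n f Hf. cbn [Z.add].
    replace (IZR 1 - 1 + 0) with 0 by ring.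
    rewrite !Rpower_O, !Rpower_1 by auto.
    change (0 + 1)%Z with 1%Z. change (Z.pos (1 + 1)) with 2%Z.
    pose proof (walk_tail_compl n p 0) as C0. change (1 - 0)%Z with 1%Z in C0.
    rewrite <- Hqp in C0.
    pose proof (walk_tail_diff n p 0) as P0. change (0 + 1)%Z with 1%Z in P0.
    pose proof (walk_tail_diff n q 0) as Q0. change (0 + 1)%Z with 1%Z in Q0.
    pose proof (walk_excess_diff n q 1) as X1. change (1 + 1)%Z with 2%Z in X1.
    rewrite (walk_prob_tilt n p q u 1) in Q0 by (auto; lra).
    rewrite Rpower_O, pow1 in Q0 by auto.
    replace (1 - walk_tail n p 0 - 1 * walk_tail n q 1) with 0 by lra.
    replace (walk_tail n p 1) with (1 - walk_tail n q 1 - walk_prob n p 0) by lra.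
    replace (walk_excess n q 1) with (walk_excess n q 2 + walk_tail n q 2) by lra.
    replace (walk_tail n q 0) with (walk_tail n q 1 + 1 * 1 * walk_prob n p 0) by lra.
    replace (/ u) with th by (apply Rmult_eq_reg_l with u; [rewrite Rinv_r; lra|lra]).
    ring.
Qed.

(** * Summation over paths *)

Lemma sumR_app l1 l2 : sumR (l1 ++ l2) = sumR l1 + sumR l2.
Proof.
  induction l1 as [|x l1 IH]; simpl; [unfold sumR; simpl; ring|].
  unfold sumR in *; simpl. rewrite IH. ring.
Qed.

Lemma sumR_map_plus {A} (f g : A -> R) l :
  sumR (map (fun x => f x + g x) l) = sumR (map f l) + sumR (map g l).
Proof.
  induction l as [|x l IH]; unfold sumR in *; simpl; [ring|]. rewrite IH. ring.
Qed.

Lemma sumR_map_scal {A} c (f : A -> R) l :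
  sumR (map (fun x => c * f x) l) = c * sumR (map f l).
Proof.
  induction l as [|x l IH]; unfold sumR in *; simpl; [ring|]. rewrite IH. ring.
Qed.

Lemma sumR_map_ext_in {A} (f g : A -> R) l :
  (forall x, In x l -> f x = g x) -> sumR (map f l) = sumR (map g l).
Proof. intros H. f_equal. apply map_ext_in; auto. Qed.

Lemma sumR_map_0 {A} (l : list A) : sumR (map (fun _ => 0) l) = 0.
Proof. induction l as [|x l IH]; unfold sumR in *; simpl; [auto|]. rewrite IH. ring. Qed.

Lemma sumR_indicator (J : list R) (F : R -> R) x : NoDup J -> In x J ->
  sumR (map (fun j => if Req_EM_T x j then F j else 0) J) = F x.
Proof.
  induction J as [|y J IH]; intros ND Hx; [contradiction|].
  inversion ND as [|y' J' Hy HJ]; subst. simpl map.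
  change (sumR (?h :: ?t)) with (h + sumR t).
  destruct (Req_EM_T x y) as [->|Hxy].
  - rewrite sumR_map_ext_in with (g := fun _ => 0).
    + rewrite sumR_map_0. ring.
    + intros j Hj. destruct (Req_EM_T y j); [subst; contradiction|auto].
  - destruct Hx as [->|Hx]; [contradiction|]. rewrite IH; auto. ring.
Qed.

Lemma sum_f_R0_indicator (w : nat -> R) k n : (k <= n)%nat ->
  sum_f_R0 (fun i => if Nat.eqb k i then w i else 0) n = w k.
Proof.
  intros H. induction n as [|n IH].
  - simpl. replace k with 0%nat by lia. reflexivity.
  - rewrite tech5. destruct (Nat.eq_dec k (S n)) as [->|Hk].
    + rewrite Nat.eqb_refl, (sum_eq _ (fun _ => 0)).
      * rewrite sum_cte. ring.
      * intros i Hi. destruct (Nat.eqb_spec (S n) i); [lia|auto].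
    + rewrite IH by lia. destruct (Nat.eqb_spec k (S n)); [lia|ring].
Qed.

(** Each path has exactly one endpoint [j] and one count [k], so the double sum regroups into a sum
    over paths. The induction runs over an arbitrary list [L], which keeps the recursive structure
    of the paths out of the argument. *)
Lemma sum_over_levels (L : list (list bool)) (e : list bool -> R) (m : list bool -> nat)
  (J : list R) (g : R -> R) (w : nat -> R) n :
  NoDup J -> (forall p, In p L -> In (e p) J /\ (m p <= n)%nat) ->
  sumR (map (fun j => g j * sum_f_R0 (fun k =>
    INR (length (filter (fun p => andb (if Req_EM_T (e p) j then true else false)
                                       (Nat.eqb (m p) k)) L)) * w k) n) J)
  = sumR (map (fun p => g (e p) * w (m p)) L).
Proof.
  intros ND. induction L as [|p L IH]; intros H.
  - simpl map at 2. change (sumR nil) with 0.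
    rewrite <- (sumR_map_0 J). apply sumR_map_ext_in. intros j _. simpl.
    rewrite (sum_eq _ (fun _ => 0)); [rewrite sum_cte; ring|]. intros; ring.
  - simpl map at 2. change (sumR (?h :: ?t)) with (h + sumR t).
    rewrite <- IH by (intros; apply H; right; auto).
    destruct (H p) as [Hp Hm]; [left; auto|].
    rewrite <- (sumR_indicator J (fun j => g j * w (m p)) (e p)) by auto.
    rewrite <- sumR_map_plus. apply sumR_map_ext_in. intros j _. simpl filter.
    destruct (Req_EM_T (e p) j) as [E|E]; simpl andb; cbv iota.
    + rewrite <- Rmult_plus_distr_l. f_equal.
      rewrite <- (sum_f_R0_indicator w (m p) n Hm), <- sum_plus.
      apply sum_eq. intros i _.
      destruct (Nat.eqb (m p) i); [|ring].
      simpl length. rewrite S_INR. ring.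
    + ring.
Qed.

Lemma all_paths_length n p : In p (all_paths n) -> length p = n.
Proof.
  revert p; induction n as [|n IH]; intros p; simpl.
  - intros [<-|[]]; reflexivity.
  - intros H. apply in_app_or in H as [H|H]; apply in_map_iff in H as [p' [<- H]];
    simpl; f_equal; auto.
Qed.

Lemma nups_le p : (nups p <= length p)%nat.
Proof. apply count_occ_bound. Qed.

(** The head of the list is the first move, so the splitting in [all_paths] is exactly the
    first-step recursion. *)
Lemma sum_paths_reflected_mean g q n j :
  sumR (map (fun p => g (endpoint j p) * ((1 - q) ^ nups p * q ^ (n - nups p))) (all_paths n))
  = reflected_mean g q n j.
Proof.
  revert j; induction n as [|n IH]; intros j.
  - simpl. unfold sumR; simpl. ring.
  - cbn [reflected_mean all_paths]. rewrite map_app, sumR_app, !map_map, <- !IH, <- !sumR_map_scal.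
    f_equal; apply sumR_map_ext_in; intros p Hp; apply all_paths_length in Hp;
    pose proof (nups_le p) as Hn.
    + change (nups (true :: p)) with (S (nups p)).
      change (endpoint j (true :: p)) with (endpoint (j + 1) p).
      rewrite Nat.sub_succ. simpl. ring.
    + change (nups (false :: p)) with (nups p).
      change (endpoint j (false :: p)) with (endpoint (Rmax (j - 1) 0) p).
      rewrite Nat.sub_succ_l by lia. simpl. ring.
Qed.

Lemma reflected_mean_minus_1 g q n j :
  reflected_mean (fun x => g x - 1) q n j = reflected_mean g q n j - 1.
Proof.
  revert j; induction n as [|n IH]; intros j; simpl; [auto|]. rewrite !IH. ring.
Qed.

Lemma P_fl_reflected_mean S M r sigma tau n :
  P_fl S M r sigma tau n =
  S * (reflected_mean (Rpower (u_n sigma tau n)) (q_n r sigma tau n) n (j0_n S M sigma tau n) - 1).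
Proof.
  unfold P_fl. cbv zeta. f_equal. rewrite <- reflected_mean_minus_1, <- sum_paths_reflected_mean.
  set (q := q_n r sigma tau n). set (j0 := j0_n S M sigma tau n). set (u := u_n sigma tau n).
  rewrite <- (sum_over_levels (all_paths n) (endpoint j0) nups (reach_levels j0 n)
    (fun j => Rpower u j - 1) (fun k => (1 - q) ^ k * q ^ (n - k)) n).
  - apply sumR_map_ext_in. intros j _. f_equal. apply sum_eq. intros k _.
    unfold Lambda. ring.
  - apply NoDup_nodup.
  - intros p Hp. split.
    + apply nodup_In, in_map; auto.
    + rewrite <- (all_paths_length n p Hp). apply nups_le.
Qed.

(** * Wallis integrals and the central probability *)

Definition wallis (n : nat) : R := RInt (fun x => sin x ^ n) 0 (PI / 2).

Lemma ex_RInt_sin_pow n a b : ex_RInt (fun x => sin x ^ n) a b.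
Proof.
  apply (ex_RInt_continuous (V := R_CompleteNormedModule)). intros x _.
  apply (ex_derive_continuous (fun x => sin x ^ n)). auto_derive; auto.
Qed.

(** Integrates the derivative of [- cos x sin^(n+1) x] over a quarter period; both boundary values
    vanish. *)
Lemma wallis_rec n : (INR n + 2) * wallis (S (S n)) = (INR n + 1) * wallis n.
Proof.
  assert (HI : is_RInt (fun x => (INR n + 2) * sin x ^ S (S n) - (INR n + 1) * sin x ^ n) 0 (PI / 2)
     (minus (- cos (PI / 2) * sin (PI / 2) ^ S n) (- cos 0 * sin 0 ^ S n))).
  { apply (is_RInt_derive (fun x => - cos x * sin x ^ S n)).
    - intros x _. evar_last.
      { apply (is_derive_mult (fun x => - cos x) (fun x => sin x ^ S n) x (sin x)
          (INR (S n) * cos x * sin x ^ n)).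
        - auto_derive; auto; ring.
        - apply (is_derive_pow sin (S n) x (cos x)). apply is_derive_sin.
        - intros; apply Rmult_comm. }
      unfold plus, mult; cbn -[INR pow]. unfold mult; cbn -[INR pow]. rewrite S_INR.
      simpl pow. pose proof (sin2_cos2 x) as E. unfold Rsqr in E.
      transitivity ((INR n + 2) * (sin x * (sin x * sin x ^ n))
        - (INR n + 1) * (sin x * sin x + cos x * cos x) * sin x ^ n); [ring|].
      rewrite E. ring.
    - intros x _. apply (ex_derive_continuous
        (fun x => (INR n + 2) * sin x ^ S (S n) - (INR n + 1) * sin x ^ n)).
      auto_derive; auto. }
  apply (is_RInt_unique (V := R_CompleteNormedModule)) in HI.
  assert (E : RInt (fun x => (INR n + 2) * sin x ^ S (S n) - (INR n + 1) * sin x ^ n) 0 (PI / 2)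
    = (INR n + 2) * wallis (S (S n)) - (INR n + 1) * wallis n).
  { unfold wallis.
    assert (E1 : RInt (fun x => scal (INR n + 2) (sin x ^ S (S n))) 0 (PI / 2) =
      (INR n + 2) * RInt (fun x => sin x ^ S (S n)) 0 (PI / 2)).
    { apply (RInt_scal (V := R_CompleteNormedModule)), ex_RInt_sin_pow. }
    assert (E2 : RInt (fun x => scal (INR n + 1) (sin x ^ n)) 0 (PI / 2) =
      (INR n + 1) * RInt (fun x => sin x ^ n) 0 (PI / 2)).
    { apply (RInt_scal (V := R_CompleteNormedModule)), ex_RInt_sin_pow. }
    rewrite <- E1, <- E2.
    apply (RInt_minus (V := R_CompleteNormedModule) (fun x => scal (INR n + 2) (sin x ^ S (S n)))
      (fun x => scal (INR n + 1) (sin x ^ n)));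
      apply (ex_RInt_scal (V := R_CompleteNormedModule)), ex_RInt_sin_pow. }
  rewrite E, cos_PI2, sin_0 in HI.
  change (minus ?a ?b) with (a - b) in HI.
  rewrite pow_i in HI by lia. lra.
Qed.

Lemma wallis_0 : wallis 0 = PI / 2.
Proof.
  unfold wallis. simpl. rewrite RInt_const. unfold scal; simpl; unfold mult; simpl. ring.
Qed.

Lemma wallis_1 : wallis 1 = 1.
Proof.
  unfold wallis. apply is_RInt_unique.
  apply (is_RInt_ext sin); [intros; simpl; symmetry; apply Rmult_1_r|].
  assert (E : 1 = minus (- cos (PI / 2)) (- cos 0)).
  { rewrite cos_PI2, cos_0. unfold minus, plus, opp; simpl; ring. }
  rewrite E. apply (is_RInt_derive (fun x => - cos x)).
  - intros x _. auto_derive; auto; ring.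
  - intros x _. apply (ex_derive_continuous sin). auto_derive; auto.
Qed.

Lemma wallis_decr n : wallis (S n) <= wallis n.
Proof.
  pose proof PI_RGT_0.
  apply RInt_le; [lra|apply ex_RInt_sin_pow|apply ex_RInt_sin_pow|].
  intros x Hx. assert (0 <= sin x) by (apply sin_ge_0; lra).
  pose proof (SIN_bound x). simpl.
  pose proof (pow_le (sin x) n H0). nra.
Qed.

(** The return probability [C(2m, m) / 4^m] of the symmetric walk. *)
Definition central (m : nat) : R := walk_prob (2 * m) (/ 2) 0.

Lemma walk_half_opp n k : walk_prob n (/ 2) (- k) = walk_prob n (/ 2) k.
Proof.
  rewrite <- (walk_prob_opp n (/ 2) k). f_equal. field.
Qed.

(** Lets the same numbers serve for odd [n], where the levels nearest to the centre are [1] and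
    [-1]. *)
Lemma central_odd m : central (S m) = walk_prob (2 * m + 1) (/ 2) 1.
Proof.
  unfold central. replace (2 * S m)%nat with (S (2 * m + 1)) by lia.
  cbn [walk_prob]. change (0 - 1)%Z with (- (1))%Z. rewrite walk_half_opp.
  change (0 + 1)%Z with 1%Z. field.
Qed.

Lemma central_0 : central 0 = 1.
Proof. reflexivity. Qed.

Lemma central_succ m : central (S m) = central m * ((2 * INR m + 1) / (2 * INR m + 2)).
Proof.
  rewrite central_odd. replace (2 * m + 1)%nat with (S (2 * m)) by lia.
  cbn [walk_prob]. change (1 - 1)%Z with 0%Z. change (1 + 1)%Z with 2%Z.
  pose proof (walk_prob_ratio (2 * m) (/ 2) 0) as H. change (0 + 2)%Z with 2%Z in H.
  rewrite mult_INR in H. change (INR 2) with 2 in H. fold (central m) in *.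
  pose proof (pos_INR m).
  replace (walk_prob (2 * m) (/ 2) 2) with (2 * INR m / (2 * INR m + 2) * central m).
  - field. lra.
  - apply Rmult_eq_reg_l with (2 * INR m + 2); [|lra].
    transitivity (2 * INR m * central m); [field; lra|]. lra.
Qed.

Lemma central_pos m : 0 < central m.
Proof.
  induction m as [|m IH]; [rewrite central_0; lra|]. rewrite central_succ.
  pose proof (pos_INR m). apply Rmult_lt_0_compat; auto. apply Rdiv_lt_0_compat; lra.
Qed.

Lemma wallis_even m : wallis (2 * m) = PI / 2 * central m.
Proof.
  induction m as [|m IH]; [rewrite central_0; simpl; rewrite wallis_0; ring|].
  replace (2 * S m)%nat with (S (S (2 * m))) by lia.
  pose proof (wallis_rec (2 * m)) as H. rewrite IH, mult_INR in H. change (INR 2) with 2 in H.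
  pose proof (pos_INR m). rewrite central_succ.
  apply Rmult_eq_reg_l with (2 * INR m + 2); [|lra]. rewrite H. field. lra.
Qed.

Lemma wallis_odd m : wallis (2 * m + 1) * ((2 * INR m + 1) * central m) = 1.
Proof.
  induction m as [|m IH]; [rewrite central_0; simpl; rewrite wallis_1; ring|].
  replace (2 * S m + 1)%nat with (S (S (2 * m + 1))) by lia.
  pose proof (wallis_rec (2 * m + 1)) as H. rewrite plus_INR, mult_INR in H.
  change (INR 2) with 2 in H. change (INR 1) with 1 in H.
  pose proof (pos_INR m). rewrite central_succ, S_INR.
  etransitivity; [|exact IH].
  replace (wallis (S (S (2 * m + 1)))) with
    ((2 * INR m + 2) / (2 * INR m + 3) * wallis (2 * m + 1)).
  - field. lra.
  - apply Rmult_eq_reg_l with (2 * INR m + 3); [|lra].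
    transitivity ((2 * INR m + 2) * wallis (2 * m + 1)); [field; lra|]. lra.
Qed.

(** [W(2m+1) <= W(2m) <= W(2m-1)], with the even and odd integrals expressed through [central]; for
    [m = 0] the upper bound is [PI <= 4]. *)
Lemma central_wallis m : 1 <= PI / 2 * (2 * INR m + 1) * central m ^ 2 <= 1 + / INR (S m).
Proof.
  pose proof (pos_INR m) as Hm. pose proof (central_pos m) as Hc. pose proof PI_RGT_0 as HP.
  pose proof (wallis_odd m) as O. pose proof (wallis_even m) as E.
  set (K := (2 * INR m + 1) * central m) in *.
  assert (HK : 0 < K) by (apply Rmult_lt_0_compat; lra).
  replace (PI / 2 * (2 * INR m + 1) * central m ^ 2) with (wallis (2 * m) * K)
    by (rewrite E; unfold K; ring).
  split.
  - rewrite <- O. apply Rmult_le_compat_r; [lra|].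
    replace (2 * m + 1)%nat with (S (2 * m)) by lia. apply wallis_decr.
  - destruct m as [|m].
    + simpl in *. rewrite wallis_0. unfold K. rewrite central_0. pose proof PI_4. simpl. lra.
    + replace (2 * S m)%nat with (S (2 * m + 1)) by lia.
      apply Rle_trans with (wallis (2 * m + 1) * K).
      { apply Rmult_le_compat_r; [lra|]. apply wallis_decr. }
      pose proof (wallis_odd m) as O'. pose proof (pos_INR m). unfold K.
      rewrite central_succ. rewrite !S_INR in *.
      replace (wallis (2 * m + 1) * ((2 * (INR m + 1) + 1)
          * (central m * ((2 * INR m + 1) / (2 * INR m + 2)))))
        with ((wallis (2 * m + 1) * ((2 * INR m + 1) * central m))
          * ((2 * (INR m + 1) + 1) / (2 * INR m + 2))) by (field; lra).
      rewrite O', Rmult_1_l.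
      apply Rle_trans with (1 + / (2 * (INR m + 1))); [right; field; lra|].
      apply Rplus_le_compat_l, Rinv_le_contravar; lra.
Qed.

Lemma central_lim : is_lim_seq (fun m => PI / 2 * (2 * INR m + 1) * central m ^ 2) 1.
Proof.
  apply is_lim_seq_le_le with (fun _ => 1) (fun m => 1 + / INR (S m)).
  - intros m. apply central_wallis.
  - apply is_lim_seq_const.
  - replace (Finite 1) with (Finite (1 + 0)) by (f_equal; ring).
    apply is_lim_seq_plus'; [apply is_lim_seq_const|].
    apply (is_lim_seq_incr_1 (fun n => / INR n)).
    replace (Finite 0) with (Rbar_inv p_infty) by reflexivity.
    apply is_lim_seq_inv; [apply is_lim_seq_INR|discriminate].
Qed.

(** Both expressions tend to 1 by Wallis; the first increases and the second decreases. The [1/4] is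
    the second term in [1 / (PI central m ^ 2) = m + 1/4 + O(1 / m)], and adding [1 / m] reverses
    the monotonicity. *)
Lemma central_bounds m : (1 <= m)%nat ->
  PI * (INR m + / 4) * central m ^ 2 <= 1 <= PI * (INR m + / 4 + / INR m) * central m ^ 2.
Proof.
  intros Hm.
  assert (Hr : is_lim_seq (fun m => / (2 * INR m + 1)) 0).
  { replace (Finite 0) with (Rbar_inv p_infty) by reflexivity.
    apply is_lim_seq_inv; [|discriminate].
    apply is_lim_seq_le_p_loc with INR; [|apply is_lim_seq_INR].
    exists 0%nat. intros k _. pose proof (pos_INR k). lra. }
  pose proof PI_RGT_0 as HP.
  assert (Hinv : is_lim_seq (fun m => / INR (m + 1)) 0).
  { apply (is_lim_seq_incr_n (fun m => / INR m) 1).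
    replace (Finite 0) with (Rbar_inv p_infty) by reflexivity.
    apply is_lim_seq_inv; [apply is_lim_seq_INR|discriminate]. }
  assert (L1 : is_lim_seq (fun m => PI * (INR (m + 1) + / 4) * central (m + 1) ^ 2) 1).
  { apply (is_lim_seq_incr_n (fun m => PI * (INR m + / 4) * central m ^ 2) 1).
    apply is_lim_seq_ext with (fun m => (PI / 2 * (2 * INR m + 1) * central m ^ 2)
      * (1 - / 2 * / (2 * INR m + 1))).
    { intros k. pose proof (pos_INR k). field. lra. }
    replace (Finite 1) with (Finite (1 * (1 - / 2 * 0))) by (f_equal; ring).
    apply is_lim_seq_mult'; [apply central_lim|].
    apply is_lim_seq_minus'; [apply is_lim_seq_const|].
    apply is_lim_seq_mult'; [apply is_lim_seq_const|auto]. }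
  assert (L2 : is_lim_seq (fun m => PI * (INR (m + 1) + / 4 + / INR (m + 1)) * central (m + 1) ^ 2) 1).
  { apply is_lim_seq_ext with (fun m => (PI * (INR (m + 1) + / 4) * central (m + 1) ^ 2)
      * (1 + / INR (m + 1) * / (INR (m + 1) + / 4))).
    { intros k. assert (0 < INR (k + 1)) by (apply lt_0_INR; lia). field. lra. }
    replace (Finite 1) with (Finite (1 * (1 + 0 * 0))) by (f_equal; ring).
    apply is_lim_seq_mult'; [apply L1|].
    apply is_lim_seq_plus'; [apply is_lim_seq_const|].
    apply is_lim_seq_mult'; auto.
    replace (Finite 0) with (Rbar_inv p_infty) by reflexivity.
    apply is_lim_seq_inv; [|discriminate].
    apply is_lim_seq_le_p_loc with (fun m => INR (m + 1)).
    - exists 0%nat. intros k _. lra.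
    - apply (is_lim_seq_incr_n INR 1), is_lim_seq_INR. }
  (* The sequences are indexed from 1, so that [1 / m] is taken at positive arguments only. *)
  replace m with ((m - 1) + 1)%nat by lia. generalize (m - 1)%nat; clear m Hm. intros m.
  split.
  - apply (growing_ineq (fun m => PI * (INR (m + 1) + / 4) * central (m + 1) ^ 2) 1).
    + intros k. replace (S k + 1)%nat with (S (k + 1)) by lia.
      rewrite central_succ, S_INR. pose proof (pos_INR (k + 1)) as Hk.
      set (x := INR (k + 1)) in *. pose proof (central_pos (k + 1)).
      set (y := central (k + 1)) in *.
      replace (PI * (x + 1 + / 4) * (y * ((2 * x + 1) / (2 * x + 2))) ^ 2) with
        (PI * y ^ 2 * ((x + 1 + / 4) * ((2 * x + 1) / (2 * x + 2)) ^ 2)) by (field; lra).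
      replace (PI * (x + / 4) * y ^ 2) with (PI * y ^ 2 * (x + / 4)) by ring.
      apply Rmult_le_compat_l.
      { apply Rmult_le_pos; [lra|apply pow2_ge_0]. }
      (* The exact increment: with the shift [1/4] all larger terms cancel. *)
      apply Rle_trans with ((x + / 4) + / (4 * (2 * x + 2) ^ 2)).
      * assert (0 < / (4 * (2 * x + 2) ^ 2)) by (apply Rinv_0_lt_compat; nra). lra.
      * right. field. lra.
    + apply is_lim_seq_Reals. exact L1.
  - apply (decreasing_ineq (fun m => PI * (INR (m + 1) + / 4 + / INR (m + 1)) * central (m + 1) ^ 2) 1).
    + intros k. replace (S k + 1)%nat with (S (k + 1)) by lia.
      rewrite central_succ, S_INR.
      assert (Hk : 1 <= INR (k + 1)) by (apply (le_INR 1); lia).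
      set (x := INR (k + 1)) in *. pose proof (central_pos (k + 1)).
      set (y := central (k + 1)) in *.
      replace (PI * (x + 1 + / 4 + / (x + 1)) * (y * ((2 * x + 1) / (2 * x + 2))) ^ 2) with
        (PI * y ^ 2 * ((x + 1 + / 4 + / (x + 1)) * ((2 * x + 1) / (2 * x + 2)) ^ 2)) by (field; lra).
      replace (PI * (x + / 4 + / x) * y ^ 2) with (PI * y ^ 2 * (x + / 4 + / x)) by ring.
      apply Rmult_le_compat_l.
      { apply Rmult_le_pos; [lra|apply pow2_ge_0]. }
      (* The exact decrement, a quotient of polynomials with positive coefficients. *)
      apply Rle_trans with ((x + / 4 + / x) - ((31 * x ^ 2 + 43 * x + 16) / (16 * x * (x + 1) ^ 3))).
      * right. field. lra.
      * assert (0 < (31 * x ^ 2 + 43 * x + 16) / (16 * x * (x + 1) ^ 3)).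
        { apply Rdiv_lt_0_compat; [nra|]. apply Rmult_lt_0_compat; [lra|apply pow_lt; lra]. }
        lra.
    + apply is_lim_seq_Reals. exact L2.
Qed.

(** * The local limit expansion *)

(** The remainder has derivative [x^4 / (1 + x)], at most [2 |z|^4] between 0 and [z]. *)
Lemma ln_taylor4 z : Rabs z <= / 2 ->
  Rabs (ln (1 + z) - (z - z ^ 2 / 2 + z ^ 3 / 3 - z ^ 4 / 4)) <= 2 * Rabs z ^ 5.
Proof.
  intros Hz.
  assert (Hz' : - / 2 <= z <= / 2) by (revert Hz; unfold Rabs; destruct (Rcase_abs z); lra).
  set (f := fun x => ln (1 + x) - (x - x ^ 2 / 2 + x ^ 3 / 3 - x ^ 4 / 4)).
  assert (H : Rabs (f z - f 0) <= (2 * Rabs z ^ 4) * Rabs (z - 0)).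
  { assert (R : forall x, Rmin 0 z <= x <= Rmax 0 z -> - / 2 <= x <= / 2 /\ Rabs x <= Rabs z).
    { intros x. unfold Rmin, Rmax. destruct (Rle_dec 0 z); intros Hx; (split; [lra|]);
      unfold Rabs; destruct (Rcase_abs x), (Rcase_abs z); lra. }
    apply derivative_bound with (fun x => x ^ 4 / (1 + x)).
    - intros x Hx. destruct (R x Hx). unfold f. auto_derive; [lra|]. field. lra.
    - intros x Hx. destruct (R x Hx) as [H1 H2]. unfold Rdiv.
      rewrite Rabs_mult, <- RPow_abs, (Rabs_pos_eq (/ _)).
      2:{ left; apply Rinv_0_lt_compat; lra. }
      rewrite (Rmult_comm 2). apply Rmult_le_compat.
      + apply pow_le, Rabs_pos.
      + left; apply Rinv_0_lt_compat; lra.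
      + apply pow_incr. split; [apply Rabs_pos|auto].
      + rewrite <- (Rinv_inv 2). apply Rinv_le_contravar; lra. }
  replace (f 0) with 0 in H by (unfold f; rewrite Rplus_0_r, ln_1; field).
  rewrite !Rminus_0_r in H. unfold f in H. eapply Rle_trans; [exact H|]. right; ring.
Qed.

Lemma ln_taylor1 x : 0 <= x -> x - x ^ 2 <= ln (1 + x) <= x.
Proof.
  intros Hx. split.
  - assert (H : ln (/ (1 + x)) <= / (1 + x) - 1).
    { rewrite <- (ln_exp (/ (1 + x) - 1)). apply ln_le; [apply Rinv_0_lt_compat; lra|].
      pose proof (exp_ineq1_le (/ (1 + x) - 1)). lra. }
    rewrite ln_Rinv in H by lra.
    apply Rle_trans with (1 - / (1 + x)); [|lra].
    apply Rmult_le_reg_r with (1 + x); [lra|].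
    replace ((1 - / (1 + x)) * (1 + x)) with x by (field; lra). nra.
  - rewrite <- (ln_exp x) at 2. apply ln_le; [lra|]. apply exp_ineq1_le.
Qed.

(** The even powers cancel, so two terms already leave an error of fifth order. Consecutive
    symmetric weights have this ratio at [z = (k + 1) / (n + 1)]. *)
Lemma ln_log_ratio z : Rabs z <= / 2 ->
  Rabs (ln ((1 - z) / (1 + z)) - (- 2 * z - 2 / 3 * z ^ 3)) <= 4 * Rabs z ^ 5.
Proof.
  intros Hz. pose proof (ln_taylor4 z Hz) as H1.
  pose proof (ln_taylor4 (- z)) as H2. rewrite Rabs_Ropp in H2. specialize (H2 Hz).
  assert (Hz' : - / 2 <= z <= / 2) by (revert Hz; unfold Rabs; destruct (Rcase_abs z); lra).
  rewrite ln_div by lra.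
  replace (1 + - z) with (1 - z) in H2 by ring.
  replace (ln (1 - z) - ln (1 + z) - (-2 * z - 2 / 3 * z ^ 3)) with
    ((ln (1 - z) - (- z - (- z) ^ 2 / 2 + (- z) ^ 3 / 3 - (- z) ^ 4 / 4))
     - (ln (1 + z) - (z - z ^ 2 / 2 + z ^ 3 / 3 - z ^ 4 / 4))) by field.
  eapply Rle_trans; [apply Rabs_triang|]. rewrite Rabs_Ropp. lra.
Qed.

(** A discrete antiderivative, in steps of 2, of [- 2 z - 2 z^3 / 3] at [z = (k + 1) / (n + 1)], up
    to [2 (k + 1) / (3 (n + 1)^3)]. The exact ratio of weights dictates [n + 1] in place of [n]. *)
Definition log_profile (n : nat) (k : Z) : R :=
  - IZR k ^ 2 / (2 * (INR n + 1)) - IZR k ^ 4 / (12 * (INR n + 1) ^ 3).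

Lemma walk_half_step n k :
  0 < walk_prob n (/ 2) k -> (0 <= k)%Z -> IZR k < INR n ->
  (IZR k + 1) / (INR n + 1) <= / 2 ->
  0 < walk_prob n (/ 2) (k + 2) /\
  Rabs (ln (walk_prob n (/ 2) (k + 2)) - log_profile n (k + 2)
        - (ln (walk_prob n (/ 2) k) - log_profile n k))
  <= 4 * ((IZR k + 1) / (INR n + 1)) ^ 5 + (IZR k + 1) / (INR n + 1) ^ 3.
Proof.
  intros Hb Hk Hkn Hz.
  assert (Hk0 : 0 <= IZR k) by (apply (IZR_le 0); auto).
  set (z := (IZR k + 1) / (INR n + 1)) in *.
  assert (Hz0 : 0 < z) by (apply Rdiv_lt_0_compat; lra).
  assert (E : walk_prob n (/ 2) (k + 2) = walk_prob n (/ 2) k * ((1 - z) / (1 + z))).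
  { pose proof (walk_prob_ratio n (/ 2) k) as H.
    apply Rmult_eq_reg_l with (INR n + IZR k + 2); [|lra].
    transitivity ((INR n - IZR k) * walk_prob n (/ 2) k); [lra|].
    unfold z. field. lra. }
  assert (Hq : 0 < (1 - z) / (1 + z)) by (apply Rdiv_lt_0_compat; lra).
  split.
  - rewrite E. apply Rmult_lt_0_compat; auto.
  - rewrite E, ln_mult by auto. unfold log_profile. rewrite plus_IZR.
    set (w := walk_prob n (/ 2) k). clearbody w.
    match goal with |- Rabs ?X <= _ => replace X with
      ((ln ((1 - z) / (1 + z)) - (- 2 * z - 2 / 3 * z ^ 3))
       + 2 / 3 * ((IZR k + 1) / (INR n + 1) ^ 3)) end.
    2:{ unfold z. field. lra. }
    eapply Rle_trans; [apply Rabs_triang|].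
    assert (0 <= (IZR k + 1) / (INR n + 1) ^ 3).
    { left. apply Rdiv_lt_0_compat; [lra|]. apply pow_lt; lra. }
    rewrite (Rabs_pos_eq (2 / 3 * _)) by lra.
    apply Rplus_le_compat; [|lra].
    eapply Rle_trans; [apply ln_log_ratio; rewrite Rabs_pos_eq; lra|].
    rewrite Rabs_pos_eq by lra. lra.
Qed.

Lemma walk_half_iter n k0 e j : (0 <= k0)%Z ->
  0 < walk_prob n (/ 2) k0 ->
  (forall k, (0 <= k < k0 + 2 * Z.of_nat j)%Z -> IZR k < INR n /\
     (IZR k + 1) / (INR n + 1) <= / 2 /\
     4 * ((IZR k + 1) / (INR n + 1)) ^ 5 + (IZR k + 1) / (INR n + 1) ^ 3 <= e) ->
  0 < walk_prob n (/ 2) (k0 + 2 * Z.of_nat j) /\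
  Rabs (ln (walk_prob n (/ 2) (k0 + 2 * Z.of_nat j)) - log_profile n (k0 + 2 * Z.of_nat j)
        - (ln (walk_prob n (/ 2) k0) - log_profile n k0)) <= INR j * e.
Proof.
  intros Hk0 Hb. induction j as [|j IH]; intros H.
  - simpl. replace (k0 + 0)%Z with k0 by lia. split; auto.
    unfold Rminus at 1. rewrite Rplus_opp_r, Rabs_R0. lra.
  - destruct IH as [P B]; [intros; apply H; lia|].
    destruct (H (k0 + 2 * Z.of_nat j)%Z) as [H1 [H2 H3]]; [lia|].
    destruct (walk_half_step n (k0 + 2 * Z.of_nat j) P) as [P' B']; auto; [lia|].
    replace (k0 + 2 * Z.of_nat (S j))%Z with (k0 + 2 * Z.of_nat j + 2)%Z by lia.
    split; auto. rewrite S_INR.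
    match goal with |- Rabs (?x - ?y) <= _ => replace (x - y) with
      ((x - (ln (walk_prob n (/ 2) (k0 + 2 * Z.of_nat j))
          - log_profile n (k0 + 2 * Z.of_nat j)))
       + ((ln (walk_prob n (/ 2) (k0 + 2 * Z.of_nat j))
          - log_profile n (k0 + 2 * Z.of_nat j)) - y)) by ring end.
    eapply Rle_trans; [apply Rabs_triang|]. lra.
Qed.

Lemma ln_central m : (1 <= m)%nat -> exists th, 0 <= th <= / INR m /\
  ln (central m) = - / 2 * ln (PI * (INR m + / 4 + th)).
Proof.
  intros Hm. destruct (central_bounds m Hm) as [L U].
  assert (Hm1 : 1 <= INR m) by (apply (le_INR 1); auto).
  pose proof (central_pos m) as Hc. pose proof PI_RGT_0 as HP.
  assert (Hc2 : 0 < PI * central m ^ 2) by (apply Rmult_lt_0_compat; [lra|apply pow_lt; auto]).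
  exists (/ (PI * central m ^ 2) - INR m - / 4).
  assert (Hi : PI * central m ^ 2 * / (PI * central m ^ 2) = 1) by (apply Rinv_r; lra).
  split; [split|].
  - assert (INR m + / 4 <= / (PI * central m ^ 2)); [|lra].
    apply Rmult_le_reg_l with (PI * central m ^ 2); lra.
  - assert (/ (PI * central m ^ 2) <= INR m + / 4 + / INR m); [|lra].
    apply Rmult_le_reg_l with (PI * central m ^ 2); lra.
  - replace (PI * (INR m + / 4 + (/ (PI * central m ^ 2) - INR m - / 4))) with
      (/ (central m ^ 2)) by (field; split; lra).
    rewrite ln_Rinv by (apply pow_lt; auto). rewrite (ln_pow (central m) 2 Hc). simpl. field.
Qed.

Lemma inv_sqrt_INR n : (1 <= n)%nat -> let s := / sqrt (INR n) in
  0 < s /\ s <= 1 /\ INR n = / s ^ 2.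
Proof.
  intros Hn s. assert (1 <= INR n) by (apply (le_INR 1); auto).
  assert (1 <= sqrt (INR n)) by (rewrite <- sqrt_1; apply sqrt_le_1_alt; auto).
  split; [apply Rinv_0_lt_compat; lra|]. split.
  - unfold s. rewrite <- Rinv_1. apply Rinv_le_contravar; lra.
  - unfold s. rewrite pow_inv, pow2_sqrt by lra. rewrite Rinv_inv. reflexivity.
Qed.

Lemma walk_half_center n k0 : (1 <= n)%nat -> (k0 = 0 \/ k0 = 1)%Z ->
  Z.even (Z.of_nat n + k0) = true ->
  let s := / sqrt (INR n) in
  0 < walk_prob n (/ 2) k0 /\
  Rabs (ln (walk_prob n (/ 2) k0) - log_profile n k0
        - (ln (2 * s) - / 2 * ln (2 * PI) - s ^ 2 / 4)) <= 50 * s ^ 4.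
Proof.
  intros Hn Hk He s. destruct (inv_sqrt_INR n Hn) as [Hs [Hs1 HsN]]. fold s in Hs, Hs1, HsN.
  set (m := Z.to_nat ((Z.of_nat n + k0) / 2)).
  assert (Hm : (Z.of_nat n + k0 = 2 * Z.of_nat m)%Z).
  { unfold m. rewrite Z2Nat.id by (apply Z.div_pos; lia).
    apply Z.even_spec in He as [j Hj]. rewrite Hj, Z.mul_comm, Z.div_mul; lia. }
  assert (HmR : INR n + IZR k0 = 2 * INR m).
  { rewrite !INR_IZR_INZ, <- plus_IZR, Hm, mult_IZR. reflexivity. }
  assert (Hm1 : (1 <= m)%nat) by lia.
  assert (Eb : walk_prob n (/ 2) k0 = central m).
  { destruct Hk as [-> | ->].
    - unfold central. f_equal. lia.
    - destruct m as [|m']; [lia|]. rewrite central_odd. f_equal. lia. }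
  rewrite Eb. pose proof (central_pos m) as Hc. split; auto.
  destruct (ln_central m Hm1) as [th [Hth El]]. rewrite El.
  assert (Hk0 : 0 <= IZR k0 <= 1) by (destruct Hk as [-> | ->]; lra).
  assert (HmN : INR m = (/ s ^ 2) * (1 + IZR k0 * s ^ 2) / 2).
  { apply Rmult_eq_reg_l with 2; [|lra]. rewrite <- HmR, HsN. field. lra. }
  (* The relative excess of [PI (m + 1/4 + th)] over [2 PI / (2 s)^2]. Its part [k0 s^2] is matched
     by [log_profile n k0]. The quadratic term of the logarithm, [th] and the profile leave at most
     [(18 + 2 + 1) s^4], within the bound with [50]. *)
  set (x := s ^ 2 / 2 + IZR k0 * s ^ 2 + 2 * th * s ^ 2).
  assert (Hm1' : 1 <= INR m) by (apply (le_INR 1); auto).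
  assert (Hths : th <= 2 * s ^ 2).
  { eapply Rle_trans; [apply Hth|].
    replace (2 * s ^ 2) with (/ (/ s ^ 2 / 2)) by (field; lra).
    assert (0 < / s ^ 2) by (apply Rinv_0_lt_compat, pow_lt; auto).
    apply Rinv_le_contravar; [lra|]. rewrite HmN.
    assert (0 <= IZR k0 * s ^ 2) by (apply Rmult_le_pos; [lra|apply pow2_ge_0]).
    unfold Rdiv. apply Rmult_le_compat_r; [lra|]. rewrite <- (Rmult_1_r (/ s ^ 2)) at 1.
    apply Rmult_le_compat_l; lra. }
  assert (Hs2 : 0 < s ^ 2 <= 1).
  { split; [apply pow_lt; auto|]. rewrite <- (pow1 2). apply pow_incr; lra. }
  assert (Hx : 0 <= x <= 6 * s ^ 2).
  { unfold x. split.
    - assert (0 <= IZR k0 * s ^ 2) by (apply Rmult_le_pos; lra).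
      assert (0 <= th * s ^ 2) by (apply Rmult_le_pos; lra). lra.
    - assert (IZR k0 * s ^ 2 <= 1 * s ^ 2) by (apply Rmult_le_compat_r; lra).
      assert (th * s ^ 2 <= (2 * 1) * s ^ 2) by (apply Rmult_le_compat_r; lra). lra. }
  pose proof PI_RGT_0 as HP.
  assert (EL : ln (PI * (INR m + / 4 + th)) = ln (2 * PI) - 2 * ln (2 * s) + ln (1 + x)).
  { replace (PI * (INR m + / 4 + th)) with ((2 * PI) / (2 * s) ^ 2 * (1 + x)).
    - rewrite ln_mult; [|apply Rdiv_lt_0_compat; [lra|apply pow_lt; lra]|lra].
      rewrite ln_div; [|lra|apply pow_lt; lra]. rewrite ln_pow by lra. simpl. ring.
    - rewrite HmN. unfold x. field. lra. }
  rewrite EL. pose proof (ln_taylor1 x (proj1 Hx)) as Hl.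
  assert (Hp : Rabs (log_profile n k0 + IZR k0 * s ^ 2 / 2) <= s ^ 4).
  { unfold log_profile. rewrite HsN.
    assert (E4 : s ^ 4 = s ^ 2 * s ^ 2) by ring.
    destruct Hk as [-> | ->].
    - rewrite pow_i, pow_i by lia. unfold Rdiv.
      match goal with |- Rabs ?X <= _ => replace X with 0 by ring end. rewrite Rabs_R0. nra.
    - rewrite !pow1.
      match goal with |- Rabs ?X <= _ => replace X with
        (s ^ 4 * (/ 2 * / (1 + s ^ 2) - s ^ 2 / 12 * (/ (1 + s ^ 2)) ^ 3)) end.
      2:{ field. repeat split; nra. }
      set (y := / (1 + s ^ 2)).
      assert (Hy : 0 < y <= 1).
      { unfold y. split; [apply Rinv_0_lt_compat; lra|].
        rewrite <- Rinv_1. apply Rinv_le_contravar; lra. }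
      assert (0 < y ^ 3 <= 1).
      { split; [apply pow_lt; lra|]. rewrite <- (pow1 3). apply pow_incr; lra. }
      assert (0 <= s ^ 2 * y ^ 3 <= 1) by (split; nra).
      rewrite Rabs_mult, (Rabs_pos_eq (s ^ 4)) by (rewrite E4; nra).
      rewrite <- (Rmult_1_r (s ^ 4)) at 2. apply Rmult_le_compat_l; [rewrite E4; nra|].
      apply Rabs_le. lra. }
  assert (Hx2 : x ^ 2 <= 36 * s ^ 4).
  { replace (36 * s ^ 4) with ((6 * s ^ 2) ^ 2) by ring. apply pow_incr; lra. }
  assert (Ht2 : 0 <= th * s ^ 2 <= 2 * s ^ 4).
  { split; [apply Rmult_le_pos; lra|]. replace (2 * s ^ 4) with (2 * s ^ 2 * s ^ 2) by ring.
    apply Rmult_le_compat_r; lra. }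
  revert Hp. unfold x in *. intros Hp.
  apply Rabs_le. apply Rabs_le_between in Hp.
  set (l := ln (1 + _)) in *. lra.
Qed.

Lemma even_decompose n k : (0 <= k)%Z -> Z.even (Z.of_nat n + k) = true ->
  exists k0 j, (k0 = 0 \/ k0 = 1)%Z /\ k = (k0 + 2 * Z.of_nat j)%Z /\
    Z.even (Z.of_nat n + k0) = true.
Proof.
  intros Hk He. exists (k mod 2)%Z, (Z.to_nat (k / 2)).
  pose proof (Z.mod_pos_bound k 2). pose proof (Z.div_mod k 2).
  assert (0 <= k / 2)%Z by (apply Z.div_pos; lia).
  split; [lia|split; [lia|]].
  rewrite <- He, !Z.even_add. f_equal.
  rewrite Zmod_even. destruct (Z.even k); reflexivity.
Qed.

Lemma log_profile_opp n k : log_profile n (- k) = log_profile n k.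
Proof. unfold log_profile. rewrite opp_IZR. f_equal; [f_equal; f_equal|]; try ring. f_equal. ring. Qed.

(** From the centre outwards, [O(1 / s)] steps of size 2 cost [O(s^5)] each, hence [O(s^4)] in
    total. The radius keeps every [z] below [1/2], and negative [k] follow by symmetry. *)
Lemma walk_half_local B : 0 <= B -> exists C d, 0 < d /\ forall n k,
  let s := / sqrt (INR n) in
  (1 <= n)%nat -> s <= d -> Z.even (Z.of_nat n + k) = true -> Rabs (IZR k * s) <= B ->
  0 < walk_prob n (/ 2) k /\
  Rabs (ln (walk_prob n (/ 2) k) - log_profile n k
        - (ln (2 * s) - / 2 * ln (2 * PI) - s ^ 2 / 4)) <= C * s ^ 4.
Proof.
  intros HB.
  exists (50 + B * (4 * (B + 1) ^ 5 + (B + 1))), (/ (2 * (B + 1))).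
  split; [apply Rinv_0_lt_compat; lra|].
  intros n k s Hn Hsd He HkB.
  destruct (inv_sqrt_INR n Hn) as [Hs [Hs1 HsN]]. fold s in Hs, Hs1, HsN.
  assert (HsB : s * (B + 1) <= / 2).
  { apply Rle_trans with (/ (2 * (B + 1)) * (B + 1)); [apply Rmult_le_compat_r; lra|].
    right; field; lra. }
  assert (M : forall k, (0 <= k)%Z -> Z.even (Z.of_nat n + k) = true -> IZR k * s <= B ->
    0 < walk_prob n (/ 2) k /\
    Rabs (ln (walk_prob n (/ 2) k) - log_profile n k
        - (ln (2 * s) - / 2 * ln (2 * PI) - s ^ 2 / 4))
      <= (50 + B * (4 * (B + 1) ^ 5 + (B + 1))) * s ^ 4).
  { clear k He HkB. intros k Hk He HkB.
    destruct (even_decompose n k Hk He) as [k0 [j [Hk0 [Ek He0]]]].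
    destruct (walk_half_center n k0 Hn Hk0 He0) as [P0 C0]. fold s in C0.
    destruct (walk_half_iter n k0 ((4 * (B + 1) ^ 5 + (B + 1)) * s ^ 5) j) as [P1 C1]; auto; [lia| |].
    - rewrite <- Ek. intros i Hi.
      assert (Hi0 : 0 <= IZR i) by (apply (IZR_le 0); lia).
      assert (HiB : IZR i * s <= B).
      { eapply Rle_trans; [|exact HkB]. apply Rmult_le_compat_r; [lra|]. apply IZR_le; lia. }
      assert (Hs2 : 0 < s ^ 2) by (apply pow_lt; auto).
      assert (Hz : (IZR i + 1) / (INR n + 1) <= (B + 1) * s).
      { apply Rle_trans with ((IZR i + 1) * s ^ 2).
        - unfold Rdiv. apply Rmult_le_compat_l; [lra|].
          replace (s ^ 2) with (/ INR n) by (rewrite HsN, Rinv_inv; auto).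
          apply Rinv_le_contravar; [|lra]. apply lt_0_INR; lia.
        - replace ((IZR i + 1) * s ^ 2) with ((IZR i * s + s) * s) by ring.
          apply Rmult_le_compat_r; lra. }
      assert (HN0 : 0 < INR n) by (apply lt_0_INR; lia).
      assert (Hz0 : 0 <= (IZR i + 1) / (INR n + 1)).
      { left. apply Rdiv_lt_0_compat; lra. }
      split; [|split].
      + apply Rmult_lt_reg_r with (s ^ 2); auto. rewrite HsN, Rinv_l by lra. nra.
      + lra.
      + rewrite Rmult_plus_distr_r. apply Rplus_le_compat.
        * rewrite Rmult_assoc, <- Rpow_mult_distr. apply Rmult_le_compat_l; [lra|].
          apply pow_incr; auto.
        * replace ((IZR i + 1) / (INR n + 1) ^ 3) with
            ((IZR i + 1) / (INR n + 1) * (/ (INR n + 1)) ^ 2) by (field; lra).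
          replace ((B + 1) * s ^ 5) with ((B + 1) * s * (s ^ 2) ^ 2) by ring.
          apply Rmult_le_compat; auto.
          { apply pow_le. left; apply Rinv_0_lt_compat; lra. }
          apply pow_incr. split; [left; apply Rinv_0_lt_compat; lra|].
          replace (s ^ 2) with (/ INR n) by (rewrite HsN, Rinv_inv; auto).
          apply Rinv_le_contravar; lra.
    - rewrite <- Ek in *. split; auto.
      replace (ln (walk_prob n (/ 2) k) - log_profile n k
        - (ln (2 * s) - / 2 * ln (2 * PI) - s ^ 2 / 4)) with
        ((ln (walk_prob n (/ 2) k) - log_profile n k
          - (ln (walk_prob n (/ 2) k0) - log_profile n k0))
         + (ln (walk_prob n (/ 2) k0) - log_profile n k0
            - (ln (2 * s) - / 2 * ln (2 * PI) - s ^ 2 / 4))) by ring.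
      eapply Rle_trans; [apply Rabs_triang|].
      assert (Hj : INR j * s <= B).
      { eapply Rle_trans; [|exact HkB]. apply Rmult_le_compat_r; [lra|].
        rewrite INR_IZR_INZ. apply IZR_le. lia. }
      assert (INR j * ((4 * (B + 1) ^ 5 + (B + 1)) * s ^ 5)
        <= B * (4 * (B + 1) ^ 5 + (B + 1)) * s ^ 4); [|lra].
      replace (INR j * ((4 * (B + 1) ^ 5 + (B + 1)) * s ^ 5)) with
        (INR j * s * ((4 * (B + 1) ^ 5 + (B + 1)) * s ^ 4)) by ring.
      rewrite (Rmult_assoc B). apply Rmult_le_compat_r; auto.
      apply Rmult_le_pos; [|apply pow_le; lra].
      assert (0 <= (B + 1) ^ 5) by (apply pow_le; lra). lra. }
  destruct (Z_le_gt_dec 0 k) as [Hk|Hk].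
  - apply M; auto. eapply Rle_trans; [apply Rle_abs|auto].
  - rewrite <- walk_half_opp, <- log_profile_opp. apply M; [lia| |].
    + replace (Z.of_nat n + - k)%Z with (Z.of_nat n + k - 2 * k)%Z by lia.
      rewrite Z.even_sub, He, Z.even_mul. reflexivity.
    + rewrite opp_IZR. replace (- IZR k * s) with (- (IZR k * s)) by ring.
      eapply Rle_trans; [apply Rle_abs|]. rewrite Rabs_Ropp. auto.
Qed.

(** * Composition with smooth functions, in particular [phi] and [Phi] *)

Lemma ex3_var {I} (s : I -> R) D F :
  bigO s D 0 F -> ex3 s D F F (fun _ => 0) (fun _ => 0).
Proof.
  intros HF. eapply ex3_fun; [|apply (ex3_base s D F (fun _ => 0) (fun _ => 0));
    auto; apply bigO_const].
  exists 1; split; [lra|]; intros; simpl; ring.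
Qed.

Lemma bounded_on_compact (f : R -> R) a b :
  (forall x, continuous f x) -> exists M, 0 <= M /\ forall x, a <= x <= b -> Rabs (f x) <= M.
Proof.
  intros Hf. destruct (Rle_dec a b) as [Hab|Hab].
  - destruct (continuity_ab_maj (fun x => Rabs (f x)) a b Hab) as [m [Hm _]].
    { intros x _. apply continuity_pt_filterlim.
      apply (continuous_comp f Rabs); [apply Hf|apply continuous_Rabs]. }
    exists (Rabs (f m)). split; [apply Rabs_pos|auto].
  - exists 0. split; [lra|]. intros; lra.
Qed.

Lemma ex3_comp_smooth {I} (s : I -> R) (D : I -> Prop) (g g1 g2 g3 : R -> R) B F a b c :
  (forall x, is_derive g x (g1 x)) -> (forall x, is_derive g1 x (g2 x)) ->
  (forall x, is_derive g2 x (g3 x)) -> (forall x, continuous g3 x) ->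
  (forall i, D i -> Rabs (a i) <= B) ->
  ex3 s D F a b c ->
  ex3 s D (fun i => g (F i)) (fun i => g (a i)) (fun i => g1 (a i) * b i)
    (fun i => g1 (a i) * c i + g2 (a i) * b i ^ 2 / 2).
Proof.
  intros H1 H2 H3 Hc Ha HF.
  destruct (bounded_on_compact g (- B - 1) (B + 1)) as [M0 [P0 B0]].
  { intros x; apply (ex_derive_continuous g); eexists; apply H1. }
  destruct (bounded_on_compact g1 (- B - 1) (B + 1)) as [M1 [P1 B1]].
  { intros x; apply (ex_derive_continuous g1); eexists; apply H2. }
  destruct (bounded_on_compact g2 (- B - 1) (B + 1)) as [M2 [P2 B2]].
  { intros x; apply (ex_derive_continuous g2); eexists; apply H3. }
  destruct (bounded_on_compact g3 (- B - 1) (B + 1)) as [M3 [P3 B3]]; [auto|].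
  apply ex3_comp with (g3 := g3) (lo := - B - 1) (hi := B + 1) (r := 1) (M := M0 + M1 + M2 + M3);
    auto; try lra.
  - intros x Hx. specialize (B0 x Hx). specialize (B1 x Hx). specialize (B2 x Hx).
    specialize (B3 x Hx). repeat split; lra.
  - intros i Di. specialize (Ha i Di). apply Rabs_le_between in Ha. lra.
Qed.

Lemma is_derive_phi1 x : is_derive (fun x => - x * phi x) x ((x ^ 2 - 1) * phi x).
Proof.
  replace ((x ^ 2 - 1) * phi x) with (- (1) * phi x + - x * (- x * phi x)) by ring.
  apply (is_derive_mult (fun x => - x) phi).
  - auto_derive; auto; ring.
  - apply is_derive_phi.
  - intros; apply Rmult_comm.
Qed.

Lemma is_derive_phi2 x : is_derive (fun x => (x ^ 2 - 1) * phi x) x ((3 * x - x ^ 3) * phi x).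
Proof.
  replace ((3 * x - x ^ 3) * phi x) with ((2 * x) * phi x + (x ^ 2 - 1) * (- x * phi x)) by ring.
  apply (is_derive_mult (fun x => x ^ 2 - 1) phi).
  - auto_derive; auto. simpl; ring.
  - apply is_derive_phi.
  - intros; apply Rmult_comm.
Qed.

Lemma continuous_phi x : continuous phi x.
Proof. apply (ex_derive_continuous phi). eexists; apply is_derive_phi. Qed.

Lemma continuous_mult_phi (f : R -> R) x : ex_derive f x -> continuous (fun x => f x * phi x) x.
Proof.
  intros. apply (continuous_mult f phi); [|apply continuous_phi].
  apply (ex_derive_continuous f); auto.
Qed.

Lemma ex3_phi {I} (s : I -> R) D B F a b c :
  (forall i, D i -> Rabs (a i) <= B) -> ex3 s D F a b c ->
  ex3 s D (fun i => phi (F i)) (fun i => phi (a i)) (fun i => - a i * phi (a i) * b i)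
    (fun i => - a i * phi (a i) * c i + (a i ^ 2 - 1) * phi (a i) * b i ^ 2 / 2).
Proof.
  apply (ex3_comp_smooth s D phi (fun x => - x * phi x) (fun x => (x ^ 2 - 1) * phi x)
    (fun x => (3 * x - x ^ 3) * phi x)).
  - apply is_derive_phi.
  - apply is_derive_phi1.
  - apply is_derive_phi2.
  - intros x. apply continuous_mult_phi. auto_derive; auto.
Qed.

Lemma ex3_Phi {I} (s : I -> R) D B F a b c :
  (forall i, D i -> Rabs (a i) <= B) -> ex3 s D F a b c ->
  ex3 s D (fun i => Phi (F i)) (fun i => Phi (a i)) (fun i => phi (a i) * b i)
    (fun i => phi (a i) * c i + - a i * phi (a i) * b i ^ 2 / 2).
Proof.
  apply (ex3_comp_smooth s D Phi phi (fun x => - x * phi x) (fun x => (x ^ 2 - 1) * phi x)).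
  - apply is_derive_Phi.
  - apply is_derive_phi.
  - apply is_derive_phi1.
  - intros x. apply continuous_mult_phi. auto_derive; auto.
Qed.

(** Carrying the level [k] and the drift [eta] in the index makes the [bigO] statements uniform in both. *)
Definition lattice_point : Type := (nat * Z * R)%type.
Definition lp_n (i : lattice_point) : nat := fst (fst i).
Definition lp_k (i : lattice_point) : Z := snd (fst i).
Definition lp_eta (i : lattice_point) : R := snd i.
Definition lp_s (i : lattice_point) : R := / sqrt (INR (lp_n i)).
Definition lp_x (i : lattice_point) : R := IZR (lp_k i) * lp_s i.
Definition lp_dom (B : R) (i : lattice_point) : Prop :=
  (1 <= lp_n i)%nat /\ Z.even (Z.of_nat (lp_n i) + lp_k i) = true /\
  Rabs (lp_x i) <= B /\ Rabs (lp_eta i) <= B.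

(** The [s^2] term of the logarithm of the local law: [- 1/4] comes from the central weight, the
    terms in [x] alone from [log_profile], and those with [eta] from the likelihood ratio of the
    drift. *)
Definition local_correction (x eta : R) : R :=
  - / 4 + x ^ 2 / 2 - x ^ 4 / 12 - eta ^ 4 / 4 + x * eta ^ 3 / 3.
(** The polynomial meets three requirements: it is odd in [y] at [eta = 0]; there the difference of
    [tail_approx] between neighbouring midpoints reproduces [local_correction x 0]; and the
    derivative of [tail_approx] in [eta] agrees with that of the tail to this order. *)
Definition tail_correction (y eta : R) : R :=
  (- y ^ 3 - y ^ 2 * eta - y * eta ^ 2 + 3 * eta ^ 3 + y + 3 * eta) / 12.

(** The likelihood ratio [(1 + h)^((n+k)/2) (1 - h)^((n-k)/2)], written as an exponential so that it
    makes sense for every [k]. *)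
Lemma walk_prob_exp n h k : Rabs h < 1 ->
  walk_prob n ((1 + h) / 2) k =
  exp (/ 2 * (INR n + IZR k) * ln (1 + h) + / 2 * (INR n - IZR k) * ln (1 - h))
  * walk_prob n (/ 2) k.
Proof.
  intros Hh. apply Rabs_def2 in Hh.
  revert k; induction n as [|n IH]; intros k; cbn [walk_prob].
  - destruct (Z.eqb_spec k 0) as [->|]; [|ring].
    simpl. replace (/ 2 * (0 + 0) * ln (1 + h) + / 2 * (0 - 0) * ln (1 - h)) with 0 by ring.
    rewrite exp_0; ring.
  - rewrite !IH. rewrite plus_IZR, minus_IZR, S_INR.
    set (w1 := walk_prob n (/ 2) (k - 1)). set (w2 := walk_prob n (/ 2) (k + 1)).
    set (E := exp (/ 2 * (INR n + 1 + IZR k) * ln (1 + h)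
      + / 2 * (INR n + 1 - IZR k) * ln (1 - h))).
    assert (E1 : E = exp (/ 2 * (INR n + (IZR k - 1)) * ln (1 + h)
      + / 2 * (INR n - (IZR k - 1)) * ln (1 - h)) * (1 + h)).
    { unfold E. transitivity (exp (/ 2 * (INR n + (IZR k - 1)) * ln (1 + h)
      + / 2 * (INR n - (IZR k - 1)) * ln (1 - h)) * exp (ln (1 + h)));
      [rewrite <- exp_plus; f_equal; field|rewrite exp_ln by lra; reflexivity]. }
    assert (E2 : E = exp (/ 2 * (INR n + (IZR k + 1)) * ln (1 + h)
      + / 2 * (INR n - (IZR k + 1)) * ln (1 - h)) * (1 - h)).
    { unfold E. transitivity (exp (/ 2 * (INR n + (IZR k + 1)) * ln (1 + h)
      + / 2 * (INR n - (IZR k + 1)) * ln (1 - h)) * exp (ln (1 - h)));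
      [rewrite <- exp_plus; f_equal; field|rewrite exp_ln by lra; reflexivity]. }
    replace (E * (/ 2 * w1 + (1 - / 2) * w2)) with (/ 2 * (E * w1) + / 2 * (E * w2)) by field.
    rewrite E1 at 1. rewrite E2. field.
Qed.

Section Local.

Variable B : R.
Hypothesis HB : 0 <= B.

Let D := lp_dom B.

Lemma bounded_x : bigO lp_s D 0 lp_x.
Proof. apply bigO_bounded with B. intros i Di; apply Di. Qed.

Lemma bounded_eta : bigO lp_s D 0 lp_eta.
Proof. apply bigO_bounded with B. intros i Di; apply Di. Qed.

Lemma bounded_inv : bigO lp_s D 0 (fun i => / (1 + lp_s i ^ 2)).
Proof.
  apply bigO_bounded with 1. intros i _. pose proof (pow2_ge_0 (lp_s i)).
  rewrite Rabs_pos_eq by (left; apply Rinv_0_lt_compat; lra).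
  rewrite <- Rinv_1. apply Rinv_le_contravar; lra.
Qed.

Ltac bnd := repeat first
  [ apply bounded_x | apply bounded_eta | apply bounded_inv | apply bigO_const
  | apply bigO_pow | apply bigO_minus | apply bigO_plus | apply bigO_opp
  | apply (bigO_mult lp_s D 0 0) ].

Lemma lp_s_spec i : D i -> 0 < lp_s i <= 1 /\ INR (lp_n i) = / lp_s i ^ 2.
Proof.
  intros [Hn _]. destruct (inv_sqrt_INR (lp_n i) Hn) as [H1 [H2 H3]]. fold (lp_s i) in *. auto.
Qed.

Lemma lp_k_x i : D i -> IZR (lp_k i) = lp_x i / lp_s i.
Proof. intros Di. destruct (lp_s_spec i Di). unfold lp_x. field. lra. Qed.

Lemma log_profile_expand : bigO lp_s D 3 (fun i => log_profile (lp_n i) (lp_k i)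
  + lp_x i ^ 2 / 2 - lp_x i ^ 2 / 2 * lp_s i ^ 2 + lp_x i ^ 4 / 12 * lp_s i ^ 2).
Proof.
  apply bigO_ext with (fun i => (- (lp_x i ^ 2 * / 2 * / (1 + lp_s i ^ 2))
    + lp_x i ^ 4 * / 12 * ((3 + 3 * lp_s i ^ 2 + lp_s i ^ 4) * / (1 + lp_s i ^ 2) ^ 3)) * lp_s i ^ 4).
  { exists 1. split; [lra|]. intros i Di Hi. destruct (lp_s_spec i Di) as [Hs Hn].
    unfold log_profile. rewrite Hn, (lp_k_x i Di). field.
    pose proof (pow2_ge_0 (lp_s i)). repeat split; apply Rgt_not_eq; nra. }
  apply (bigO_weaken lp_s D 4); [lia|].
  apply (bigO_mult lp_s D 0 4); [|apply bigO_small].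
  assert (S2 : bigO lp_s D 0 lp_s).
  { apply bigO_bounded with 1. intros i Di. destruct (lp_s_spec i Di).
    rewrite Rabs_pos_eq; lra. }
  apply bigO_eq with (fun i => - (lp_x i ^ 2 * / 2 * / (1 + lp_s i ^ 2))
    + lp_x i ^ 4 * / 12 * ((3 + 3 * lp_s i ^ 2 + lp_s i ^ 4) * (/ (1 + lp_s i ^ 2)) ^ 3)).
  { intros i. rewrite pow_inv. reflexivity. }
  bnd; apply S2.
Qed.

(** [e] selects [ln (1 + h)] or [ln (1 - h)]. The factor [n = 1 / s^2] lowers the remainder [h^5] to
    order 3, which is why the logarithm is expanded to degree 4. *)
Lemma log_remainder (e : R) : e = 1 \/ e = -1 ->
  bigO lp_s D 3 (fun i => / 2 * (INR (lp_n i) + e * IZR (lp_k i)) *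
    (ln (1 + e * (lp_eta i * lp_s i)) - (e * (lp_eta i * lp_s i) - (e * (lp_eta i * lp_s i)) ^ 2 / 2
      + (e * (lp_eta i * lp_s i)) ^ 3 / 3 - (e * (lp_eta i * lp_s i)) ^ 4 / 4))).
Proof.
  intros He.
  apply bigO_le with (fun i => (/ 2 * (1 + e * lp_x i * lp_s i)) * (2 * lp_eta i ^ 5 * lp_s i ^ 3)).
  - exists (/ (2 * (B + 1))). split; [apply Rinv_0_lt_compat; lra|].
    intros i Di Hi. destruct (lp_s_spec i Di) as [Hs Hn].
    assert (Hh : Rabs (e * (lp_eta i * lp_s i)) <= / 2).
    { rewrite !Rabs_mult. replace (Rabs e) with 1 by
        (destruct He as [-> | ->]; [rewrite Rabs_pos_eq; lra|rewrite Rabs_left; lra]).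
      rewrite Rmult_1_l, (Rabs_pos_eq (lp_s i)) by lra.
      apply Rle_trans with (B * / (2 * (B + 1))).
      - apply Rmult_le_compat; try lra; [apply Rabs_pos|apply Di].
      - apply Rmult_le_reg_r with (2 * (B + 1)); [lra|]. rewrite Rmult_assoc, Rinv_l; lra. }
    pose proof (ln_taylor4 _ Hh) as L.
    set (rem := ln _ - _) in *. set (h := e * (lp_eta i * lp_s i)) in *.
    rewrite Hn, (lp_k_x i Di).
    replace (/ 2 * (/ lp_s i ^ 2 + e * (lp_x i / lp_s i)) * rem) with
      ((/ 2 * (1 + e * lp_x i * lp_s i)) * (/ lp_s i ^ 2 * rem)) by (field; lra).
    rewrite !(Rabs_mult (/ 2 * (1 + e * lp_x i * lp_s i))). apply Rmult_le_compat_l; [apply Rabs_pos|].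
    rewrite Rabs_mult. eapply Rle_trans; [apply Rmult_le_compat_l; [apply Rabs_pos|exact L]|].
    right. unfold h. rewrite !Rabs_mult, <- !RPow_abs, Rabs_inv.
    rewrite (Rabs_pos_eq 2) by lra. rewrite <- RPow_abs.
    rewrite (Rabs_pos_eq (lp_s i)) by lra.
    replace (Rabs e) with 1 by
        (destruct He as [-> | ->]; [rewrite Rabs_pos_eq; lra|rewrite Rabs_left; lra]).
    field. lra.
  - assert (S2 : bigO lp_s D 0 lp_s).
    { apply bigO_bounded with 1. intros i Di. destruct (lp_s_spec i Di).
      rewrite Rabs_pos_eq; lra. }
    apply (bigO_mult lp_s D 0 3); [bnd; apply S2|].
    apply (bigO_mult lp_s D 0 3); [bnd|apply bigO_small].
Qed.

(** Dividing by [2 s], the spacing of the rescaled lattice, makes the leading term a density. The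
    logarithm is expanded first, and the result is then exponentiated. *)
Lemma walk_prob_local :
  ex3 lp_s D (fun i => walk_prob (lp_n i) ((1 + lp_eta i * lp_s i) / 2) (lp_k i) / (2 * lp_s i))
    (fun i => phi (lp_x i - lp_eta i)) (fun _ => 0)
    (fun i => phi (lp_x i - lp_eta i) * local_correction (lp_x i) (lp_eta i)).
Proof.
  destruct (walk_half_local B HB) as [C [d [Hd HL]]].
  set (A := fun i => ln (walk_prob (lp_n i) (/ 2) (lp_k i)) - ln (2 * lp_s i)
    + (/ 2 * (INR (lp_n i) + IZR (lp_k i)) * ln (1 + lp_eta i * lp_s i)
       + / 2 * (INR (lp_n i) - IZR (lp_k i)) * ln (1 - lp_eta i * lp_s i))).
  set (a := fun i => - / 2 * ln (2 * PI) - (lp_x i - lp_eta i) ^ 2 / 2).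
  assert (HA : ex3 lp_s D A a (fun _ => 0) (fun i => local_correction (lp_x i) (lp_eta i))).
  { apply ex3_bigO; [unfold a, Rdiv; bnd|bnd|unfold local_correction, Rdiv; bnd|].
    apply bigO_ext with (fun i =>
      (ln (walk_prob (lp_n i) (/ 2) (lp_k i)) - log_profile (lp_n i) (lp_k i)
        - (ln (2 * lp_s i) - / 2 * ln (2 * PI) - lp_s i ^ 2 / 4))
      + (log_profile (lp_n i) (lp_k i)
         + lp_x i ^ 2 / 2 - lp_x i ^ 2 / 2 * lp_s i ^ 2 + lp_x i ^ 4 / 12 * lp_s i ^ 2)
      + / 2 * (INR (lp_n i) + 1 * IZR (lp_k i)) *
        (ln (1 + 1 * (lp_eta i * lp_s i)) - (1 * (lp_eta i * lp_s i)
          - (1 * (lp_eta i * lp_s i)) ^ 2 / 2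
          + (1 * (lp_eta i * lp_s i)) ^ 3 / 3 - (1 * (lp_eta i * lp_s i)) ^ 4 / 4))
      + / 2 * (INR (lp_n i) + -1 * IZR (lp_k i)) *
        (ln (1 + -1 * (lp_eta i * lp_s i)) - (-1 * (lp_eta i * lp_s i)
          - (-1 * (lp_eta i * lp_s i)) ^ 2 / 2
          + (-1 * (lp_eta i * lp_s i)) ^ 3 / 3 - (-1 * (lp_eta i * lp_s i)) ^ 4 / 4))).
    - exists 1. split; [lra|]. intros i Di Hi. destruct (lp_s_spec i Di) as [Hs Hn].
      unfold A, a, local_correction.
      replace (1 + 1 * (lp_eta i * lp_s i)) with (1 + lp_eta i * lp_s i) by ring.
      replace (1 + -1 * (lp_eta i * lp_s i)) with (1 - lp_eta i * lp_s i) by ring.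
      rewrite Hn, (lp_k_x i Di). field. lra.
    - apply bigO_plus; [apply bigO_plus; [apply bigO_plus|]|].
      + apply (bigO_weaken lp_s D 4); [lia|].
        exists (Rmax C 0), d. split; [auto|split; [apply Rmax_r|]].
        intros i Di Hi. destruct (HL (lp_n i) (lp_k i)) as [_ H]; try apply Di.
        { apply Hi. }
        eapply Rle_trans; [exact H|]. fold (lp_s i).
        apply Rmult_le_compat_r; [apply pow_le; lra|apply Rmax_l].
      + apply log_profile_expand.
      + apply log_remainder; auto.
      + apply log_remainder; auto. }
  assert (Ha : forall i, D i -> Rabs (a i) <= / 2 * Rabs (ln (2 * PI)) + (B + B) ^ 2).
  { intros i [_ [_ [Hx He]]]. unfold a, Rminus at 1. eapply Rle_trans; [apply Rabs_triang|].
    rewrite Rabs_Ropp. apply Rplus_le_compat.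
    - rewrite Rabs_mult, Rabs_Ropp, (Rabs_pos_eq (/ 2)) by lra. lra.
    - unfold Rdiv. rewrite Rabs_mult, <- RPow_abs, (Rabs_pos_eq (/ 2)) by lra.
      assert (Rabs (lp_x i - lp_eta i) ^ 2 <= (B + B) ^ 2).
      { apply pow_incr. split; [apply Rabs_pos|].
        eapply Rle_trans; [apply Rabs_triang|]. rewrite Rabs_Ropp. lra. }
      pose proof (pow2_ge_0 (Rabs (lp_x i - lp_eta i))). lra. }
  assert (Ephi : forall i, exp (a i) = phi (lp_x i - lp_eta i)).
  { intros i. unfold a, phi, gauss. unfold Rminus at 1. rewrite exp_plus. f_equal.
    - pose proof PI_RGT_0. rewrite <- (exp_ln (sqrt (2 * PI))) by apply sqrt_2PI_pos.
      rewrite <- exp_Ropp. f_equal. rewrite <- Rpower_sqrt by lra.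
      unfold Rpower. rewrite ln_exp. ring.
    - f_equal. field. }
  eapply ex3_eq; [|apply (ex3_exp lp_s D _ A a _ _ Ha HA)].
  exists (Rmin d (/ (2 * (B + 1)))). split.
  { apply Rmin_pos; auto. apply Rinv_0_lt_compat; lra. }
  intros i Di Hi. pose proof (Rmin_l d (/ (2 * (B + 1)))). pose proof (Rmin_r d (/ (2 * (B + 1)))).
  simpl. rewrite Ephi. split; [|split; [|split]]; try (field; fail).
  destruct (lp_s_spec i Di) as [Hs Hn].
  destruct (HL (lp_n i) (lp_k i)) as [Hp _]; try apply Di.
  { change (lp_s i <= d). lra. }
  assert (Hh : Rabs (lp_eta i * lp_s i) < 1).
  { rewrite Rabs_mult, (Rabs_pos_eq (lp_s i)) by lra.
    apply Rle_lt_trans with (B * / (2 * (B + 1))).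
    - apply Rmult_le_compat; try lra; [apply Rabs_pos|apply Di].
    - apply Rmult_lt_reg_r with (2 * (B + 1)); [lra|]. rewrite Rmult_assoc, Rinv_l; lra. }
  rewrite walk_prob_exp by auto.
  unfold A. rewrite exp_plus. unfold Rminus at 1. rewrite exp_plus, exp_Ropp, !exp_ln by lra.
  field. lra.
Qed.

End Local.

(** * The tail expansion *)

Definition tail_approx (y eta s : R) : R :=
  1 - Phi (y - eta) + s ^ 2 * (phi (y - eta) * tail_correction y eta).

Lemma phi_opp x : phi (- x) = phi x.
Proof. unfold phi, gauss. f_equal. f_equal. field. Qed.

(** The counterpart of [walk_tail_half_opp]: the level [2 - k] has midpoint [- y]. *)
Lemma tail_approx_opp y s : tail_approx (- y) 0 s = 1 - tail_approx y 0 s.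
Proof.
  unfold tail_approx, tail_correction. rewrite !Rminus_0_r, Phi_opp, phi_opp. field.
Qed.

Lemma walk_tail_half_opp n k : Z.even (Z.of_nat n + k) = true ->
  walk_tail n (/ 2) (2 - k) = 1 - walk_tail n (/ 2) k.
Proof.
  intros He. pose proof (walk_tail_compl n (/ 2) k) as H.
  replace (1 - / 2) with (/ 2) in H by field.
  pose proof (walk_tail_diff n (/ 2) (1 - k)) as H2.
  replace (1 - k + 1)%Z with (2 - k)%Z in H2 by lia.
  rewrite walk_prob_odd in H2; [lra|].
  replace (Z.of_nat n + (1 - k))%Z with (Z.of_nat n + k + (1 - 2 * k))%Z by lia.
  rewrite Z.odd_add, <- Z.negb_even, He, Z.odd_sub, Z.odd_mul. reflexivity.
Qed.

Lemma walk_tail_even_diff n a k : Z.even (Z.of_nat n + k) = true ->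
  walk_tail n a k - walk_tail n a (k + 2) = walk_prob n a k.
Proof.
  intros He. pose proof (walk_tail_diff n a k) as H1.
  pose proof (walk_tail_diff n a (k + 1)) as H2.
  replace (k + 1 + 1)%Z with (k + 2)%Z in H2 by lia.
  rewrite (walk_prob_odd n a (k + 1)) in H2; [lra|].
  rewrite Z.add_assoc, Z.odd_add, <- Z.negb_even, He. reflexivity.
Qed.

Lemma telescope_bound (f : Z -> R) a e j :
  (forall i, (0 <= i < Z.of_nat j)%Z -> Rabs (f (a + 2 * i + 2)%Z - f (a + 2 * i)%Z) <= e) ->
  Rabs (f (a + 2 * Z.of_nat j)%Z - f a) <= INR j * e.
Proof.
  induction j as [|j IH]; intros H.
  - simpl. replace (a + 0)%Z with a by lia. unfold Rminus. rewrite Rplus_opp_r, Rabs_R0. lra.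
  - rewrite S_INR. replace (a + 2 * Z.of_nat (S j))%Z with (a + 2 * Z.of_nat j + 2)%Z by lia.
    replace (f (a + 2 * Z.of_nat j + 2)%Z - f a) with
      ((f (a + 2 * Z.of_nat j + 2)%Z - f (a + 2 * Z.of_nat j)%Z)
       + (f (a + 2 * Z.of_nat j)%Z - f a)) by ring.
    eapply Rle_trans; [apply Rabs_triang|].
    assert (Rabs (f (a + 2 * Z.of_nat j)%Z - f a) <= INR j * e) by (apply IH; intros; apply H; lia).
    assert (Rabs (f (a + 2 * Z.of_nat j + 2)%Z - f (a + 2 * Z.of_nat j)%Z) <= e) by (apply H; lia).
    lra.
Qed.

(** The symmetric difference cancels the even terms. Its derivative in [s] is a sum of two
    third-order Taylor remainders of [phi], and one more mean value step gives order 4. *)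
Lemma Phi_central_difference B : exists M, 0 <= M /\ forall x s, Rabs x <= B -> 0 < s <= 1 ->
  Rabs (Phi (x + s) - Phi (x - s) - 2 * s * phi x - s ^ 3 / 3 * ((x ^ 2 - 1) * phi x)) <= M * s ^ 4.
Proof.
  destruct (bounded_on_compact (fun x => (3 * x - x ^ 3) * phi x) (- B - 1) (B + 1)) as [M [HM HB]].
  { intros x. apply continuous_mult_phi. auto_derive; auto. }
  exists (2 * M). split; [lra|]. intros x s Hx Hs. apply Rabs_le_between in Hx.
  assert (T : forall t, -1 <= t <= 1 ->
    Rabs (phi (x + t) - phi x - - x * phi x * t - (x ^ 2 - 1) * phi x * t ^ 2 / 2) <= M * Rabs t ^ 3).
  { intros t Ht.
    pose proof (taylor3 phi (fun x => - x * phi x) (fun x => (x ^ 2 - 1) * phi x)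
      (fun x => (3 * x - x ^ 3) * phi x) (- B - 1) (B + 1) M
      (fun x _ => is_derive_phi x) (fun x _ => is_derive_phi1 x) (fun x _ => is_derive_phi2 x)
      HB x (x + t)) as H.
    replace (x + t - x) with t in H by ring. apply H; lra. }
  set (f := fun t => Phi (x + t) - Phi (x - t) - 2 * t * phi x - t ^ 3 / 3 * ((x ^ 2 - 1) * phi x)).
  assert (H : Rabs (f s - f 0) <= (2 * M * s ^ 3) * Rabs (s - 0)).
  { apply derivative_bound with (fun t => phi (x + t) + phi (x - t) - 2 * phi x
      - t ^ 2 * ((x ^ 2 - 1) * phi x)).
    - intros t _. unfold f.
      pose proof (is_derive_Phi (x + t)) as D1. pose proof (is_derive_Phi (x - t)) as D2.
      auto_derive; [split; [eexists; apply D1|split; [eexists; apply D2|auto]]|].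
      assert (E1 : Derive (fun x : R => Phi x) (x + t) = phi (x + t)) by (apply is_derive_unique; auto).
      assert (E2 : Derive (fun x : R => Phi x) (x + - t) = phi (x - t)) by (apply is_derive_unique; auto).
      rewrite E1, E2. field.
    - intros t. unfold Rmin, Rmax. destruct (Rle_dec 0 s); [|lra]. intros Ht.
      replace (phi (x + t) + phi (x - t) - 2 * phi x - t ^ 2 * ((x ^ 2 - 1) * phi x)) with
        ((phi (x + t) - phi x - - x * phi x * t - (x ^ 2 - 1) * phi x * t ^ 2 / 2)
         + (phi (x + - t) - phi x - - x * phi x * - t - (x ^ 2 - 1) * phi x * (- t) ^ 2 / 2)).
      2:{ unfold Rminus. field. }
      eapply Rle_trans; [apply Rabs_triang|].
      pose proof (T t) as H1. pose proof (T (- t)) as H2. rewrite Rabs_Ropp in H2.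
      rewrite (Rabs_pos_eq t) in H1, H2 by lra.
      assert (M * t ^ 3 <= M * s ^ 3).
      { apply Rmult_le_compat_l; auto. apply pow_incr; lra. }
      lra. }
  replace (f 0) with 0 in H.
  2:{ unfold f. rewrite Rplus_0_r, Rminus_0_r. simpl. field. }
  rewrite !Rminus_0_r, (Rabs_pos_eq s) in H by lra. unfold f in H.
  eapply Rle_trans; [exact H|]. right; ring.
Qed.

Lemma is_derive_phi_tail_correction x :
  is_derive (fun y => phi y * tail_correction y 0) x (phi x * (x ^ 4 / 12 - x ^ 2 / 3 + / 12)).
Proof.
  replace (phi x * (x ^ 4 / 12 - x ^ 2 / 3 + / 12)) with
    (- x * phi x * tail_correction x 0 + phi x * ((- 3 * x ^ 2 + 1) / 12)) by (unfold tail_correction; field).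
  apply (is_derive_mult phi (fun y => tail_correction y 0)).
  - apply is_derive_phi.
  - unfold tail_correction. auto_derive; auto. field.
  - intros; apply Rmult_comm.
Qed.

(** Order 2 suffices, since the correction enters the tail with a factor [s^2]. *)
Lemma phi_tail_correction_central_difference B : exists M, 0 <= M /\
  forall x s, Rabs x <= B -> 0 < s <= 1 ->
  Rabs (phi (x + s) * tail_correction (x + s) 0 - phi (x - s) * tail_correction (x - s) 0
        - 2 * s * (phi x * (x ^ 4 / 12 - x ^ 2 / 3 + / 12))) <= M * s ^ 2.
Proof.
  set (g := fun x => phi x * (x ^ 4 / 12 - x ^ 2 / 3 + / 12)).
  set (g' := fun x => (x ^ 3 / 3 - 2 * x / 3 - x * (x ^ 4 / 12 - x ^ 2 / 3 + / 12)) * phi x).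
  assert (Dg : forall x, is_derive g x (g' x)).
  { intros x. unfold g, g'.
    replace ((x ^ 3 / 3 - 2 * x / 3 - x * (x ^ 4 / 12 - x ^ 2 / 3 + / 12)) * phi x) with
      (- x * phi x * (x ^ 4 / 12 - x ^ 2 / 3 + / 12) + phi x * (x ^ 3 / 3 - 2 * x / 3)) by field.
    apply (is_derive_mult phi (fun x => x ^ 4 / 12 - x ^ 2 / 3 + / 12)).
    - apply is_derive_phi.
    - auto_derive; auto. field.
    - intros; apply Rmult_comm. }
  destruct (bounded_on_compact g' (- B - 1) (B + 1)) as [M [HM HB]].
  { intros x. apply continuous_mult_phi. auto_derive; auto. }
  exists (2 * M). split; [lra|]. intros x s Hx Hs. apply Rabs_le_between in Hx.
  set (f := fun t => phi (x + t) * tail_correction (x + t) 0 - phi (x - t) * tail_correction (x - t) 0 - 2 * t * g x).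
  assert (H : Rabs (f s - f 0) <= (2 * M * s) * Rabs (s - 0)).
  { apply derivative_bound with (fun t => g (x + t) + g (x - t) - 2 * g x).
    - intros t _. unfold f.
      pose proof (is_derive_phi_tail_correction (x + t)) as D1.
      pose proof (is_derive_phi_tail_correction (x - t)) as D2. fold (g (x + t)) in D1. fold (g (x - t)) in D2.
      set (h := fun y => phi y * tail_correction y 0) in *.
      change (is_derive (fun t => h (x + t) - h (x - t) - 2 * t * g x) t
        (g (x + t) + g (x - t) - 2 * g x)).
      auto_derive; [split; [eexists; apply D1|split; [eexists; apply D2|auto]]|].
      assert (E1 : Derive (fun x : R => h x) (x + t) = g (x + t)) by (apply is_derive_unique; auto).
      assert (E2 : Derive (fun x : R => h x) (x + - t) = g (x - t)) by (apply is_derive_unique; auto).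
      rewrite E1, E2. ring.
    - intros t. unfold Rmin, Rmax. destruct (Rle_dec 0 s); [|lra]. intros Ht.
      assert (G : forall z, x - s <= z <= x + s -> Rabs (g z - g x) <= M * s).
      { intros z Hz. apply Rle_trans with (M * Rabs (z - x)).
        - apply derivative_bound with g'; [intros; apply Dg|].
          intros w Hw. apply HB. unfold Rmin, Rmax in Hw. destruct (Rle_dec x z); lra.
        - apply Rmult_le_compat_l; auto. apply Rabs_le. lra. }
      replace (g (x + t) + g (x - t) - 2 * g x) with
        ((g (x + t) - g x) + (g (x - t) - g x)) by ring.
      eapply Rle_trans; [apply Rabs_triang|].
      assert (Rabs (g (x + t) - g x) <= M * s) by (apply G; lra).
      assert (Rabs (g (x - t) - g x) <= M * s) by (apply G; lra). lra. }
  replace (f 0) with 0 in H.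
  2:{ unfold f. rewrite Rplus_0_r, Rminus_0_r. ring. }
  rewrite !Rminus_0_r, (Rabs_pos_eq s) in H by lra. unfold f in H.
  eapply Rle_trans; [exact H|]. right; ring.
Qed.

(** The coefficients of [2 s^3 phi x] agree because [(x^2 - 1)/6 - (x^4/12 - x^2/3 + 1/12)] equals
    [local_correction x 0]. *)
Lemma walk_tail_half_step B : 0 <= B -> exists C d, 0 < d /\ 0 <= C /\ forall n k,
  let s := / sqrt (INR n) in
  (1 <= n)%nat -> s <= d -> Z.even (Z.of_nat n + k) = true -> Rabs (IZR k * s) <= B ->
  Rabs ((walk_tail n (/ 2) k - walk_tail n (/ 2) (k + 2))
    - (tail_approx (IZR k * s - s) 0 s - tail_approx (IZR k * s + s) 0 s)) <= C * s ^ 4.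
Proof.
  intros HB. destruct (walk_prob_local B HB) as [_ [_ [_ [C [d [Hd [HC HL]]]]]]].
  destruct (Phi_central_difference B) as [M1 [HM1 H1]].
  destruct (phi_tail_correction_central_difference B) as [M2 [HM2 H2]].
  exists (2 * C + M1 + M2), d. split; [auto|split; [lra|]].
  intros n k s Hn Hsd He HkB.
  destruct (inv_sqrt_INR n Hn) as [Hs [Hs1 HsN]]. fold s in Hs, Hs1, HsN.
  rewrite walk_tail_even_diff by auto.
  specialize (HL (n, k, 0)). unfold lp_dom, lp_x, lp_eta, lp_s, lp_n, lp_k in HL. simpl fst in HL. simpl snd in HL.
  fold s in HL. rewrite Rabs_R0 in HL.
  assert (HL' := HL (conj Hn (conj He (conj HkB HB))) (conj Hs Hsd)). clear HL.
  replace ((1 + 0 * s) / 2) with (/ 2) in HL' by field.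
  set (x := IZR k * s) in *. rewrite Rminus_0_r in HL'.
  specialize (H1 x s HkB (conj Hs Hs1)). specialize (H2 x s HkB (conj Hs Hs1)).
  set (w := walk_prob n (/ 2) k) in *. unfold tail_approx. rewrite !Rminus_0_r.
  match goal with |- Rabs ?X <= _ => replace X with
    (2 * s * (w / (2 * s) - (phi x + 0 * s + phi x * local_correction x 0 * s ^ 2))
     + - (Phi (x + s) - Phi (x - s) - 2 * s * phi x - s ^ 3 / 3 * ((x ^ 2 - 1) * phi x))
     + s ^ 2 * (phi (x + s) * tail_correction (x + s) 0 - phi (x - s) * tail_correction (x - s) 0
        - 2 * s * (phi x * (x ^ 4 / 12 - x ^ 2 / 3 + / 12)))) end.
  2:{ unfold local_correction. field. lra. }
  eapply Rle_trans; [apply Rabs_triang|].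
  rewrite !Rmult_plus_distr_r. apply Rplus_le_compat.
  - eapply Rle_trans; [apply Rabs_triang|]. apply Rplus_le_compat.
    + rewrite Rabs_mult, (Rabs_pos_eq (2 * s)) by lra.
      replace (2 * C * s ^ 4) with (2 * s * (C * s ^ 3)) by ring.
      apply Rmult_le_compat_l; [lra|exact HL'].
    + rewrite Rabs_Ropp. exact H1.
  - rewrite Rabs_mult, (Rabs_pos_eq (s ^ 2)) by apply pow2_ge_0.
    replace (M2 * s ^ 4) with (s ^ 2 * (M2 * s ^ 2)) by ring.
    apply Rmult_le_compat_l; [apply pow2_ge_0|exact H2].
Qed.

(** The error is odd under [k -> 2 - k], so summing the local errors from [2 - k] to [k] bounds
    twice the error at [k]; no tail estimate is needed. *)
Lemma walk_tail_half B : 0 <= B -> exists C d, 0 < d /\ 0 <= C /\ forall n k,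
  let s := / sqrt (INR n) in
  (1 <= n)%nat -> s <= d -> Z.even (Z.of_nat n + k) = true -> Rabs (IZR k * s) <= B ->
  Rabs (walk_tail n (/ 2) k - tail_approx (IZR k * s - s) 0 s) <= C * s ^ 3.
Proof.
  (* The [+ 2] makes room for the mirrored level [2 - k], to which the case [k <= 0] is reduced. *)
  intros HB. destruct (walk_tail_half_step (B + 2)) as [C [d [Hd [HC H]]]]; [lra|].
  exists ((B + 2) * C), d. split; [auto|split; [nra|]].
  intros n k s Hn Hsd He HkB.
  destruct (inv_sqrt_INR n Hn) as [Hs [Hs1 HsN]]. fold s in Hs, Hs1, HsN.
  set (f := fun k => walk_tail n (/ 2) k - tail_approx (IZR k * s - s) 0 s).
  assert (Hodd : forall k, Z.even (Z.of_nat n + k) = true -> f (2 - k)%Z = - f k).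
  { intros i Hi. unfold f. rewrite walk_tail_half_opp by auto. rewrite minus_IZR.
    replace ((2 - IZR i) * s - s) with (- (IZR i * s - s)) by ring.
    rewrite tail_approx_opp. ring. }
  assert (Hpar : forall i j, Z.even (Z.of_nat n + (i + 2 * j)) = Z.even (Z.of_nat n + i)).
  { intros i j. rewrite Z.add_assoc, Z.even_add, Z.even_mul. simpl. destruct (Z.even (Z.of_nat n + i)); reflexivity. }
  assert (M : forall k, (1 <= k)%Z -> Z.even (Z.of_nat n + k) = true -> IZR k * s <= B + 2 ->
    Rabs (f k) <= (B + 2) * C * s ^ 3).
  { clear k He HkB. intros k Hk He HkB.
    set (j := Z.to_nat (k - 1)).
    assert (Hj : Z.of_nat j = (k - 1)%Z) by (apply Z2Nat.id; lia).
    assert (He2 : Z.even (Z.of_nat n + (2 - k)) = true).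
    { rewrite <- (Hpar (2 - k) (k - 1))%Z, <- He. f_equal. lia. }
    assert (T : Rabs (f ((2 - k) + 2 * Z.of_nat j)%Z - f (2 - k)%Z) <= INR j * (C * s ^ 4)).
    { apply telescope_bound. intros i Hi.
      set (z := (2 - k + 2 * i)%Z).
      specialize (H n z Hn Hsd). fold s in H. unfold f.
      rewrite (plus_IZR z 2).
      replace ((IZR z + 2) * s - s) with (IZR z * s + s) by ring.
      replace (walk_tail n (/ 2) (z + 2) - tail_approx (IZR z * s + s) 0 s
        - (walk_tail n (/ 2) z - tail_approx (IZR z * s - s) 0 s)) with
        (- (walk_tail n (/ 2) z - walk_tail n (/ 2) (z + 2)
           - (tail_approx (IZR z * s - s) 0 s - tail_approx (IZR z * s + s) 0 s))) by ring.
      rewrite Rabs_Ropp. apply H.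
      - unfold z. rewrite Hpar. auto.
      - rewrite Rabs_mult, (Rabs_pos_eq s), <- abs_IZR by lra.
        eapply Rle_trans; [|exact HkB]. apply Rmult_le_compat_r; [lra|]. apply IZR_le. lia. }
    replace ((2 - k) + 2 * Z.of_nat j)%Z with k in T by lia.
    rewrite Hodd in T by auto.
    replace (f k - - f k) with (2 * f k) in T by ring.
    rewrite Rabs_mult, (Rabs_pos_eq 2) in T by lra.
    assert (INR j * s <= B + 2).
    { rewrite INR_IZR_INZ, Hj, minus_IZR. lra. }
    assert (INR j * (C * s ^ 4) <= (B + 2) * C * s ^ 3).
    { replace (INR j * (C * s ^ 4)) with (INR j * s * (C * s ^ 3)) by ring.
      rewrite (Rmult_assoc (B + 2)). apply Rmult_le_compat_r; auto.
      apply Rmult_le_pos; auto. apply pow_le; lra. }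
    pose proof (Rabs_pos (f k)). lra. }
  apply Rabs_le_between in HkB.
  destruct (Z_le_gt_dec 1 k) as [Hk|Hk].
  - apply M; auto. lra.
  - change (Rabs (f k) <= (B + 2) * C * s ^ 3).
    rewrite <- Rabs_Ropp, <- Hodd by auto. apply M; [lia| |].
    + rewrite <- (Hpar (2 - k) (k - 1))%Z, <- He. f_equal. lia.
    + rewrite minus_IZR. lra.
Qed.

Lemma is_derive_tail_approx y s eta :
  is_derive (fun eta => tail_approx y eta s) eta
   (phi (y - eta) * (1 + s ^ 2 * (/ 4 + eta ^ 2 / 2 - y ^ 4 / 12 - eta ^ 4 / 4 + y * eta ^ 3 / 3))).
Proof.
  unfold tail_approx.
  pose proof (is_derive_Phi (y - eta)) as D1. pose proof (is_derive_phi (y - eta)) as D2.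
  unfold tail_correction.
  auto_derive; [split; [eexists; apply D1|split; [eexists; apply D2|auto]]|].
  assert (E1 : Derive (fun x : R => Phi x) (y + - eta) = phi (y - eta)) by (apply is_derive_unique; auto).
  assert (E2 : Derive (fun x : R => phi x) (y + - eta) = - (y - eta) * phi (y - eta)) by (apply is_derive_unique; auto).
  rewrite E1, E2. unfold Rminus. field.
Qed.

Section Drift.

Variable B : R.
Hypothesis HB : 0 <= B.

Let D := lp_dom B.

(** The exact derivative of the tail in [eta], with chain factor [s / 2], against that of
    [tail_approx]. One is centred at the level [x], the other at the midpoint [x - s]; expanding
    both around [x - eta] makes orders 0, 1 and 2 cancel. *)
Lemma walk_tail_drift_derivative :
  bigO lp_s D 3 (fun i =>
    (INR (lp_n i) + IZR (lp_k i)) * walk_prob (lp_n i) ((1 + lp_eta i * lp_s i) / 2) (lp_k i)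
      / (1 + lp_eta i * lp_s i) * (lp_s i / 2)
    - phi (lp_x i - lp_s i - lp_eta i) * (1 + lp_s i ^ 2 *
       (/ 4 + lp_eta i ^ 2 / 2 - (lp_x i - lp_s i) ^ 4 / 12 - lp_eta i ^ 4 / 4
        + (lp_x i - lp_s i) * lp_eta i ^ 3 / 3))).
Proof.
  pose proof (walk_prob_local B HB) as HW. fold D in HW.
  pose proof (ex3_var lp_s D _ (bounded_x B)) as HX.
  pose proof (ex3_var lp_s D _ (bounded_eta B)) as HE.
  pose proof (ex3_small lp_s D) as HS.
  pose proof (ex3_const lp_s D) as HC.
  assert (HI : ex3 lp_s D (fun i => / (1 + lp_eta i * lp_s i)) (fun _ => 1)
    (fun i => - lp_eta i) (fun i => lp_eta i ^ 2)).
  { eapply ex3_coef.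
    - apply (ex3_inv lp_s D (1 / 2) 2); [lra| |].
      2:{ apply (ex3_plus (HC 1) (ex3_mult HE HS)). }
      intros; simpl; lra.
    - intros; simpl. field.
    - intros; simpl. field.
    - intros; simpl. field. }
  assert (HN : ex3 lp_s D (fun i => 1 + lp_x i * lp_s i) (fun _ => 1) lp_x (fun _ => 0)).
  { eapply ex3_coef.
    - apply (ex3_plus (HC 1) (ex3_mult HX HS)).
    - intros; simpl; ring.
    - intros; simpl; ring.
    - intros; simpl; ring. }
  pose proof (ex3_mult (ex3_mult HW HN) HI) as HL.
  pose proof (ex3_minus HX HS) as HY.
  assert (HP : ex3 lp_s D (fun i => phi (lp_x i - lp_s i - lp_eta i))
    (fun i => phi (lp_x i - lp_eta i)) (fun i => (lp_x i - lp_eta i) * phi (lp_x i - lp_eta i))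
    (fun i => ((lp_x i - lp_eta i) ^ 2 - 1) / 2 * phi (lp_x i - lp_eta i))).
  { eapply ex3_coef.
    - apply (ex3_phi lp_s D (B + B)).
      2:{ apply (ex3_minus HY HE). }
      intros i [_ [_ [Hx He]]]. simpl. unfold Rminus.
      rewrite Ropp_0, Rplus_0_r. eapply Rle_trans; [apply Rabs_triang|].
      rewrite Rabs_Ropp. lra.
    - intros; simpl. f_equal. ring.
    - intros; simpl. rewrite Rminus_0_r. ring.
    - intros; simpl. rewrite Rminus_0_r. field. }
  assert (HY4 : bigO lp_s D 1 (fun i =>
    (/ 4 + lp_eta i ^ 2 / 2 - (lp_x i - lp_s i) ^ 4 / 12 - lp_eta i ^ 4 / 4
        + (lp_x i - lp_s i) * lp_eta i ^ 3 / 3) -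
    (/ 4 + lp_eta i ^ 2 / 2 - lp_x i ^ 4 / 12 - lp_eta i ^ 4 / 4
        + lp_x i * lp_eta i ^ 3 / 3))).
  { apply bigO_eq with (fun i =>
      ((4 * lp_x i ^ 3 - 6 * lp_x i ^ 2 * lp_s i + 4 * lp_x i * lp_s i ^ 2 - lp_s i ^ 3) * / 12
       - lp_eta i ^ 3 * / 3) * lp_s i ^ 1).
    { intros; field. }
    apply (bigO_mult lp_s D 0 1); [|apply bigO_small].
    pose proof (bounded_x B) as bx. pose proof (bounded_eta B) as be.
    pose proof (ex3_bounded HS) as bs. fold D in bx, be.
    repeat first [ apply bx | apply be | apply bs | apply bigO_const | apply bigO_pow
      | apply bigO_minus | apply bigO_plus | apply (bigO_mult lp_s D 0 0)]. }
  assert (HQ : ex3 lp_s D (fun i => 1 + lp_s i ^ 2 *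
       (/ 4 + lp_eta i ^ 2 / 2 - (lp_x i - lp_s i) ^ 4 / 12 - lp_eta i ^ 4 / 4
        + (lp_x i - lp_s i) * lp_eta i ^ 3 / 3)) (fun _ => 1) (fun _ => 0)
     (fun i => / 4 + lp_eta i ^ 2 / 2 - lp_x i ^ 4 / 12 - lp_eta i ^ 4 / 4
        + lp_x i * lp_eta i ^ 3 / 3)).
  { apply ex3_bigO; try apply bigO_const.
    - pose proof (bounded_x B) as bx. pose proof (bounded_eta B) as be. fold D in bx, be.
      unfold Rdiv.
      repeat first [ apply bx | apply be | apply bigO_const | apply bigO_pow
      | apply bigO_minus | apply bigO_plus | apply (bigO_mult lp_s D 0 0)].
    - eapply bigO_eq; [|apply (bigO_mult lp_s D 2 1 _ _ (bigO_small lp_s D 2) HY4)].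
      intros; simpl; ring. }
  pose proof (ex3_minus HL (ex3_mult HP HQ)) as HF.
  destruct HF as [_ [_ [_ HF]]].
  eapply bigO_ext; [|exact HF]. exists (/ (2 * (B + 1))). split.
  { apply Rinv_0_lt_compat; lra. }
  intros i Di Hi. destruct (lp_s_spec B i Di) as [Hs Hn].
  assert (Hh : Rabs (lp_eta i * lp_s i) < 1).
  { rewrite Rabs_mult, (Rabs_pos_eq (lp_s i)) by lra.
    apply Rle_lt_trans with (B * / (2 * (B + 1))).
    - apply Rmult_le_compat; try lra; [apply Rabs_pos|apply Di].
    - apply Rmult_lt_reg_r with (2 * (B + 1)); [lra|]. rewrite Rmult_assoc, Rinv_l; lra. }
  apply Rabs_def2 in Hh.
  rewrite Hn, (lp_k_x B i Di). unfold local_correction. field. lra.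
Qed.

End Drift.

(** The error at zero drift is the symmetric case, and its derivative in the drift is [O(s^3)]
    uniformly on the segment from 0 to [eta]; the mean value inequality adds the two. *)
Lemma walk_tail_expansion B : 0 <= B -> exists C d, 0 < d /\ 0 <= C /\ forall n k eta,
  let s := / sqrt (INR n) in
  (1 <= n)%nat -> s <= d -> Z.even (Z.of_nat n + k) = true -> Rabs (IZR k * s) <= B ->
  Rabs eta <= B ->
  Rabs (walk_tail n ((1 + eta * s) / 2) k - tail_approx (IZR k * s - s) eta s) <= C * s ^ 3.
Proof.
  intros HB. destruct (walk_tail_half B HB) as [C0 [d0 [Hd0 [HC0 H0]]]].
  destruct (walk_tail_drift_derivative B HB) as [C1 [d1 [Hd1 [HC1 H1]]]].
  (* Keeps the step probability [(1 + e s) / 2] away from 0 for all [|e| <= B], as the derivative of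
     the tail requires. *)
  set (d2 := / (2 * (B + 1))).
  assert (Hd2 : 0 < d2) by (apply Rinv_0_lt_compat; lra).
  exists (C0 + C1 * B), (Rmin d0 (Rmin d1 d2)).
  split; [repeat apply Rmin_pos; auto|split; [nra|]].
  intros n k eta s Hn Hsd He Hk Heta.
  pose proof (Rmin_l d0 (Rmin d1 d2)). pose proof (Rmin_r d0 (Rmin d1 d2)).
  pose proof (Rmin_l d1 d2). pose proof (Rmin_r d1 d2).
  destruct (inv_sqrt_INR n Hn) as [Hs [Hs1 HsN]]. fold s in Hs, Hs1, HsN.
  set (y := IZR k * s - s).
  set (f := fun eta => walk_tail n ((1 + eta * s) / 2) k - tail_approx y eta s).
  assert (E0 : Rabs (f 0) <= C0 * s ^ 3).
  { unfold f. replace ((1 + 0 * s) / 2) with (/ 2) by field. apply H0; auto. fold s. lra. }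
  assert (ED : Rabs (f eta - f 0) <= (C1 * s ^ 3) * Rabs (eta - 0)).
  { assert (R : forall x, Rmin 0 eta <= x <= Rmax 0 eta -> Rabs x <= B /\ -1 < x * s < 1).
    { intros x Hx. assert (Hx' : Rabs x <= B).
      { apply Rabs_le_between in Heta. apply Rabs_le.
        unfold Rmin, Rmax in Hx. destruct (Rle_dec 0 eta); lra. }
      split; auto. assert (Hxs : Rabs (x * s) < 1); [|apply Rabs_def2 in Hxs; lra].
      rewrite Rabs_mult, (Rabs_pos_eq s) by lra.
      apply Rle_lt_trans with (B * d2); [apply Rmult_le_compat; try lra; apply Rabs_pos|].
      unfold d2. apply Rmult_lt_reg_r with (2 * (B + 1)); [lra|].
      rewrite Rmult_assoc, Rinv_l; lra. }
    apply derivative_bound with (fun e =>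
      (INR n + IZR k) * walk_prob n ((1 + e * s) / 2) k / (1 + e * s) * (s / 2)
      - phi (y - e) * (1 + s ^ 2 *
       (/ 4 + e ^ 2 / 2 - y ^ 4 / 12 - e ^ 4 / 4 + y * e ^ 3 / 3))).
    - intros e Hx. destruct (R e Hx) as [R1 R2]. unfold f.
      apply (is_derive_minus (fun e => walk_tail n ((1 + e * s) / 2) k) (fun e => tail_approx y e s)).
      + evar_last.
        { apply (is_derive_comp (fun a => walk_tail n a k) (fun e => (1 + e * s) / 2)).
          - apply is_derive_walk_tail; auto. lra.
          - instantiate (1 := s / 2). auto_derive; auto. field. }
        rewrite (walk_prob_odd n _ (k + 1)).
        2:{ rewrite Z.add_assoc, Z.odd_add, <- Z.negb_even, He. reflexivity. }
        unfold scal; simpl; unfold mult; simpl. field. lra.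
      + apply is_derive_tail_approx.
    - intros e Hx. destruct (R e Hx) as [R1 R2].
      specialize (H1 (n, k, e)). unfold lp_dom, lp_x, lp_eta, lp_s, lp_n, lp_k in H1.
      simpl fst in H1. simpl snd in H1. fold s in H1.
      apply H1; [tauto|lra]. }
  rewrite Rminus_0_r in ED.
  assert (C1 * s ^ 3 * Rabs eta <= C1 * s ^ 3 * B).
  { apply Rmult_le_compat_l; auto. apply Rmult_le_pos; auto. apply pow_le; lra. }
  change (Rabs (f eta) <= (C0 + C1 * B) * s ^ 3).
  replace (f eta) with (f 0 + (f eta - f 0)) by ring.
  eapply Rle_trans; [apply Rabs_triang|]. lra.
Qed.

(** * Expansions along the number of periods *)

Definition sn (n : nat) : R := / sqrt (INR n).
Definition pos_index (n : nat) : Prop := (1 <= n)%nat.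
Notation ex3n := (ex3 sn pos_index).

Lemma sn_spec n : pos_index n -> 0 < sn n <= 1 /\ INR n = / sn n ^ 2.
Proof. intros Hn. destruct (inv_sqrt_INR n Hn) as [H1 [H2 H3]]. auto. Qed.

(** Forgets all but the leading coefficient. The correction terms carry a factor [s^2], so their own
    higher coefficients fall into the error and are never computed. *)
Definition lead (F a : nat -> R) : Prop := exists b c, ex3n F a b c.

Lemma lead_ex3 F a b c : ex3n F a b c -> lead F a.
Proof. intros H; exists b, c; auto. Qed.

Lemma lead_const c : lead (fun _ => c) (fun _ => c).
Proof. eapply lead_ex3, ex3_const. Qed.

Lemma lead_plus F G a b : lead F a -> lead G b -> lead (fun i => F i + G i) (fun i => a i + b i).
Proof.
  intros [x [y H]] [x' [y' H']]. eapply lead_ex3, (ex3_plus H H').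
Qed.

Lemma lead_minus F G a b : lead F a -> lead G b -> lead (fun i => F i - G i) (fun i => a i - b i).
Proof.
  intros [x [y H]] [x' [y' H']]. eapply lead_ex3, (ex3_minus H H').
Qed.

Lemma lead_opp F a : lead F a -> lead (fun i => - F i) (fun i => - a i).
Proof. intros [x [y H]]. eapply lead_ex3, (ex3_opp H). Qed.

Lemma lead_mult F G a b : lead F a -> lead G b -> lead (fun i => F i * G i) (fun i => a i * b i).
Proof.
  intros [x [y H]] [x' [y' H']]. eapply lead_ex3, (ex3_mult H H').
Qed.

Lemma lead_pow F a k : lead F a -> lead (fun i => F i ^ k) (fun i => a i ^ k).
Proof.
  intros H. induction k; simpl; [apply lead_const|]. apply lead_mult; auto.
Qed.

Lemma lead_small2 F a : lead F a -> ex3n (fun i => sn i ^ 2 * F i) (fun _ => 0) (fun _ => 0) a.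
Proof.
  intros [x [y H]].
  pose proof (ex3_small sn pos_index) as HS.
  pose proof (ex3_mult (ex3_mult HS HS) H) as H2.
  eapply ex3_eq; [|exact H2]. exists 1. split; [lra|]. intros i _ _. repeat split; simpl; ring.
Qed.

Ltac lead_tac := repeat first
  [ eassumption | apply lead_const | apply lead_minus | apply lead_plus | apply lead_opp
  | apply lead_pow | apply lead_mult ].

Lemma sn_small d : 0 < d -> exists N, forall n, (N <= n)%nat -> pos_index n /\ 0 < sn n <= d.
Proof.
  intros Hd. exists (S (Z.to_nat (up (/ d ^ 2)))). intros n Hn.
  assert (Hn1 : pos_index n) by (unfold pos_index; lia). split; auto.
  destruct (sn_spec n Hn1) as [[Hs _] HN]. split; auto.
  apply Rnot_lt_le. intros L.
  assert (H1 : / d ^ 2 < INR n).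
  { destruct (archimed (/ d ^ 2)) as [A _]. eapply Rlt_le_trans; [exact A|].
    rewrite INR_IZR_INZ. apply IZR_le. lia. }
  rewrite HN in H1.
  assert (/ sn n ^ 2 <= / d ^ 2); [|lra].
  apply Rinv_le_contravar; [apply pow_lt; auto|]. apply pow_incr. lra.
Qed.

Lemma ex_bounded_away F a b c : ex3n F a b c -> exists B N, 0 <= B /\
  forall n, (N <= n)%nat -> Rabs (F n) <= B.
Proof.
  intros H. apply ex3_bounded in H. destruct H as [C [d [Hd [HC H]]]].
  destruct (sn_small d Hd) as [N HN]. exists C, N. split; auto.
  intros n Hn. destruct (HN n Hn) as [H1 H2]. specialize (H n H1 H2).
  simpl in H. rewrite Rmult_1_r in H. exact H.
Qed.

Lemma sn_eventually (d : R) (N : nat) : 0 < d -> exists d', 0 < d' /\ d' <= d /\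
  forall n, pos_index n -> 0 < sn n <= d' -> (N <= n)%nat.
Proof.
  intros Hd. exists (Rmin d (/ (INR N + 1))).
  assert (H0 : 0 < INR N + 1) by (pose proof (pos_INR N); lra).
  split; [apply Rmin_pos; auto; apply Rinv_0_lt_compat; auto|]. split; [apply Rmin_l|].
  intros n Hn [Hs Hsd]. destruct (sn_spec n Hn) as [[_ Hs1] HN].
  apply INR_le. assert (H : INR N + 1 <= / sn n).
  { rewrite <- (Rinv_inv (INR N + 1)). apply Rinv_le_contravar; auto.
    eapply Rle_trans; [exact Hsd|apply Rmin_r]. }
  rewrite HN. rewrite <- pow_inv.
  assert (1 <= / sn n) by (rewrite <- Rinv_1; apply Rinv_le_contravar; lra).
  nra.
Qed.

Section WalkSequence.

Variables (k : nat -> Z) (a : nat -> R) (x0 e0 e2 : R) (x1 : nat -> R).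
Hypothesis Hk : forall n, pos_index n -> Z.even (Z.of_nat n + k n) = true.
Hypothesis Hx : forall n, pos_index n -> IZR (k n) * sn n = x0 + x1 n * sn n.
Hypothesis Hx1 : bigO sn pos_index 0 x1.
Hypothesis He : ex3n (fun n => (2 * a n - 1) / sn n) (fun _ => e0) (fun _ => 0) (fun _ => e2).

Lemma ex_level : ex3n (fun n => IZR (k n) * sn n) (fun _ => x0) x1 (fun _ => 0).
Proof.
  eapply ex3_fun; [|apply (ex3_base sn pos_index (fun _ => x0) x1 (fun _ => 0)); auto; apply bigO_const].
  exists 1. split; [lra|]. intros n Hn _. rewrite Hx; auto. ring.
Qed.

Lemma level_eventually : exists B d, 0 <= B /\ 0 < d /\ forall n, pos_index n -> 0 < sn n <= d ->
  Rabs (IZR (k n) * sn n) <= B /\ Rabs ((2 * a n - 1) / sn n) <= B.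
Proof.
  destruct (ex_bounded_away _ _ _ _ ex_level) as [B1 [N1 [HB1 H1]]].
  destruct (ex_bounded_away _ _ _ _ He) as [B2 [N2 [HB2 H2]]].
  destruct (sn_eventually 1 (N1 + N2)) as [d [Hd [_ H]]]; [lra|].
  exists (B1 + B2), d. split; [lra|split; auto].
  intros n Hn Hs. specialize (H n Hn Hs).
  specialize (H1 n ltac:(lia)). specialize (H2 n ltac:(lia)). lra.
Qed.

Lemma prob_of_drift n : pos_index n -> (1 + (2 * a n - 1) / sn n * sn n) / 2 = a n.
Proof. intros Hn. destruct (sn_spec n Hn). field. lra. Qed.

(** The [- 1] beside [x1 n] is the passage from the level to the midpoint [y = k s - s]. *)
Lemma walk_tail_ex3 :
  ex3n (fun n => walk_tail n (a n) (k n)) (fun _ => 1 - Phi (x0 - e0))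
    (fun n => - phi (x0 - e0) * (x1 n - 1))
    (fun n => phi (x0 - e0) * (e2 + (x0 - e0) * (x1 n - 1) ^ 2 / 2 + tail_correction x0 e0)).
Proof.
  destruct level_eventually as [B [d [HB [Hd HBd]]]].
  destruct (walk_tail_expansion B HB) as [C [d' [Hd' [HC H]]]].
  pose proof ex_level as HL. pose proof (ex3_small sn pos_index) as HS.
  pose proof (ex3_minus HL HS) as HY.
  pose proof (ex3_minus HY He) as HZ.
  assert (Hb : forall i : nat, pos_index i -> Rabs (x0 - 0 - e0) <= Rabs (x0 - 0 - e0)) by (intros; lra).
  pose proof (ex3_Phi sn pos_index _ _ _ _ _ Hb HZ) as HP.
  pose proof (ex3_phi sn pos_index _ _ _ _ _ Hb HZ) as Hp.
  set (y := fun n => IZR (k n) * sn n - sn n) in *.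
  set (eta := fun n => (2 * a n - 1) / sn n) in *.
  assert (HR : lead (fun n => phi (y n - eta n) * tail_correction (y n) (eta n))
    (fun _ => phi (x0 - 0 - e0) * tail_correction (x0 - 0) e0)).
  { apply lead_mult; [eapply lead_ex3; exact Hp|].
    apply lead_ex3 in HY. pose proof (lead_ex3 _ _ _ _ He) as HE.
    unfold tail_correction, Rdiv. lead_tac. }
  apply lead_small2 in HR.
  pose proof (ex3_plus
    (ex3_minus (ex3_const sn pos_index 1) HP) HR) as HT.
  rewrite Rminus_0_r in HT.
  apply ex3_perturb with (F := fun n => tail_approx (y n) (eta n) (sn n)).
  - exists C, (Rmin d d'). split; [apply Rmin_pos; auto|split; auto].
    intros n Hn [Hs Hsd]. pose proof (Rmin_l d d'). pose proof (Rmin_r d d').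
    destruct (HBd n Hn) as [Hy1 Hy2]; [lra|].
    specialize (H n (k n) (eta n) Hn). fold (sn n) in H.
    replace (walk_tail n (a n) (k n)) with (walk_tail n ((1 + eta n * sn n) / 2) (k n))
      by (unfold eta; rewrite prob_of_drift; auto).
    apply H; auto. lra.
  - eapply ex3_coef; [exact HT| | |]; intros n Hn; cbv beta; field.
Qed.

Lemma walk_prob_ex3 :
  ex3n (fun n => walk_prob n (a n) (k n) / (2 * sn n)) (fun _ => phi (x0 - e0))
    (fun n => - (x0 - e0) * phi (x0 - e0) * x1 n)
    (fun n => phi (x0 - e0) * ((x0 - e0) * e2 + ((x0 - e0) ^ 2 - 1) * x1 n ^ 2 / 2 + local_correction x0 e0)).
Proof.
  destruct level_eventually as [B [d [HB [Hd HBd]]]].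
  destruct (walk_prob_local B HB) as [_ [_ [_ H]]].
  pose proof ex_level as HL.
  pose proof (ex3_minus HL He) as HZ.
  assert (Hb : forall i : nat, pos_index i -> Rabs (x0 - e0) <= Rabs (x0 - e0)) by (intros; lra).
  pose proof (ex3_phi sn pos_index _ _ _ _ _ Hb HZ) as Hp.
  set (x := fun n => IZR (k n) * sn n) in *.
  set (eta := fun n => (2 * a n - 1) / sn n) in *.
  assert (HR : lead (fun n => phi (x n - eta n) * local_correction (x n) (eta n))
    (fun _ => phi (x0 - e0) * local_correction x0 e0)).
  { apply lead_mult; [eapply lead_ex3; exact Hp|].
    apply lead_ex3 in HL. pose proof (lead_ex3 _ _ _ _ He) as HE.
    unfold local_correction, Rdiv. lead_tac. }
  apply lead_small2 in HR.
  pose proof (ex3_plus Hp HR) as HT.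
  apply ex3_perturb with (F := fun n => phi (x n - eta n)
    + sn n ^ 2 * (phi (x n - eta n) * local_correction (x n) (eta n))).
  - apply (bigO_comap (fun n => (n, k n, eta n)) lp_s sn (lp_dom B) pos_index) in H.
    + eapply bigO_ext; [|exact H]. exists 1. split; [lra|]. intros n Hn _.
      unfold lp_x, lp_eta, lp_s, lp_n, lp_k. simpl fst. simpl snd. fold (sn n).
      unfold eta at 1. rewrite prob_of_drift by auto. unfold x. ring.
    + exists d. split; auto. intros n Hn Hs. destruct (HBd n Hn Hs) as [H1 H2].
      split; [|reflexivity]. split; [auto|split; [apply Hk; auto|split; auto]].
  - eapply ex3_coef; [exact HT| | |]; intros n Hn; cbv beta; field.
Qed.

End WalkSequence.

(** * Exponentials of multiples of the small parameter *)

Fixpoint exp_taylor (m : nat) (x : R) : R :=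
  match m with O => 1 | S m' => exp_taylor m' x + x ^ m / INR (fact m) end.

Lemma is_derive_exp_taylor m x : is_derive (exp_taylor (S m)) x (exp_taylor m x).
Proof.
  induction m as [|m IH].
  - simpl. auto_derive; auto. field.
  - set (c := INR (fact (S (S m)))). set (c' := INR (fact (S m))).
    assert (Hc : c = INR (S (S m)) * c').
    { unfold c, c'. rewrite <- mult_INR. reflexivity. }
    assert (Hc' : 0 < c') by apply INR_fact_lt_0.
    assert (Hm : 0 < INR (S (S m))) by (apply lt_0_INR; lia).
    change (is_derive (fun x => exp_taylor (S m) x + x ^ S (S m) / c) x
      (exp_taylor m x + x ^ S m / c')).
    apply (is_derive_plus (exp_taylor (S m)) (fun x => x ^ S (S m) / c)); [exact IH|].
    rewrite Hc. clearbody c c'. evar_last.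
    { apply (is_derive_ext (fun x => / (INR (S (S m)) * c') * x ^ S (S m))).
      { intros t. unfold Rdiv. apply Rmult_comm. }
      apply (is_derive_scal (fun x => x ^ S (S m))).
      apply (is_derive_pow (fun x => x) (S (S m)) x 1). auto_derive; auto. }
    cbn [Init.Nat.pred]. field. split; lra.
Qed.

(** Induction by the mean value inequality, [exp_taylor m] being the derivative of
    [exp_taylor (S m)]. The constant is the maximum of [exp] on [-1, 1] for every [m]. *)
Lemma exp_taylor_bound m x : Rabs x <= 1 -> Rabs (exp x - exp_taylor m x) <= exp 1 * Rabs x ^ S m.
Proof.
  revert x; induction m as [|m IH]; intros x Hx.
  - assert (H : Rabs (exp x - exp 0) <= exp 1 * Rabs (x - 0)).
    { apply derivative_bound with exp; [intros; apply is_derive_exp|].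
      intros y Hy. apply exp_bound. apply Rabs_le_between in Hx.
      unfold Rmin, Rmax in Hy. destruct (Rle_dec 0 x); lra. }
    rewrite exp_0, Rminus_0_r in H. simpl. rewrite Rmult_1_r. exact H.
  - assert (H : Rabs ((exp x - exp_taylor (S m) x) - (exp 0 - exp_taylor (S m) 0))
      <= (exp 1 * Rabs x ^ S m) * Rabs (x - 0)).
    { apply derivative_bound with (f := fun x => exp x - exp_taylor (S m) x)
        (f' := fun x => exp x - exp_taylor m x).
      - intros y _. apply (is_derive_minus exp (exp_taylor (S m))); [apply is_derive_exp|].
        apply is_derive_exp_taylor.
      - intros y Hy. assert (Hyx : Rabs y <= Rabs x).
        { unfold Rmin, Rmax in Hy. destruct (Rle_dec 0 x); unfold Rabs;
          destruct (Rcase_abs y), (Rcase_abs x); lra. }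
        eapply Rle_trans; [apply IH; lra|]. apply Rmult_le_compat_l; [left; apply exp_pos|].
        apply pow_incr. split; [apply Rabs_pos|auto]. }
    assert (E0 : forall m, exp_taylor m 0 = 1).
    { intros j; induction j as [|j IHj]; [auto|]. cbn [exp_taylor].
      rewrite IHj, pow_i by lia. unfold Rdiv; ring. }
    rewrite E0, exp_0 in H. rewrite !Rminus_0_r in H.
    replace (exp x - exp_taylor (S m) x - (1 - 1)) with (exp x - exp_taylor (S m) x) in H by ring.
    eapply Rle_trans; [exact H|]. right; simpl; ring.
Qed.

Lemma exp_scaled_remainder v j m : (1 <= j)%nat ->
  bigO sn pos_index (j * S m) (fun n => exp (v * sn n ^ j) - exp_taylor m (v * sn n ^ j)).
Proof.
  intros Hj. apply bigO_le with (fun n => exp 1 * (Rabs v ^ S m * sn n ^ (j * S m))).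
  - exists (/ (Rabs v + 1)). pose proof (Rabs_pos v) as Hv. split; [apply Rinv_0_lt_compat; lra|].
    intros n Hn [Hs Hsd]. destruct (sn_spec n Hn) as [[_ Hs1] _].
    assert (Hp : 0 < sn n ^ j) by (apply pow_lt; auto).
    assert (Hp2 : sn n ^ j <= sn n).
    { destruct j as [|j]; [lia|]. simpl. rewrite <- (Rmult_1_r (sn n)) at 3.
      apply Rmult_le_compat_l; [lra|]. rewrite <- (pow1 j). apply pow_incr; lra. }
    assert (Ha : Rabs (v * sn n ^ j) = Rabs v * sn n ^ j).
    { rewrite Rabs_mult, (Rabs_pos_eq (_ ^ _)); lra. }
    assert (Hle : Rabs (v * sn n ^ j) <= 1).
    { rewrite Ha. apply Rle_trans with (Rabs v * / (Rabs v + 1)).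
      - apply Rmult_le_compat_l; lra.
      - apply Rmult_le_reg_r with (Rabs v + 1); [lra|]. rewrite Rmult_assoc, Rinv_l; lra. }
    eapply Rle_trans; [apply exp_taylor_bound; auto|].
    rewrite Ha, Rpow_mult_distr, <- pow_mult.
    apply Rle_abs.
  - apply bigO_scal, bigO_scal, bigO_small.
Qed.

Lemma bigO_div_small m j F : bigO sn pos_index (m + j) F -> bigO sn pos_index m (fun n => F n / sn n ^ j).
Proof.
  intros [C [d [Hd [HC H]]]]. exists C, d. split; [auto|split; auto].
  intros n Hn Hs. assert (Hp : 0 < sn n ^ j) by (apply pow_lt; lra).
  unfold Rdiv. rewrite Rabs_mult, (Rabs_pos_eq (/ _)) by (left; apply Rinv_0_lt_compat; auto).
  apply Rmult_le_reg_r with (sn n ^ j); auto.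
  rewrite Rmult_assoc, Rinv_l, Rmult_1_r, Rmult_assoc, <- pow_add by lra. auto.
Qed.

Lemma ex_expm1 v : ex3n (fun n => (exp (v * sn n) - 1) / sn n) (fun _ => v) (fun _ => v ^ 2 / 2)
  (fun _ => v ^ 3 / 6).
Proof.
  apply ex3_bigO; try apply bigO_const.
  eapply bigO_ext; [|apply (bigO_div_small 3 1), (exp_scaled_remainder v 1 3); lia].
  exists 1. split; [lra|]. intros n Hn Hs. rewrite !pow_1. simpl. field. lra.
Qed.

(** The sum of this quotient at [v] and at [- v] is [(u + 1/u - 2) / s^2], the even part in the
    numerators of [2 p - 1] and [2 q - 1]. Dividing by [s^2] costs two orders, hence the Taylor
    polynomial of degree 4. *)
Lemma ex_expm2 v : ex3n (fun n => (exp (v * sn n) - 1 - v * sn n) / sn n ^ 2) (fun _ => v ^ 2 / 2)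
  (fun _ => v ^ 3 / 6) (fun _ => v ^ 4 / 24).
Proof.
  apply ex3_bigO; try apply bigO_const.
  eapply bigO_ext; [|apply (bigO_div_small 3 2), (exp_scaled_remainder v 1 4); lia].
  exists 1. split; [lra|]. intros n Hn Hs. rewrite !pow_1. simpl. field. lra.
Qed.

Lemma ex_expm1_sq v : ex3n (fun n => (exp (v * sn n ^ 2) - 1) / sn n ^ 2) (fun _ => v) (fun _ => 0)
  (fun _ => v ^ 2 / 2).
Proof.
  apply ex3_bigO; try apply bigO_const.
  apply (bigO_weaken sn pos_index 4); [lia|].
  eapply bigO_ext; [|apply (bigO_div_small 4 2), (exp_scaled_remainder v 2 2); lia].
  exists 1. split; [lra|]. intros n Hn Hs. cbn [exp_taylor]. simpl fact. simpl INR. field. lra.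
Qed.

Ltac coef_tac := let n := fresh "n" in intros n _; cbv beta.

(** * Levels of either parity *)

Section Levels.

Variables (K : nat -> Z) (lam : R) (w : nat -> R).
Hypothesis HK : forall n, pos_index n -> IZR (K n) * sn n = lam + w n * sn n.
Hypothesis Hw : forall n, pos_index n -> 0 <= w n <= 1.

(** Chosen so that [K + 1 - parity] and [K + 1 + parity] both have the parity of [n]: they are the
    first lattice points counted by the tails at [K] and at [K + 1]. *)
Definition parity (n : nat) : Z := if Z.even (Z.of_nat n + K n) then 1%Z else 0%Z.

Lemma parity_cases n :
  (Z.even (Z.of_nat n + K n) = true /\ parity n = 1%Z) \/
  (Z.odd (Z.of_nat n + K n) = true /\ parity n = 0%Z).
Proof.
  unfold parity. rewrite <- Z.negb_even. destruct (Z.even (Z.of_nat n + K n)); auto.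
Qed.

Lemma even_level n : Z.even (Z.of_nat n + (K n + 1 - parity n)) = true /\
  Z.even (Z.of_nat n + (K n + 1 + parity n)) = true.
Proof.
  destruct (parity_cases n) as [[H ->]|[H ->]].
  - split; (replace (Z.of_nat n + _)%Z with (Z.of_nat n + K n)%Z by lia) ||
    replace (Z.of_nat n + (K n + 1 + 1))%Z with (Z.of_nat n + K n + 2)%Z by lia; auto.
    rewrite Z.even_add, H; reflexivity.
  - rewrite Z.sub_0_r, Z.add_0_r. rewrite Z.add_assoc, Z.even_add.
    rewrite <- Z.negb_odd, H. auto.
Qed.

Lemma walk_tail_level n a : walk_tail n a (K n) = walk_tail n a (K n + 1 - parity n).
Proof.
  destruct (parity_cases n) as [[H ->]|[H ->]]; [f_equal; lia|].
  rewrite Z.sub_0_r. pose proof (walk_tail_diff n a (K n)) as E.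
  rewrite walk_prob_odd in E by auto. lra.
Qed.

Lemma odd_level_succ n : Z.even (Z.of_nat n + K n) = true ->
  Z.odd (Z.of_nat n + (K n + 1)) = true.
Proof. intros H. rewrite Z.add_assoc, Z.odd_add, <- Z.negb_even, H. reflexivity. Qed.

Lemma walk_tail_level_succ n a : walk_tail n a (K n + 1) = walk_tail n a (K n + 1 + parity n).
Proof.
  destruct (parity_cases n) as [[H ->]|[H ->]]; [|f_equal; lia].
  pose proof (walk_tail_diff n a (K n + 1)) as E.
  rewrite walk_prob_odd in E by (apply odd_level_succ; auto). lra.
Qed.

Lemma walk_excess_level_succ n a :
  walk_excess n a (K n + 1) = (INR n * (2 * a - 1) - IZR (K n + 1)) * walk_tail n a (K n + 1)
  + (1 - a) * ((INR n + IZR (K n + 1 + parity n)) * walk_prob n a (K n + 1 + parity n)).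
Proof.
  unfold walk_excess. f_equal. f_equal.
  destruct (parity_cases n) as [[H ->]|[H ->]].
  - rewrite (walk_prob_odd n a (K n + 1)) by (apply odd_level_succ; auto).
    rewrite (plus_IZR (K n + 1) 1). ring.
  - rewrite Z.add_0_r, (walk_prob_odd n a (K n + 1 + 1)); [ring|].
    replace (Z.of_nat n + (K n + 1 + 1))%Z with (Z.of_nat n + K n + 2)%Z by lia.
    rewrite Z.odd_add, H. reflexivity.
Qed.

Definition parity_shift (n : nat) : R := IZR (parity n).

Lemma parity_shift_cases n : parity_shift n = 0 \/ parity_shift n = 1.
Proof. unfold parity_shift. destruct (parity_cases n) as [[_ ->]|[_ ->]]; auto. Qed.

Lemma bounded_w : bigO sn pos_index 0 w.
Proof.
  apply bigO_bounded with 1. intros n Hn. specialize (Hw n Hn). rewrite Rabs_pos_eq; lra.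
Qed.

Lemma bounded_parity_shift : bigO sn pos_index 0 parity_shift.
Proof.
  apply bigO_bounded with 1. intros n _. destruct (parity_shift_cases n) as [-> | ->];
  rewrite Rabs_pos_eq; lra.
Qed.

Section Drift.

Variables (a : nat -> R) (e0 e2 : R).
Hypothesis He : ex3n (fun n => (2 * a n - 1) / sn n) (fun _ => e0) (fun _ => 0) (fun _ => e2).

(** The midpoint below the lattice point [K + 1 - parity] is [K - parity], whence the combination
    [w - parity_shift]. *)
Lemma ex_tail_level :
  ex3n (fun n => walk_tail n (a n) (K n)) (fun _ => 1 - Phi (lam - e0))
    (fun n => - phi (lam - e0) * (w n - parity_shift n))
    (fun n => phi (lam - e0) * (e2 + (lam - e0) * (w n - parity_shift n) ^ 2 / 2 + tail_correction lam e0)).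
Proof.
  pose proof bounded_w. pose proof bounded_parity_shift.
  eapply ex3_eq; [|apply (walk_tail_ex3 (fun n => K n + 1 - parity n)%Z a lam e0 e2
    (fun n => w n + 1 - parity_shift n)); auto].
  - exists 1. split; [lra|]. intros n Hn _. rewrite walk_tail_level.
    split; [auto|split; [auto|]]. split; [ring|].
    replace (w n + 1 - parity_shift n - 1) with (w n - parity_shift n) by ring. auto.
  - intros n _. apply even_level.
  - intros n Hn. rewrite minus_IZR, plus_IZR. fold (parity_shift n).
    replace ((IZR (K n) + 1 - parity_shift n) * sn n) with (IZR (K n) * sn n + (1 - parity_shift n) * sn n) by ring.
    rewrite HK by auto. ring.
  - apply bigO_minus; auto. apply bigO_plus; auto. apply bigO_const.
Qed.

Lemma level_succ_x n : pos_index n ->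
  IZR (K n + 1 + parity n) * sn n = lam + (w n + 1 + parity_shift n) * sn n.
Proof.
  intros Hn. rewrite !plus_IZR. fold (parity_shift n).
  replace ((IZR (K n) + 1 + parity_shift n) * sn n) with (IZR (K n) * sn n + (1 + parity_shift n) * sn n) by ring.
  rewrite HK by auto. ring.
Qed.

Lemma ex_tail_level_succ :
  ex3n (fun n => walk_tail n (a n) (K n + 1)) (fun _ => 1 - Phi (lam - e0))
    (fun n => - phi (lam - e0) * (w n + parity_shift n))
    (fun n => phi (lam - e0) * (e2 + (lam - e0) * (w n + parity_shift n) ^ 2 / 2 + tail_correction lam e0)).
Proof.
  pose proof bounded_w. pose proof bounded_parity_shift.
  eapply ex3_eq; [|apply (walk_tail_ex3 (fun n => K n + 1 + parity n)%Z a lam e0 e2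
    (fun n => w n + 1 + parity_shift n)); auto].
  - exists 1. split; [lra|]. intros n Hn _. rewrite walk_tail_level_succ.
    split; [auto|split; [auto|]]. split; [ring|].
    replace (w n + 1 + parity_shift n - 1) with (w n + parity_shift n) by ring. auto.
  - intros n _. apply even_level.
  - apply level_succ_x.
  - apply bigO_plus; auto. apply bigO_plus; auto. apply bigO_const.
Qed.

Lemma ex_prob_level_succ :
  ex3n (fun n => walk_prob n (a n) (K n + 1 + parity n) / (2 * sn n)) (fun _ => phi (lam - e0))
    (fun n => - (lam - e0) * phi (lam - e0) * (w n + 1 + parity_shift n))
    (fun n => phi (lam - e0) * ((lam - e0) * e2
       + ((lam - e0) ^ 2 - 1) * (w n + 1 + parity_shift n) ^ 2 / 2 + local_correction lam e0)).
Proof.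
  pose proof bounded_w. pose proof bounded_parity_shift.
  apply walk_prob_ex3; auto.
  - intros n _. apply even_level.
  - apply level_succ_x.
  - apply bigO_plus; auto. apply bigO_plus; auto. apply bigO_const.
Qed.

(** [((1 + h) / (1 - h)) ^ K] with [h = 2 a - 1], through [ln ((1 + h) / (1 - h)) = 2 h + 2 h^3 / 3 + O(h^5)]. *)
Lemma ex_odds_power :
  ex3n (fun n => Rpower (a n / (1 - a n)) (IZR (K n))) (fun _ => exp (2 * lam * e0))
    (fun n => exp (2 * lam * e0) * (2 * w n * e0))
    (fun n => exp (2 * lam * e0) * (2 * lam * (e2 + e0 ^ 3 / 3) + (2 * w n * e0) ^ 2 / 2)).
Proof.
  assert (HB : Rabs (2 * lam * e0) <= Rabs (2 * lam * e0)) by lra.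
  set (eta := fun n => (2 * a n - 1) / sn n) in *.
  pose proof bounded_w as bw. pose proof (ex3_small sn pos_index) as HS.
  assert (HX : ex3n (fun n => lam + w n * sn n) (fun _ => lam) w (fun _ => 0)).
  { eapply ex3_fun; [|apply (ex3_base sn pos_index (fun _ => lam) w (fun _ => 0)); auto; apply bigO_const].
    exists 1. split; [lra|]. intros; simpl; ring. }
  assert (HE3 : ex3n (fun n => sn n ^ 2 * eta n ^ 3) (fun _ => 0) (fun _ => 0) (fun _ => e0 ^ 3)).
  { apply lead_small2, lead_pow. eapply lead_ex3; exact He. }
  pose proof (ex3_mult HX
    (ex3_plus
      (ex3_mult (ex3_const sn pos_index 2) He)
      (ex3_mult (ex3_const sn pos_index (2 / 3)) HE3))) as HF.
  assert (HL : ex3n (fun n => IZR (K n) * ln (a n / (1 - a n))) (fun _ => 2 * lam * e0)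
     (fun n => 2 * w n * e0) (fun n => 2 * lam * (e2 + e0 ^ 3 / 3))).
  { eapply ex3_coef; [eapply ex3_perturb; [|exact HF]| | |]; try (coef_tac; field).
    apply bigO_le with (fun n => (lam + w n * sn n) * (4 * eta n ^ 5) * sn n ^ 4).
    - destruct (ex_bounded_away _ _ _ _ He) as [B [N [HB0 HBN]]].
      destruct (sn_eventually (/ (2 * (B + 1))) N) as [d [Hd [Hd2 HdN]]].
      { apply Rinv_0_lt_compat; lra. }
      exists d. split; auto. intros n Hn Hs. destruct (sn_spec n Hn) as [Hs1 HN].
      specialize (HBN n (HdN n Hn Hs)). fold (eta n) in HBN.
      assert (Ea : a n = (1 + eta n * sn n) / 2) by (unfold eta; field; lra).
      assert (Hh : Rabs (eta n * sn n) <= / 2).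
      { rewrite Rabs_mult, (Rabs_pos_eq (sn n)) by lra.
        apply Rle_trans with (B * / (2 * (B + 1))).
        - apply Rmult_le_compat; try lra; apply Rabs_pos.
        - apply Rmult_le_reg_r with (2 * (B + 1)); [lra|]. rewrite Rmult_assoc, Rinv_l; lra. }
      pose proof (ln_log_ratio (- (eta n * sn n))) as L. rewrite Rabs_Ropp in L. specialize (L Hh).
      apply Rabs_le_between in Hh.
      replace ((1 - - (eta n * sn n)) / (1 + - (eta n * sn n))) with (a n / (1 - a n)) in L
        by (rewrite Ea; field; lra).
      assert (EK : IZR (K n) = (lam + w n * sn n) / sn n).
      { rewrite <- HK by auto. field. lra. }
      rewrite EK. set (l := ln _) in *.
      match goal with |- Rabs ?X <= _ => replace X with ((lam + w n * sn n) * (/ sn n *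
        (l - (-2 * - (eta n * sn n) - 2 / 3 * (- (eta n * sn n)) ^ 3)))) by (field; lra) end.
      rewrite Rmult_assoc, !(Rabs_mult (lam + w n * sn n)).
      apply Rmult_le_compat_l; [apply Rabs_pos|].
      rewrite Rabs_mult. eapply Rle_trans; [apply Rmult_le_compat_l; [apply Rabs_pos|exact L]|].
      right. rewrite !Rabs_mult, <- !RPow_abs, Rabs_inv, (Rabs_pos_eq 4), (Rabs_pos_eq (sn n)) by lra.
      field. lra.
    - apply (bigO_weaken sn pos_index 4); [lia|]. apply (bigO_mult sn pos_index 0 4); [|apply bigO_small].
      apply (bigO_mult sn pos_index 0 0); [apply (ex3_bounded HX)|].
      apply bigO_scal, bigO_pow. apply (ex3_bounded He). }
  eapply ex3_coef; [apply (ex3_exp sn pos_index (Rabs (2 * lam * e0)) _ _ _ _ (fun _ _ => HB) HL)| | |];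
    coef_tac; field.
Qed.

End Drift.

(** * The model probabilities and the expansion of the price *)

Section Model.

Variables (v mu : R).
Hypothesis Hv : 0 < v.

Definition up_factor (n : nat) : R := exp (v * sn n).
Definition growth (n : nat) : R := exp (mu * sn n ^ 2).
Definition prob_p (n : nat) : R := (growth n - / up_factor n) / (up_factor n - / up_factor n).
Definition prob_q (n : nat) : R := (up_factor n - / growth n) / (up_factor n - / up_factor n).
(** Coefficients of orders 0 and 2 of [(2 p - 1) / s] and [(2 q - 1) / s]. Changing the sign of [s]
    exchanges [u] and [1 / u] and keeps the growth factor, so [2 p - 1] and [2 q - 1] are odd in [s]
    and order 1 is absent. *)
Definition drift_p0 : R := mu / v - v / 2.
Definition drift_p2 : R := mu ^ 2 / (2 * v) - mu * v / 6 + v ^ 3 / 24.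
Definition drift_q0 : R := mu / v + v / 2.
Definition drift_q2 : R := - mu ^ 2 / (2 * v) - mu * v / 6 - v ^ 3 / 24.

Lemma up_factor_gt_1 n : pos_index n -> 1 < up_factor n.
Proof.
  intros Hn. destruct (sn_spec n Hn). unfold up_factor. rewrite <- exp_0. apply exp_increasing. nra.
Qed.

Lemma up_factor_inv n : exp (- v * sn n) = / up_factor n.
Proof. unfold up_factor. rewrite <- exp_Ropp. f_equal. ring. Qed.

Lemma growth_inv n : exp (- mu * sn n ^ 2) = / growth n.
Proof. unfold growth. rewrite <- exp_Ropp. f_equal. ring. Qed.

Lemma growth_pos n : 0 < growth n.
Proof. apply exp_pos. Qed.

Lemma up_factor_diff_pos n : pos_index n -> 0 < up_factor n - / up_factor n.
Proof.
  intros Hn. pose proof (up_factor_gt_1 n Hn).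
  assert (/ up_factor n < 1) by (rewrite <- Rinv_1; apply Rinv_lt_contravar; lra). lra.
Qed.

Lemma ex_inv_up_factor_diff : ex3n (fun n => / ((up_factor n - / up_factor n) / sn n)) (fun _ => / (2 * v)) (fun _ => 0)
  (fun _ => - v / 12).
Proof.
  pose proof (ex3_minus (ex_expm1 v) (ex_expm1 (- v))) as H.
  assert (Hb : forall n : nat, pos_index n -> v <= v - - v <= 3 * v) by (intros; lra).
  eapply ex3_eq; [|apply (ex3_inv sn pos_index v (3 * v) _ _ _ _ Hv Hb H)].
  exists 1. split; [lra|]. intros n Hn _. destruct (sn_spec n Hn).
  cbv beta. rewrite up_factor_inv. fold (up_factor n). pose proof (up_factor_gt_1 n Hn).
  repeat split; try (field; lra). f_equal. field. lra.
Qed.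

Lemma ex_drift_p : ex3n (fun n => (2 * prob_p n - 1) / sn n) (fun _ => drift_p0) (fun _ => 0) (fun _ => drift_p2).
Proof.
  pose proof (ex3_mult
    (ex3_minus (ex3_mult (ex3_const sn pos_index 2) (ex_expm1_sq mu))
      (ex3_plus (ex_expm2 v) (ex_expm2 (- v)))) ex_inv_up_factor_diff) as H.
  eapply ex3_eq; [|exact H]. exists 1. split; [lra|]. intros n Hn _. destruct (sn_spec n Hn).
  cbv beta. rewrite up_factor_inv. fold (up_factor n). fold (growth n). unfold drift_p0, drift_p2.
  pose proof (up_factor_diff_pos n Hn) as Hd. pose proof (up_factor_gt_1 n Hn) as Hu.
  repeat split; try (field; lra). unfold prob_p.
  assert (up_factor n * up_factor n - 1 <> 0) by nra.
  field. repeat split; try lra; nra.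
Qed.

Lemma ex_drift_q : ex3n (fun n => (2 * prob_q n - 1) / sn n) (fun _ => drift_q0) (fun _ => 0) (fun _ => drift_q2).
Proof.
  pose proof (ex3_mult
    (ex3_minus (ex3_plus (ex_expm2 v) (ex_expm2 (- v)))
      (ex3_mult (ex3_const sn pos_index 2) (ex_expm1_sq (- mu)))) ex_inv_up_factor_diff) as H.
  eapply ex3_eq; [|exact H]. exists 1. split; [lra|]. intros n Hn _. destruct (sn_spec n Hn).
  cbv beta. rewrite up_factor_inv, growth_inv. fold (up_factor n). unfold drift_q0, drift_q2.
  pose proof (up_factor_diff_pos n Hn) as Hd. pose proof (up_factor_gt_1 n Hn) as Hu. pose proof (growth_pos n).
  repeat split; try (field; lra). unfold prob_q.
  field. repeat split; try lra; nra.
Qed.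

Lemma ex_drift_pc :
  ex3n (fun n => (2 * (1 - prob_p n) - 1) / sn n) (fun _ => - drift_p0) (fun _ => 0) (fun _ => - drift_p2).
Proof.
  eapply ex3_eq; [|exact (ex3_opp ex_drift_p)].
  exists 1. split; [lra|]. intros n Hn _. destruct (sn_spec n Hn).
  repeat split; try (field; lra).
Qed.

Lemma ex_up_factor_inv : ex3n (fun n => / up_factor n) (fun _ => 1) (fun _ => - v) (fun _ => v ^ 2 / 2).
Proof.
  eapply ex3_eq; [|exact (ex3_plus (ex3_const sn pos_index 1)
    (ex3_mult (ex3_small sn pos_index) (ex_expm1 (- v))))].
  exists 1. split; [lra|]. intros n Hn _. destruct (sn_spec n Hn).
  cbv beta. rewrite up_factor_inv. pose proof (up_factor_gt_1 n Hn).
  repeat split; try (field; lra).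
Qed.

Lemma ex_level_power : ex3n (fun n => Rpower (up_factor n) (IZR (K n))) (fun _ => exp (v * lam))
  (fun n => exp (v * lam) * (v * w n)) (fun n => exp (v * lam) * ((v * w n) ^ 2 / 2)).
Proof.
  assert (HB : Rabs (v * lam) <= Rabs (v * lam)) by lra.
  assert (H : ex3n (fun n => v * lam + (v * w n) * sn n + 0 * sn n ^ 2) (fun _ => v * lam)
    (fun n => v * w n) (fun _ => 0)).
  { apply ex3_base; try apply bigO_const. apply bigO_scal, bounded_w. }
  eapply ex3_eq; [|apply (ex3_exp sn pos_index _ _ _ _ _ (fun _ _ => HB) H)].
  exists 1. split; [lra|]. intros n Hn _. cbv beta.
  split; [|repeat split; field].
  unfold Rpower, up_factor. rewrite ln_exp. f_equal.
  replace (IZR (K n) * (v * sn n)) with (v * (IZR (K n) * sn n)) by ring.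
  rewrite HK by auto. ring.
Qed.

(** The Gaussian form of the tilt: the Black-Scholes identity
    [M exp(- r tau) phi(d2) = S phi(d1)]. *)
Lemma phi_shift_q : exp (- mu) * exp (v * lam) * phi (lam - drift_p0) = phi (lam - drift_q0).
Proof.
  unfold phi, gauss. rewrite (Rmult_comm (/ _)), (Rmult_comm (/ _)), <- Rmult_assoc.
  f_equal. rewrite <- !exp_plus. f_equal. unfold drift_p0, drift_q0. field. lra.
Qed.

(** The Gaussian form of the odds factor in the reflection principle. *)
Lemma phi_reflect : exp (2 * lam * drift_p0) * phi (lam - - drift_p0) = phi (lam - drift_p0).
Proof.
  unfold phi, gauss. rewrite (Rmult_comm (/ _)), (Rmult_comm (/ _)), <- Rmult_assoc.
  f_equal. rewrite <- !exp_plus. f_equal. field.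
Qed.

Lemma price_expansion_pos : 0 < mu ->
  ex3n (fun n =>
    let c := (up_factor n - 1) * (1 - growth n / up_factor n) / ((up_factor n + 1) * (growth n - 1)) in
    let crho := (up_factor n - 1) * (growth n - / up_factor n) / ((up_factor n + 1) * (growth n - 1)) in
    exp (- mu) * exp (v * lam)
      * (1 - walk_tail n (prob_p n) (K n)
         - Rpower (prob_p n / (1 - prob_p n)) (IZR (K n)) * walk_tail n (1 - prob_p n) (K n + 1))
    + (walk_tail n (prob_q n) (K n) + c * walk_tail n (prob_q n) (K n + 1))
    + (1 - crho) * (exp (- mu) * (Rpower (up_factor n) (IZR (K n)) * Rpower (prob_p n / (1 - prob_p n)) (IZR (K n)))
       * walk_tail n (1 - prob_p n) (K n + 1)))
   (fun _ => (1 + v ^ 2 / (2 * mu)) * (1 - Phi (lam - drift_q0))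
     + exp (v * lam) * exp (- mu) * Phi (lam - drift_p0)
     - v ^ 2 / (2 * mu) * (exp (- mu) * exp (2 * lam * mu / v) * (1 - Phi (lam - - drift_p0))))
   (fun _ => - (v / 2) * ((1 + v ^ 2 / (2 * mu)) * (1 - Phi (lam - drift_q0))
     + (1 - v ^ 2 / (2 * mu)) * (exp (- mu) * exp (2 * lam * mu / v) * (1 - Phi (lam - - drift_p0)))))
   (fun n => v ^ 2 / 12 * ((3 + v ^ 2 / (2 * mu)) * (1 - Phi (lam - drift_q0))
     + (3 - v ^ 2 / (2 * mu) - (12 * mu / v ^ 2 * (1 - v ^ 2 / (2 * mu)) * (w n * (1 - w n))
          + (1 + 4 * mu ^ 2 / v ^ 4) * (v * lam)))
       * (exp (- mu) * exp (2 * lam * mu / v) * (1 - Phi (lam - - drift_p0))))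
     + (1 / 2 + w n * (1 - w n) - (lam + drift_q0) * lam / 6) * v * phi (lam - drift_q0)).
Proof.
  intros Hmu.
  pose proof (ex3_small sn pos_index) as HS. pose proof (ex3_const sn pos_index) as HC.
  pose proof (ex_expm1_sq mu) as HM.
  assert (HU : ex3n (fun n => / (up_factor n + 1)) (fun _ => / 2) (fun _ => - v / 4) (fun _ => 0)).
  { assert (H : ex3n (fun n => up_factor n + 1) (fun _ => 2) (fun _ => v) (fun _ => v ^ 2 / 2)).
    { eapply ex3_eq; [|exact (ex3_plus (HC 2)
        (ex3_mult HS (ex_expm1 v)))].
      exists 1. split; [lra|]. intros n Hn _. destruct (sn_spec n Hn).
      cbv beta. fold (up_factor n). repeat split; field; lra. }
    assert (H2 : forall n : nat, pos_index n -> 1 <= 2 <= 3) by (intros; lra).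
    eapply ex3_coef; [apply (ex3_inv sn pos_index 1 3 _ _ _ _ Rlt_0_1 H2 H)| | |];
    coef_tac; field. }
  assert (HI : ex3n (fun n => / ((growth n - 1) / sn n ^ 2)) (fun _ => / mu) (fun _ => 0) (fun _ => - / 2)).
  { assert (H2 : forall n : nat, pos_index n -> mu <= mu <= mu) by (intros; lra).
    eapply ex3_coef; [apply (ex3_inv sn pos_index mu mu _ _ _ _ Hmu H2 HM)| | |];
    coef_tac; field; lra. }
  assert (HA : ex3n (fun n => (1 - growth n / up_factor n) / sn n) (fun _ => v) (fun _ => - (v ^ 2 / 2 + mu))
    (fun _ => v ^ 3 / 6 + mu * v)).
  { eapply ex3_eq; [|exact (ex3_opp (ex3_plus (ex_expm1 (- v))
      (ex3_mult (ex3_mult HS HM) ex_up_factor_inv)))].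
    exists 1. split; [lra|]. intros n Hn _. destruct (sn_spec n Hn).
    pose proof (up_factor_gt_1 n Hn). cbv beta. rewrite up_factor_inv. fold (growth n). repeat split; field; lra. }
  assert (HA' : ex3n (fun n => (growth n - / up_factor n) / sn n) (fun _ => v) (fun _ => mu - v ^ 2 / 2)
    (fun _ => v ^ 3 / 6)).
  { eapply ex3_eq; [|exact (ex3_minus
      (ex3_mult HS HM) (ex_expm1 (- v)))].
    exists 1. split; [lra|]. intros n Hn _. destruct (sn_spec n Hn).
    pose proof (up_factor_gt_1 n Hn). cbv beta. rewrite up_factor_inv. fold (growth n). repeat split; field; lra. }
  (* The common factor of [c] and [crho] is of order [1 / s], since [growth - 1] is of order [s^2].
     [HF] expands it after multiplication by [s]; the compensating [1 / s] goes to the factors of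
     [HA] and [HA']. *)
  pose proof (ex3_mult (ex3_mult (ex_expm1 v) HU) HI) as HF.
  assert (Her : forall n, pos_index n -> 1 < growth n).
  { intros n Hn. destruct (sn_spec n Hn) as [[Hs _] _]. unfold growth. rewrite <- exp_0.
    apply exp_increasing. apply Rmult_lt_0_compat; auto. apply pow_lt; auto. }
  assert (Hc : ex3n (fun n => (up_factor n - 1) * (1 - growth n / up_factor n) / ((up_factor n + 1) * (growth n - 1)))
    (fun _ => v / (2 * mu) * v) (fun _ => - (v / (2 * mu)) * (v ^ 2 / 2 + mu))
    (fun _ => v / (2 * mu) * (v ^ 3 / 12 + mu * v / 2))).
  { eapply ex3_eq; [|exact (ex3_mult HF HA)].
    exists 1. split; [lra|]. intros n Hn _. destruct (sn_spec n Hn).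
    pose proof (up_factor_gt_1 n Hn). specialize (Her n Hn). cbv beta. fold (up_factor n).
    repeat split; field; repeat split; lra. }
  assert (Hcr : ex3n (fun n => (up_factor n - 1) * (growth n - / up_factor n) / ((up_factor n + 1) * (growth n - 1)))
    (fun _ => v / (2 * mu) * v) (fun _ => v / (2 * mu) * (mu - v ^ 2 / 2))
    (fun _ => v / (2 * mu) * (v ^ 3 / 12 - mu * v / 2))).
  { eapply ex3_eq; [|exact (ex3_mult HF HA')].
    exists 1. split; [lra|]. intros n Hn _. destruct (sn_spec n Hn).
    pose proof (up_factor_gt_1 n Hn). specialize (Her n Hn). cbv beta. fold (up_factor n).
    repeat split; field; repeat split; lra. }
  pose proof (ex_tail_level prob_p drift_p0 drift_p2 ex_drift_p) as HTp.
  pose proof (ex_tail_level prob_q drift_q0 drift_q2 ex_drift_q) as HTq.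
  pose proof (ex_tail_level_succ prob_q drift_q0 drift_q2 ex_drift_q) as HTq1.
  pose proof (ex_tail_level_succ (fun n => 1 - prob_p n) (- drift_p0) (- drift_p2) ex_drift_pc) as HTm.
  pose proof (ex_odds_power prob_p drift_p0 drift_p2 ex_drift_p) as HO.
  pose proof ex_level_power as HL.
  pose proof (ex3_plus (ex3_plus
    (ex3_mult (HC (exp (- mu) * exp (v * lam)))
      (ex3_minus (ex3_minus (HC 1) HTp)
         (ex3_mult HO HTm)))
    (ex3_plus HTq (ex3_mult Hc HTq1)))
    (ex3_mult (ex3_minus (HC 1) Hcr)
      (ex3_mult
        (ex3_mult (HC (exp (- mu)))
          (ex3_mult HL HO)) HTm))) as HV.
  assert (Eb : exp (2 * lam * mu / v) = exp (2 * lam * drift_p0) * exp (v * lam)).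
  { rewrite <- exp_plus. f_equal. unfold drift_p0. field. lra. }
  pose proof phi_shift_q as P1. pose proof phi_reflect as P2.
  rewrite Eb.
  pose proof (exp_pos (- mu)) as HX. pose proof (exp_pos (v * lam)) as Hm.
  pose proof (exp_pos (2 * lam * drift_p0)) as HT.
  (* All densities are expressed through the one at [lam - drift_q0], after which each coefficient
     is a rational identity in independent atoms. *)
  assert (P1' : phi (lam - drift_p0) = phi (lam - drift_q0) / (exp (- mu) * exp (v * lam))).
  { rewrite <- P1. field. lra. }
  assert (P2' : phi (lam - - drift_p0) = phi (lam - drift_q0) / (exp (- mu) * exp (v * lam) * exp (2 * lam * drift_p0))).
  { rewrite <- P1, <- P2. field. lra. }
  rewrite P1', P2' in HV.
  set (X := exp (- mu)) in *. set (m := exp (v * lam)) in *. set (Th := exp (2 * lam * drift_p0)) in *.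
  set (g := phi (lam - drift_q0)) in *. set (Fp := Phi (lam - drift_p0)) in *. set (Fq := Phi (lam - drift_q0)) in *.
  set (Fm := Phi (lam - - drift_p0)) in *.
  clearbody X m Th g Fp Fq Fm.
  eapply ex3_coef; [exact HV| | |]; clear HV; coef_tac.
  - field. lra.
  - destruct (parity_shift_cases n) as [-> | ->]; unfold drift_p0, drift_q0; field; repeat split; lra.
  (* With [pi] the parity shift, the parity remains only in a term [v g (pi - pi^2)], so the
     identity holds at the values 0 and 1 and not for arbitrary [pi]. *)
  - unfold tail_correction, drift_p2, drift_q2. destruct (parity_shift_cases n) as [-> | ->]; unfold drift_p0, drift_q0; field; repeat split; lra.
Qed.

Lemma price_expansion_zero : mu = 0 ->
  ex3n (fun n =>
    exp (v * lam)
      * (1 - walk_tail n (prob_p n) (K n)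
         - Rpower (prob_p n / (1 - prob_p n)) (IZR (K n)) * walk_tail n (prob_q n) (K n + 1))
    + (walk_tail n (prob_q n) (K n) + walk_tail n (prob_q n) (K n + 1))
    + (1 - / up_factor n) * walk_excess n (prob_q n) (K n + 1))
   (fun _ => 1 - Phi (lam - drift_q0) + exp (v * lam) * Phi (lam - drift_p0)
     + (- (v * lam) + v ^ 2 / 2) * (1 - Phi (lam - drift_q0)) + v * phi (lam - drift_q0))
   (fun _ => - (v / 2) * (2 * (1 - Phi (lam - drift_q0))
     + (- (v * lam) + v ^ 2 / 2) * (1 - Phi (lam - drift_q0)) + v * phi (lam - drift_q0)))
   (fun n => v ^ 2 / 6 * ((3 + 3 * (w n * (1 - w n)) - v ^ 2 / 4) * (1 - Phi (lam - drift_q0))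
     + (- (v * lam) + v ^ 2 / 2) * (1 - Phi (lam - drift_q0)))
     + (1 / 2 + w n * (1 - w n) + v ^ 2 / 12 + (drift_p0 - lam) * lam / 6) * (v * phi (lam - drift_q0))).
Proof.
  intros Hmu.
  pose proof (ex3_small sn pos_index) as HS. pose proof (ex3_const sn pos_index) as HC.
  pose proof bounded_w as bw. pose proof bounded_parity_shift as be.
  pose proof (ex_tail_level prob_p drift_p0 drift_p2 ex_drift_p) as HTp.
  pose proof (ex_tail_level prob_q drift_q0 drift_q2 ex_drift_q) as HTq.
  pose proof (ex_tail_level_succ prob_q drift_q0 drift_q2 ex_drift_q) as HTq1.
  pose proof (ex_odds_power prob_p drift_p0 drift_p2 ex_drift_p) as HO.
  pose proof (ex_prob_level_succ prob_q drift_q0 drift_q2 ex_drift_q) as HP.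
  pose proof ex_drift_q as HE.
  assert (HK1 : ex3n (fun n => lam + (w n + 1) * sn n + 0 * sn n ^ 2) (fun _ => lam)
    (fun n => w n + 1) (fun _ => 0)).
  { apply ex3_base; try apply bigO_const. apply bigO_plus; auto. apply bigO_const. }
  assert (HX : ex3n (fun n => lam + (w n + 1 + parity_shift n) * sn n + 0 * sn n ^ 2) (fun _ => lam)
    (fun n => w n + 1 + parity_shift n) (fun _ => 0)).
  { apply ex3_base; try apply bigO_const. apply bigO_plus; auto. apply bigO_plus; auto. apply bigO_const. }
  (* The excess grows like [1 / s], both in its drift part and in its local part, so [s] times it is
     expanded; the factor [1 - 1/u], of order [s], absorbs the scaling. *)
  pose proof (ex3_plus
    (ex3_mult (ex3_minus HE HK1) HTq1)
    (ex3_mult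
      (ex3_mult
        (ex3_minus (HC 1) (ex3_mult HS HE))
        (ex3_plus (HC 1) (ex3_mult HS HX))) HP)) as HG.
  match type of HG with ex3 _ _ _ ?a ?b ?c =>
    assert (HG' : ex3n (fun n => sn n * walk_excess n (prob_q n) (K n + 1)) a b c) end.
  { eapply ex3_fun; [|exact HG]. exists 1. split; [lra|]. intros n Hn _.
    destruct (sn_spec n Hn) as [Hs HN].
    rewrite walk_excess_level_succ, (plus_IZR (K n) 1).
    assert (E1 : IZR (K n) = (lam + w n * sn n) / sn n) by (rewrite <- HK by auto; field; lra).
    assert (E2 : IZR (K n + 1 + parity n) = (lam + (w n + 1 + parity_shift n) * sn n) / sn n)
      by (rewrite <- level_succ_x by auto; field; lra).
    rewrite E1, E2, HN. field. lra. }
  pose proof (ex3_plus (ex3_plus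
    (ex3_mult (HC (exp (v * lam)))
      (ex3_minus (ex3_minus (HC 1) HTp)
         (ex3_mult HO HTq1)))
    (ex3_plus HTq HTq1))
    (ex3_mult (ex3_opp (ex_expm1 (- v))) HG')) as HV.
  pose proof (exp_pos (v * lam)) as Hm.
  assert (P1 : phi (lam - drift_p0) = phi (lam - drift_q0) / exp (v * lam)).
  { rewrite <- phi_shift_q, Hmu, Ropp_0, exp_0. field. lra. }
  assert (ET : exp (2 * lam * drift_p0) = / exp (v * lam)).
  { rewrite <- exp_Ropp. f_equal. unfold drift_p0. rewrite Hmu. field. lra. }
  rewrite P1, ET in HV.
  set (m := exp (v * lam)) in *.
  set (g := phi (lam - drift_q0)) in *. set (Fp := Phi (lam - drift_p0)) in *. set (Fq := Phi (lam - drift_q0)) in *.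
  clearbody m g Fp Fq.
  eapply ex3_eq; [|exact HV]. exists 1. split; [lra|]. intros n Hn _. destruct (sn_spec n Hn) as [Hs HN].
  pose proof (up_factor_gt_1 n Hn). cbv beta. split; [|split; [|split]].
  - rewrite up_factor_inv. field. lra.
  - unfold drift_p0, drift_q0. rewrite Hmu. field. lra.
  - destruct (parity_shift_cases n) as [-> | ->]; unfold drift_p0, drift_q0; rewrite Hmu; field; repeat split; lra.
  - unfold tail_correction, local_correction, drift_p2, drift_q2.
    destruct (parity_shift_cases n) as [-> | ->]; unfold drift_p0, drift_q0; rewrite Hmu; field; repeat split; lra.
Qed.

End Model.
End Levels.

(** * The model parameters *)

Section BlackScholes.

Variables (S M r sigma tau : R).
Hypothesis HS : 0 < S.
Hypothesis HSM : S <= M.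
Hypothesis Hr : 0 <= r.
Hypothesis Hsigma : 0 < sigma.
Hypothesis Htau : 0 < tau.

Definition vol : R := sigma * sqrt tau.
Definition drift : R := r * tau.
Definition level : R := ln (M / S) / vol.
(** The least number of net down moves that carries the free walk below 0. For integral [j0] it is
    [j0 + 1], so the gap lies in (0, 1]. *)
Definition top (n : nat) : Z := (Int_part (j0_n S M sigma tau n) + 1)%Z.
Definition gap (n : nat) : R := 1 - fracR (j0_n S M sigma tau n).

Lemma sqrt_tau_pos : 0 < sqrt tau.
Proof. apply sqrt_lt_R0; auto. Qed.

Lemma sqrt_tau_sq : sqrt tau ^ 2 = tau.
Proof. apply pow2_sqrt; lra. Qed.

Lemma vol_pos : 0 < vol.
Proof. apply Rmult_lt_0_compat; [auto|apply sqrt_tau_pos]. Qed.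

Lemma vol_sq : vol ^ 2 = sigma ^ 2 * tau.
Proof. unfold vol. rewrite Rpow_mult_distr, sqrt_tau_sq. reflexivity. Qed.

Lemma dt_sn n : pos_index n -> dt tau n = tau * sn n ^ 2.
Proof.
  intros Hn. destruct (sn_spec n Hn) as [Hs HN]. unfold dt. rewrite HN. field. lra.
Qed.

Lemma sigma_sqrt_dt n : pos_index n -> sigma * sqrt (dt tau n) = vol * sn n.
Proof.
  intros Hn. destruct (sn_spec n Hn) as [Hs HN]. rewrite dt_sn by auto.
  rewrite sqrt_mult_alt, sqrt_pow2 by lra. unfold vol. ring.
Qed.

Lemma u_n_up_factor n : pos_index n -> u_n sigma tau n = up_factor vol n.
Proof. intros Hn. unfold u_n, up_factor. rewrite sigma_sqrt_dt; auto. Qed.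

Lemma q_n_prob_q n : pos_index n -> q_n r sigma tau n = prob_q vol drift n.
Proof.
  intros Hn. unfold q_n, prob_q, d_n. rewrite u_n_up_factor by auto.
  rewrite <- growth_inv. do 3 f_equal. rewrite dt_sn by auto. unfold drift. ring.
Qed.

Lemma j0_level n : pos_index n -> j0_n S M sigma tau n = level / sn n.
Proof.
  intros Hn. destruct (sn_spec n Hn) as [Hs HN]. pose proof vol_pos.
  unfold j0_n, level. rewrite sigma_sqrt_dt by auto. field. lra.
Qed.

Lemma level_nonneg : 0 <= level.
Proof.
  apply Rmult_le_pos; [|left; apply Rinv_0_lt_compat, vol_pos].
  rewrite <- ln_1. apply ln_le; [lra|]. apply Rmult_le_reg_r with S; auto.
  unfold Rdiv. rewrite Rmult_assoc, Rinv_l; lra.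
Qed.

Lemma fracR_bounds x : 0 <= fracR x < 1.
Proof. unfold fracR. destruct (base_Int_part x). lra. Qed.

Lemma gap_bounds n : pos_index n -> 0 <= gap n <= 1.
Proof. intros _. unfold gap. pose proof (fracR_bounds (j0_n S M sigma tau n)). lra. Qed.

Lemma j0_top n : j0_n S M sigma tau n = IZR (top n) - 1 + fracR (j0_n S M sigma tau n).
Proof. unfold top, fracR. rewrite plus_IZR. ring. Qed.

Lemma top_level n : pos_index n -> IZR (top n) * sn n = level + gap n * sn n.
Proof.
  intros Hn. destruct (sn_spec n Hn) as [Hs HN].
  replace (IZR (top n)) with (j0_n S M sigma tau n + gap n)
    by (unfold gap; pose proof (j0_top n); lra).
  rewrite j0_level by auto. field. lra.
Qed.

Lemma top_ge_1 n : pos_index n -> (1 <= top n)%Z.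
Proof.
  intros Hn. destruct (sn_spec n Hn) as [Hs HN].
  assert (0 <= j0_n S M sigma tau n).
  { rewrite j0_level by auto. apply Rmult_le_pos; [apply level_nonneg|].
    left; apply Rinv_0_lt_compat; lra. }
  destruct (base_Int_part (j0_n S M sigma tau n)) as [_ H2]. unfold top.
  assert (-1 < Int_part (j0_n S M sigma tau n))%Z; [apply lt_IZR; lra|lia].
Qed.

Lemma exp_vol_level : exp (vol * level) = M / S.
Proof.
  pose proof vol_pos. unfold level. replace (vol * (ln (M / S) / vol)) with (ln (M / S)) by (field; lra).
  apply exp_ln. apply Rdiv_lt_0_compat; lra.
Qed.

Lemma up_factor_j0 n : pos_index n -> Rpower (up_factor vol n) (IZR (top n) - 1 + fracR (j0_n S M sigma tau n)) = exp (vol * level).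
Proof.
  intros Hn. destruct (sn_spec n Hn) as [Hs HN].
  rewrite <- j0_top, j0_level by auto. unfold Rpower, up_factor. rewrite ln_exp. f_equal. field. lra.
Qed.

Lemma growth_pow_n n : pos_index n -> (/ growth drift n) ^ n = exp (- drift).
Proof.
  intros Hn. destruct (sn_spec n Hn) as [Hs HN]. rewrite <- growth_inv.
  assert (E : forall x m, exp x ^ m = exp (INR m * x)).
  { intros x m. induction m as [|m IH]; [simpl; rewrite Rmult_0_l, exp_0; auto|].
    simpl pow. rewrite IH, S_INR, <- exp_plus. f_equal. ring. }
  rewrite E, HN. f_equal. field. lra.
Qed.

Lemma model_eventually : exists d, 0 < d /\ forall n, pos_index n -> 0 < sn n <= d ->
  growth drift n < up_factor vol n /\ 1 <= growth drift n /\ 1 < up_factor vol n.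
Proof.
  pose proof vol_pos as Hv. assert (Hd : 0 <= drift) by (apply Rmult_le_pos; lra).
  (* [growth < up_factor] amounts to [drift s < vol]; the [+ 1] covers zero drift. *)
  exists (vol / (2 * (drift + 1))). split; [apply Rdiv_lt_0_compat; lra|].
  intros n Hn [Hs Hsd]. split; [|split; [|apply up_factor_gt_1; auto]].
  - apply exp_increasing.
    assert (sn n * (2 * (drift + 1)) <= vol).
    { apply Rmult_le_reg_r with (/ (2 * (drift + 1))); [apply Rinv_0_lt_compat; lra|].
      rewrite Rmult_assoc, Rinv_r by lra. unfold Rdiv in Hsd. lra. }
    replace (drift * sn n ^ 2) with (drift * sn n * sn n) by ring.
    apply Rmult_lt_compat_r; nra.
  - unfold growth. rewrite <- exp_0. destruct Hd as [Hd| <-].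
    + left. apply exp_increasing. apply Rmult_lt_0_compat; auto. apply pow_lt; auto.
    + rewrite Rmult_0_l. lra.
Qed.

(** With [E = 1 / e] these are the hypotheses of the closed forms; [e < u] is what gives [p < 1].
    The formula for [rho = u p / (1 - p)] shows that [rho = 1] exactly when [(u + 1) (e - 1) = 0],
    that is, for zero interest. *)
Lemma model_relations u e : 1 < u -> 1 <= e -> e < u ->
  let p := (e - / u) / (u - / u) in let q := (u - / e) / (u - / u) in
  0 < p < 1 /\ 1 - p = (u - e) / (u - / u) /\ q = p * u * / e /\ 1 - q = (1 - p) / u * / e /\
  u * (p / (1 - p)) = (u * e - 1) / (u - e) /\ 0 < u - / u.
Proof.
  intros Hu He Heu p q.
  assert (Hi : / u < 1) by (rewrite <- Rinv_1; apply Rinv_lt_contravar; lra).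
  assert (Hd : 0 < u - / u) by lra.
  assert (Hd2 : u * u - 1 <> 0) by nra.
  assert (E1 : 1 - p = (u - e) / (u - / u)) by (unfold p; field; lra).
  assert (H1 : 0 < 1 - p) by (rewrite E1; apply Rdiv_lt_0_compat; lra).
  assert (H2 : 0 < p) by (apply Rdiv_lt_0_compat; lra).
  split; [lra|split; [auto|]]. rewrite E1.
  split; [|split; [|split; [|auto]]]; unfold p, q; field; repeat split; lra.
Qed.

Lemma P_fl_closed_pos : 0 < r -> exists d, 0 < d /\ forall n, pos_index n -> 0 < sn n <= d ->
  let u := up_factor vol n in let e := growth drift n in
  let p := prob_p vol drift n in let q := prob_q vol drift n in
  let c := (u - 1) * (1 - e / u) / ((u + 1) * (e - 1)) in
  let crho := (u - 1) * (e - / u) / ((u + 1) * (e - 1)) in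
  P_fl S M r sigma tau n = S * (exp (- drift) * exp (vol * level)
      * (1 - walk_tail n p (top n)
         - Rpower (p / (1 - p)) (IZR (top n)) * walk_tail n (1 - p) (top n + 1))
    + (walk_tail n q (top n) + c * walk_tail n q (top n + 1))
    + (1 - crho) * (exp (- drift) * (Rpower u (IZR (top n)) * Rpower (p / (1 - p)) (IZR (top n)))
       * walk_tail n (1 - p) (top n + 1)) - 1).
Proof.
  intros Hr0. destruct model_eventually as [d [Hd H]]. exists d. split; auto.
  intros n Hn Hs u e p q c crho. destruct (H n Hn Hs) as [H1 [H2 H3]].
  fold u e in H1, H2, H3.
  assert (He : 1 < e).
  { unfold e, growth. rewrite <- exp_0. apply exp_increasing.
    apply Rmult_lt_0_compat; [apply Rmult_lt_0_compat; auto|apply pow_lt; lra]. }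
  destruct (model_relations u e H3 H2 H1) as [Hp [Ep [Eq [Eq1 [Erho Hden]]]]].
  change ((e - / u) / (u - / u)) with p in *. change ((u - / e) / (u - / u)) with q in *.
  rewrite P_fl_reflected_mean, u_n_up_factor, q_n_prob_q by auto. fold u q.
  f_equal. f_equal. rewrite j0_top.
  assert (Hne : u * (p / (1 - p)) <> 1).
  { rewrite Erho. intros E. apply (f_equal (fun x => x * (u - e))) in E.
    unfold Rdiv in E. rewrite Rmult_assoc, Rinv_l in E by lra. nra. }
  rewrite (reflected_mean_closed u p q (/ e) n (top n)); auto; try lra.
  2:{ apply top_ge_1; auto. }
  2:{ apply fracR_bounds. }
  unfold u at 1. rewrite up_factor_j0 by auto. unfold e at 1 2. rewrite growth_pow_n by auto.
  rewrite <- Rpower_mult_distr by (try apply Rdiv_lt_0_compat; lra).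
  rewrite Erho.
  assert (Ec : (1 - / u) / ((u * e - 1) / (u - e) - 1) = c).
  { unfold c. field. repeat split; try lra; nra. }
  assert (Ecr : c * ((u * e - 1) / (u - e)) = crho).
  { unfold c, crho. field. repeat split; try lra; nra. }
  rewrite Ec, Ecr. reflexivity.
Qed.

Lemma P_fl_closed_zero : r = 0 -> exists d, 0 < d /\ forall n, pos_index n -> 0 < sn n <= d ->
  let u := up_factor vol n in
  let p := prob_p vol drift n in let q := prob_q vol drift n in
  P_fl S M r sigma tau n = S * (exp (vol * level)
      * (1 - walk_tail n p (top n)
         - Rpower (p / (1 - p)) (IZR (top n)) * walk_tail n q (top n + 1))
    + (walk_tail n q (top n) + walk_tail n q (top n + 1))
    + (1 - / u) * walk_excess n q (top n + 1) - 1).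
Proof.
  intros Hr0. destruct model_eventually as [d [Hd H]]. exists d. split; auto.
  intros n Hn Hs u p q. destruct (H n Hn Hs) as [H1 [H2 H3]].
  fold u in H1, H3.
  assert (He : growth drift n = 1).
  { unfold growth, drift. rewrite Hr0, !Rmult_0_l, exp_0. reflexivity. }
  rewrite He in H1, H2.
  destruct (model_relations u 1 H3 H2 H1) as [Hp [Ep [Eq [Eq1 [Erho Hden]]]]].
  assert (Epp : p = (1 - / u) / (u - / u)) by (unfold p, prob_p; rewrite He; reflexivity).
  assert (Eqq : q = (u - / 1) / (u - / u)) by (unfold q, prob_q; rewrite He; reflexivity).
  rewrite <- Epp in *. rewrite <- Eqq in *. rewrite Rinv_1, Rmult_1_r in Eq, Eq1.
  rewrite P_fl_reflected_mean, u_n_up_factor, q_n_prob_q by auto. fold u q.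
  f_equal. f_equal. rewrite j0_top.
  rewrite (reflected_mean_closed_zero u p q n (top n)); auto; try lra.
  - unfold u at 1. rewrite up_factor_j0 by auto. reflexivity.
  - rewrite Erho. field. lra.
  - apply top_ge_1; auto.
  - apply fracR_bounds.
Qed.

Lemma ln_SM : ln (S / M) = - (vol * level).
Proof.
  pose proof vol_pos. replace (S / M) with (/ (M / S)) by (field; lra).
  rewrite ln_Rinv by (apply Rdiv_lt_0_compat; lra). unfold level. field. lra.
Qed.

Lemma d1_model : Defs.d1 S M r sigma tau = - (level - drift_q0 vol drift).
Proof.
  pose proof vol_pos as Hv. unfold Defs.d1. rewrite ln_SM.
  replace ((r + sigma ^ 2 / 2) * tau) with (drift + vol ^ 2 / 2)
    by (rewrite vol_sq; unfold drift; field).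
  fold vol. unfold drift_q0. field. lra.
Qed.

Lemma d2_model : Defs.d2 S M r sigma tau = - (level - drift_p0 vol drift).
Proof.
  pose proof vol_pos as Hv. unfold Defs.d2. rewrite d1_model. fold vol. unfold drift_q0, drift_p0. field. lra.
Qed.

Lemma d3_model : - Defs.d3 S M r sigma tau = - (level - - drift_p0 vol drift).
Proof.
  pose proof vol_pos as Hv. unfold Defs.d3. rewrite d1_model.
  replace (2 * r / sigma * sqrt tau) with (2 * drift / vol).
  - unfold drift_q0, drift_p0. field. lra.
  - unfold drift, vol. pose proof sqrt_tau_pos. rewrite <- sqrt_tau_sq at 1. field. lra.
Qed.

Lemma d4_model : Defs.d4 S M r sigma tau = level + drift_q0 vol drift.
Proof.
  pose proof vol_pos as Hv. unfold Defs.d4.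
  replace (Defs.d3 S M r sigma tau) with (level - - drift_p0 vol drift) by (pose proof d3_model; lra).
  fold vol. unfold drift_q0, drift_p0. field. lra.
Qed.

Lemma B1_model : Defs.B1 S M r sigma tau = 1 - Phi (level - drift_q0 vol drift).
Proof. unfold Defs.B1. rewrite d1_model. apply Phi_opp. Qed.

Lemma B2_model : Defs.B2 S M r sigma tau = exp (- drift) * Phi (level - drift_p0 vol drift).
Proof.
  unfold Defs.B2. rewrite d2_model, Ropp_involutive. f_equal. f_equal. unfold drift. ring.
Qed.

Lemma r_over_sigma2 : r / sigma ^ 2 = drift / vol ^ 2.
Proof. rewrite vol_sq. unfold drift. field. lra. Qed.

Lemma B3_model : Defs.B3 S M r sigma tau = exp (- drift) * exp (2 * level * drift / vol)
  * (1 - Phi (level - - drift_p0 vol drift)).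
Proof.
  pose proof vol_pos as Hv. unfold Defs.B3. rewrite d3_model, Phi_opp. f_equal.
  f_equal; [f_equal; unfold drift; ring|].
  unfold Rpower. rewrite ln_SM. f_equal.
  replace (2 * r / sigma ^ 2) with (2 * (r / sigma ^ 2)) by (field; lra).
  rewrite r_over_sigma2. field. lra.
Qed.

Lemma M_model : M = S * exp (vol * level).
Proof. rewrite exp_vol_level. field. lra. Qed.

(** [M] supplies [exp (vol level)], which combines with the power of [S / M] and the exponent in
    [d1] and [d4] into [- d1^2 / 2]. *)
Lemma B4_model : M * Defs.B4 S M r sigma tau = S * (vol * phi (level - drift_q0 vol drift)).
Proof.
  pose proof vol_pos as Hv. unfold Defs.B4. fold vol. rewrite M_model at 1.
  rewrite d1_model, d4_model. unfold Rpower. rewrite ln_SM.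
  unfold phi, gauss. pose proof sqrt_2PI_pos.
  assert (E : exp (vol * level) * exp ((1 - 2 * r / sigma ^ 2) / 2 * - (vol * level))
     * exp (- / 4 * ((- (level - drift_q0 vol drift)) ^ 2 + (level + drift_q0 vol drift) ^ 2))
     = exp (- (level - drift_q0 vol drift) ^ 2 / 2)).
  { rewrite <- !exp_plus. f_equal.
    replace (2 * r / sigma ^ 2) with (2 * (r / sigma ^ 2)) by (field; lra).
    rewrite r_over_sigma2. unfold drift_q0. field. lra. }
  rewrite <- E. field. lra.
Qed.

(** [x (1 - x)] is invariant under [x -> 1 - x], so the gap may replace the fractional part. *)
Lemma kappa_model n : kappa_n S M sigma tau n = gap n * (1 - gap n).
Proof. unfold kappa_n, gap. ring. Qed.

Lemma inv_sqrt_sn n : 1 / sqrt (INR n) = sn n.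
Proof. unfold sn, Rdiv. ring. Qed.

Lemma inv_sn n : pos_index n -> 1 / INR n = sn n ^ 2.
Proof. intros Hn. destruct (sn_spec n Hn) as [Hs HN]. rewrite HN. field. lra. Qed.

(** The error [s^3] is [1 / (n sqrt n)], and a bound for small [s] is one for all large [n]. *)
Lemma bigO_n32_of_ex3 F G a b c : ex3 sn pos_index F a b c ->
  (forall n, pos_index n -> G n = a n + b n * sn n + c n * sn n ^ 2) -> bigO_n32 F G.
Proof.
  intros [_ [_ [_ [C [d [Hd [HC H]]]]]]] HG.
  destruct (sn_small d Hd) as [N HN]. exists C, N. intros n Hn.
  destruct (HN n Hn) as [H1 H2]. rewrite HG by auto.
  eapply Rle_trans; [apply H; auto|]. right. unfold Rdiv. f_equal.
  rewrite Rinv_mult. fold (sn n). replace (/ INR n) with (sn n ^ 2); [ring|].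
  destruct (sn_spec n H1) as [_ ->]. rewrite Rinv_inv. reflexivity.
Qed.

Lemma theta1_model : 0 < r -> theta1 r sigma = 1 + vol ^ 2 / (2 * drift).
Proof. intros. unfold theta1. rewrite vol_sq. unfold drift. field. lra. Qed.

Lemma theta2_model : 0 < r -> theta2 r sigma = 1 - vol ^ 2 / (2 * drift).
Proof. intros. unfold theta2. rewrite vol_sq. unfold drift. field. lra. Qed.

Lemma T1_model n : 0 < r -> Defs.T1 S M r sigma tau n =
  12 * drift / vol ^ 2 * (1 - vol ^ 2 / (2 * drift)) * (gap n * (1 - gap n))
  + (1 + 4 * drift ^ 2 / vol ^ 4) * (vol * level).
Proof.
  intros. unfold Defs.T1. rewrite theta2_model, kappa_model, ln_SM by auto.
  replace (12 * r / sigma ^ 2) with (12 * (r / sigma ^ 2)) by (field; lra).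
  replace (4 * r ^ 2 / sigma ^ 4) with (4 * (r / sigma ^ 2) ^ 2) by (field; lra).
  rewrite r_over_sigma2. pose proof vol_pos. field. split; [lra|].
  apply Rgt_not_eq, Rmult_lt_0_compat; auto.
Qed.

Lemma T2_model n : Defs.T2 S M r sigma tau n =
  1 / 2 + gap n * (1 - gap n) - (level + drift_q0 vol drift) * level / 6.
Proof.
  unfold Defs.T2. rewrite kappa_model, d4_model, ln_SM.
  pose proof vol_pos.
  replace (6 * sigma * sqrt tau) with (6 * vol) by (unfold vol; ring). field. lra.
Qed.

Lemma expansion_pos_correct : 0 < r ->
  bigO_n32 (fun n => P_fl S M r sigma tau n) (fun n => expansion_pos S M r sigma tau n).
Proof.
  intros Hr0. pose proof vol_pos as Hv.
  assert (Hmu : 0 < drift) by (apply Rmult_lt_0_compat; auto).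
  pose proof (price_expansion_pos top level gap top_level gap_bounds vol drift Hv Hmu) as H.
  cbv zeta in H.
  pose proof (ex3_mult (ex3_const sn pos_index S)
    (ex3_minus H (ex3_const sn pos_index 1))) as HP.
  eapply bigO_n32_of_ex3.
  - eapply ex3_fun; [|exact HP]. destruct (P_fl_closed_pos Hr0) as [d [Hd HC]].
    exists d. split; auto. intros n Hn Hs. symmetry. apply HC; auto.
  - intros n Hn. cbv beta. unfold expansion_pos, PBS_pos.
    replace (M * Defs.T2 S M r sigma tau n * Defs.B4 S M r sigma tau)
      with (Defs.T2 S M r sigma tau n * (M * Defs.B4 S M r sigma tau)) by ring.
    rewrite B1_model, B2_model, B3_model, B4_model, T1_model, T2_model, theta1_model,
      theta2_model, inv_sqrt_sn, inv_sn, exp_vol_level by auto.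
    fold vol. rewrite <- vol_sq. field. repeat split; lra.
Qed.

Lemma expansion_zero_correct : r = 0 ->
  bigO_n32 (fun n => P_fl S M r sigma tau n) (fun n => expansion_zero S M r sigma tau n).
Proof.
  intros Hr0. pose proof vol_pos as Hv. pose proof sqrt_tau_pos as Ht.
  assert (Hmu : drift = 0) by (unfold drift; rewrite Hr0; ring).
  pose proof (price_expansion_zero top level gap top_level gap_bounds vol drift Hv Hmu) as H.
  pose proof (ex3_mult (ex3_const sn pos_index S)
    (ex3_minus H (ex3_const sn pos_index 1))) as HP.
  eapply bigO_n32_of_ex3.
  - eapply ex3_fun; [|exact HP]. destruct (P_fl_closed_zero Hr0) as [d [Hd HC]].
    exists d. split; auto. intros n Hn Hs. symmetry. apply HC; auto.
  - intros n Hn. cbv beta. unfold expansion_zero, PBS_zero.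
    assert (EB4 : B4s S M r sigma tau = vol * phi (level - drift_q0 vol drift)).
    { unfold B4s. fold vol. rewrite d1_model. unfold phi, gauss.
      replace (- (- (level - drift_q0 vol drift)) ^ 2 / 2) with (- (level - drift_q0 vol drift) ^ 2 / 2) by field.
      unfold Rdiv. ring. }
    assert (EB3 : B3s S M r sigma tau
      = (- (vol * level) + vol ^ 2 / 2) * (1 - Phi (level - drift_q0 vol drift))).
    { unfold B3s. rewrite <- B1_model, ln_SM, <- vol_sq. reflexivity. }
    assert (ET2 : T2s S M r sigma tau n = 1 / 2 + gap n * (1 - gap n) + vol ^ 2 / 12
      + (drift_p0 vol drift - level) * level / 6).
    { unfold T2s. rewrite kappa_model, d2_model, ln_SM, <- vol_sq.
      replace (6 * sigma * sqrt tau) with (6 * vol) by (unfold vol; ring). field. lra. }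
    rewrite B1_model, B2_model, EB3, EB4, ET2, kappa_model, inv_sqrt_sn, inv_sn, exp_vol_level, Hmu by auto.
    rewrite Ropp_0, exp_0. fold vol. rewrite <- vol_sq. field. lra.
Qed.

End BlackScholes.

Theorem theorem4p3 (T t r sigma S M : R)
  (hT : 0 < T) (ht0 : 0 <= t) (htT : t < T) (hr : 0 <= r) (hsigma : 0 < sigma)
  (hS : 0 < S) (hSM : S <= M) :
  (0 < r ->
     bigO_n32 (fun n => P_fl S M r sigma (T - t) n)
              (fun n => expansion_pos S M r sigma (T - t) n)) /\
  (r = 0 ->
     bigO_n32 (fun n => P_fl S M r sigma (T - t) n)
              (fun n => expansion_zero S M r sigma (T - t) n)).
Proof.
  assert (Htau : 0 < T - t) by lra.
  split; intros Hr.
  - apply expansion_pos_correct; auto.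
  - apply expansion_zero_correct; auto.
Qed.
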